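(* Let $0\le \ell<k$ be integers and $\mathcal F$ a (possibly infinite) family of $k$-graphs, and let $\gamma:=\gamma^+_\ell(\mathcal F)$. Then: (1) $\gamma$ equals the supremum of $\delta^+_\ell(W)$ over all $\mathcal F$-free $k$-hypergraphons $W$, and this supremum is attained (it is a maximum); (2) a $k$-hypergraphon $W$ belongs to $\mathcal W^+_\ell(\mathcal F)$ if and only if $W$ is $\mathcal F$-free and $\delta^+_\ell(W)=\gamma$.
   Context: A $k$-graph $G$ is a pair $(V(G),E(G))$ with $E(G)$ a set of $k$-subsets of the finite set $V(G)$; $\deg_L(G)$ is the number of edges containing $L\subseteq V(G)$. The minimum positive $\ell$-degree $\delta^+_\ell(G)$ of a $k$-graph with at least one edge is the maximum $m$ such that every $\ell$-subset of $V(G)$ lies in no edges or in at least $m$ edges; if $G$ has no edges, $\delta^+_\ell(G):=0$. $G$ is $\mathcal F$-free if it contains no member of $\mathcal F$ as a subgraph. $\mathrm{co^{+}ex}_\ell(n,\mathcal F)$ is the maximum of $\delta^+_\ell(G)$ over $\mathcal F$-free $k$-graphs on $n$ vertices, and $\gamma^+_\ell(\mathcal F):=\limsup_{n\to\infty}\mathrm{co^{+}ex}_\ell(n,\mathcal F)/\binom{n-\ell}{k-\ell}$. For a finite set $A$ and $m\ge1$, $\binom{A}{\le m}$ denotes the family of nonempty subsets of $A$ of size at most $m$; $r(A)$ denotes all nonempty subsets of $A$ and $r_<(A)$ all nonempty proper subsets of $A$; $r[m]:=r([m])$, $r_<[m]:=r_<([m])$. For a vector $\mathbf x=(x_B)_B$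 and a family $\mathcal A$ of index sets, $\mathbf x_{\mathcal A}$ is its restriction to indices in $\mathcal A$. A $k$-hypergraphon is a Lebesgue measurable function $W:[0,1]^{r_<[k]}\to[0,1]$ that is symmetric, i.e. invariant under the natural action of the permutations of $[k]$ on the coordinates indexed by $r_<[k]$ (so $W(\mathbf x_{r_<(A)})$ is well defined for any $k$-set $A$ via any bijection $A\to[k]$). The homomorphism density of a $k$-graph $F$ in $W$ is $t(F,W):=\int_{[0,1]^{\binom{V(F)}{\le k-1}}}\prod_{A\in E(F)}W(\mathbf x_{r_<(A)})\,d\mathbf x$. $W$ is $\mathcal F$-free if $t(F,W)=0$ for all $F\in\mathcal F$. For a $k$-graph $G$, $t(F,G)$ is the probability that a uniformly random map $V(F)\to V(G)$ sends every edge of $F$ to an edge of $G$. A sequence $(G_n)$ of $k$-graphs converges to $W$ if $t(F,G_n)\to t(F,W)$ for every $k$-graph $F$. For $\mathbf x\in[0,1]^{r[\ell]}$ (for $\ell=0$ this is a single point), the degree is $\deg_W(\mathbf x):=\int_{[0,1]^{r_<[k]\setminus r[\ell]}}W(\mathbf x_{r_<[k]})\,d\mathbf x_{r_<[k]\setminus r[\ell]}$, where the new coordinates are integrated over $[0,1]$ (set to $0$ where the integral is undefined). $W$ is non-zero if $\{W>0\}$ has positive measure. For non-zero $W$, $\delta^+_\ell(W)$ is the essential infimum of $\deg_W(\mathbf x)$ over $\mathbf x\in[0,1]^{r[\ell]}$ with $\deg_W(\mathbf x)>0$ (i.e. the supremum over null sets $A$ of $\inf\{\deg_W(\mathbf x):\mathbf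 x\notin A,\ \deg_W(\mathbf x)>0\}$); for zero $W$, $\delta^+_\ell(W):=0$. $\mathcal W^+_\ell(\mathcal F)$ is the set of $k$-hypergraphons $W$ that are limits of some sequence $(G_n)$ of $\mathcal F$-free $k$-graphs with $|V(G_n)|\to\infty$ and $\delta^+_\ell(G_n)=(\gamma^+_\ell(\mathcal F)+o(1))\binom{|V(G_n)|-\ell}{k-\ell}$. *)

(* Defs.v *)
From HB Require Import structures.
From mathcomp Require Import all_boot all_order all_algebra.
From mathcomp Require Import fingroup perm.
From mathcomp Require Import all_classical all_reals all_analysis.

Set Implicit Arguments.
Unset Strict Implicit.
Unset Printing Implicit Defensive.

Import Order.TTheory GRing.Theory Num.Theory.
Import numFieldNormedType.Exports.

Local Open Scope classical_set_scope.
Local Open Scope ring_scope.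

Record kgraph (k : nat) := KGraph {
  kv : nat ;
  kE : {set {set 'I_kv}} ;
  kunif : [forall A in kE, #|A| == k] }.

Definition kdeg (k : nat) (G : kgraph k) (L : {set 'I_(kv G)}) : nat :=
  #|[set A in kE G | L \subset A]|.

(* minimum positive l-degree: the maximum m such that every l-subset lies in
   no edge or in at least m edges (0 if G has no edges; note any m works only
   if it is <= #|E|, since some l-set lies in an edge as soon as E <> set0). *)
Definition kdelta (k l : nat) (G : kgraph k) : nat :=
  (\max_(m < #|kE G|.+1 |
      [forall L : {set 'I_(kv G)},
         (#|L| == l) ==> ((kdeg L == 0) || (m <= kdeg L))]) m)%N.

Definition kcontains (k : nat) (G F : kgraph k) : Prop :=
  exists f : 'I_(kv F) -> 'I_(kv G),
    injective f /\ forall A, A \in kE F -> f @: A \in kE G.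

Definition kfree (k : nat) (Fam : kgraph k -> Prop) (G : kgraph k) : Prop :=
  forall F, Fam F -> ~ kcontains G F.

Definition tG (R : realType) (k : nat) (F G : kgraph k) : R :=
  (#|[set f : {ffun 'I_(kv F) -> 'I_(kv G)} |
       [forall A in kE F, ((fun x => f x) @: A) \in kE G]]|%:R)
  / ((kv G ^ kv F)%N%:R).

(* co^+ex_l(n, Fam) : maximum of delta^+_l over Fam-free k-graphs on n
   vertices (a finite nonempty set of naturals, so sup = max). *)
Definition coex (R : realType) (k l : nat) (Fam : kgraph k -> Prop) (n : nat)
  : R :=
  sup [set ((kdelta l G)%:R : R) | G in [set G : kgraph k | kv G = n /\ kfree Fam G]].

Definition gammaP (R : realType) (k l : nat) (Fam : kgraph k -> Prop) : \bar R :=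
  limn_esup (fun n => (coex R l Fam n / ('C(n - l, k - l))%:R)%:E).

Definition incube (R : realType) (I : Type) (x : I -> R) : Prop :=
  forall i, 0 <= x i <= 1.

Definition cube (R : realType) (I : Type) : set (I -> R) := [set x | incube x].

(* Iterated Lebesgue integral over [0,1] of the coordinates listed in s,
   the remaining coordinates being those of x. (By Tonelli this is the
   integral over [0,1]^s w.r.t. the product Lebesgue measure for the
   nonnegative integrands used below.) *)
Fixpoint iint (R : realType) (I : eqType) (s : seq I) (f : (I -> R) -> \bar R)
  (x : I -> R) : \bar R :=
  match s with
  | [::] => f x
  | i :: s' => (\int[@lebesgue_measure R]_(t in [set t : R | (0 <= t <= 1)%R])
                  iint s' f (fun j => (if j == i then t else x j)%R))%E
  end.

Definition coord_sets (R : realType) (I : Type) : set (set (I -> R)) :=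
  [set S | exists (i : I) (A : set R), measurable A /\
                                     S = (fun x : I -> R => x i) @^-1` A].

Definition borelI (R : realType) (I : Type) : set (set (I -> R)) :=
  <<s (@coord_sets R I) >>.

(* Lebesgue (product) measure of S inter [0,1]^I, for Borel S *)
Definition vol (R : realType) (I : finType) (S : set (I -> R)) : \bar R :=
  iint (enum I) (fun x => (\1_S x)%:E) (fun _ => 0).

Definition null (R : realType) (I : finType) (S : set (I -> R)) : Prop :=
  exists N, @borelI R I N /\ vol N = 0%E /\ S `&` @cube R I `<=` N.

Definition lmeas_set (R : realType) (I : finType) (S : set (I -> R)) : Prop :=
  exists B, @borelI R I B /\ null ((S `\` B) `|` (B `\` S)).

Definition lmeas_fun (R : realType) (I : finType) (f : (I -> R) -> R) : Prop :=
  forall A : set R, measurable A -> lmeas_set (@cube R I `&` f @^-1` A).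

Definition rlt (k : nat) := {B : {set 'I_k} | (B != finset.set0) && (B != [set: 'I_k]%SET)}.

Definition rle (k l : nat) :=
  {B : {set 'I_k} | (B != finset.set0) && (B \subset [set i : 'I_k | (i < l)%N])}.

Definition permpt (R : realType) (k : nat) (s : {perm 'I_k}) (x : rlt k -> R)
  : rlt k -> R :=
  fun B => oapp x 0 (insub (s @: val B) : option (rlt k)).

Definition hypergraphon (R : realType) (k : nat) (W : (rlt k -> R) -> R) : Prop :=
  [/\ lmeas_fun W,
      (forall x, incube x -> 0 <= W x <= 1) &
      (forall (s : {perm 'I_k}) x, incube x -> W (permpt s x) = W x)].

(* For an edge A (a k-set) of F and x in [0,1]^{binom(V(F), <= k-1)},
   x_{r_<(A)} transported to [0,1]^{r_<[k]} through the bijection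
   [k] -> A, i |-> i-th element of enum A. *)
Definition img_set (n : nat) (A : {set 'I_n}) (k : nat) (B : {set 'I_k})
  : {set 'I_n} :=
  [set a in A | [exists i in B, nat_of_ord i == index a (enum A)]].

Definition pull (R : realType) (n k : nat) (A : {set 'I_n}) (x : {set 'I_n} -> R)
  : rlt k -> R :=
  fun B => x (img_set A (val B)).

Definition tW (R : realType) (k : nat) (F : kgraph k) (W : (rlt k -> R) -> R) : R :=
  fine (iint (enum [pred B : {set 'I_(kv F)} | (B != finset.set0) && (#|B| < k)%N])
          (fun x => (\prod_(A in kE F) W (pull A x))%:E) (fun _ => 0)).

Definition Wfree (R : realType) (k : nat) (Fam : kgraph k -> Prop)
  (W : (rlt k -> R) -> R) : Prop :=
  forall F, Fam F -> tW F W = 0.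

Definition degW (R : realType) (k l : nat) (W : (rlt k -> R) -> R)
  (x : rle k l -> R) : R :=
  fine (iint (enum [pred B : rlt k |
                  ~~ (val B \subset [set i : 'I_k | (i < l)%N])])
          (fun y => (W y)%:E)
          (fun B => oapp x 0 (insub (val B) : option (rle k l)))).

Definition Wzero (R : realType) (k : nat) (W : (rlt k -> R) -> R) : Prop :=
  null [set x | 0 < W x].

Definition deltaW (R : realType) (k l : nat) (W : (rlt k -> R) -> R) : \bar R :=
  if `[< Wzero W >] then 0%E
  else ereal_sup
         [set ereal_inf
                [set (degW W x)%:E | x in
                   [set x | incube x /\ ~ A x /\ 0 < degW W x]]
         | A in [set A : set (rle k l -> R) | null A]].

Definition WplusP (R : realType) (k l : nat) (Fam : kgraph k -> Prop)
  (W : (rlt k -> R) -> R) : Prop :=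
  exists G : nat -> kgraph k,
    [/\ (forall n, kfree Fam (G n)),
        (forall M : nat, exists N : nat, forall n, (N <= n)%N -> (M <= kv (G n))%N),
        (fun n => ((kdelta l (G n))%:R / ('C(kv (G n) - l, k - l))%:R : R)%:E)
          @ \oo --> gammaP R l Fam &
        (forall F : kgraph k, (fun n => tG R F (G n)) @ \oo --> tW F W)].

(* Main.v *)
Require Import Defs.
From HB Require Import structures.
From mathcomp Require Import all_boot all_order all_algebra.
From mathcomp Require Import fingroup perm.
From mathcomp Require Import all_classical all_reals all_analysis.
From mathcomp Require Import measurable_realfun.
From mathcomp Require Import zify ring lra.

(* Compactness. Along an ultrafilter, uniformly random maps into the graphs of a sequence
   define a dissociated exchangeable law on finite set systems. Such a law is represented by
   a hypergraphon, built one dimension at a time: adding infinitely many reference vertices,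
   the sets with a given trace [A] of size [j] become conditionally independent, given the
   smaller traces, from everything not containing [A] (an energy argument over growing sets
   of reference vertices), so their conditional law can be realized by a fresh coordinate
   [x_A].

   Degrees in the limit. The moments of the [l]-degree are densities of a family of [k]-sets
   sharing an [l]-set, so they pass to the limit. Normalized degrees in the graphs avoid
   ]0, c'[ with c' -> c, and the expectations of large powers of 1 + t (c - t) show that
   the degree of the limit avoids ]0, c[.

   Sampling. The random graph with edge set {A : x_A < W(x restricted to the subsets of A)}
   is almost surely free, its densities concentrate by the second moment method, and the
   degree of an [l]-set, conditionally on the coordinates below it, is an average over
   placements of sums of independent indicators; a Chernoff bound then controls all the
   [l]-sets at once. *)

Set Implicit Arguments.
Unset Strict Implicit.
Unset Printing Implicit Defensive.

Import Order.TTheory GRing.Theory Num.Theory.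
Import numFieldNormedType.Exports.

Local Open Scope classical_set_scope.
Local Open Scope ring_scope.

(** * Expectations of bounded measurable functions *)

(** A representation on [k]-sets has two coordinates that a hypergraphon lacks. The coordinate of a
    [k]-set itself is averaged out into the value of [W]. The coordinate of the empty set, which
    mixes different limits, is frozen at a typical value; dissociation makes the variance of every
    density over that coordinate vanish. Sets of degree 0 are ignored by the positive minimum
    degree, so this atom must be kept apart in both directions. In the limit, the gap above 0 has to
    survive and [W] must not collapse to 0: a positive degree threshold forces a positive edge
    density. In a sample, a set of conditional degree 0 must not pick up stray edges: almost surely
    it lies in none. For the other [l]-sets, linearly many extensions, disjoint outside the set, are
    conditionally independent, so failure is exponentially unlikely and beats the polynomial number
    of [l]-sets. Since [W] is only Lebesgue measurable while the integrals are iterated and total,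
    everything is first transferred to a Borel version that is symmetric at every point. *)

Definition bmf (R : realType) d (T : measurableType d) (f : T -> R) :=
  measurable_fun setT f /\ exists M : R, forall x, `|f x| <= M.

Definition EE (R : realType) d (T : measurableType d) (P : probability T R)
  (f : T -> R) : R := \int[P]_x f x.

Lemma indic_bool (R : realType) (T : Type) (b : T -> bool) x :
  \1_[set x | b x] x = (b x)%:R :> R.
Proof.
rewrite indicE; case: (boolP (b x)) => bx; first by rewrite mem_set.
by rewrite memNset//=; exact/negP.
Qed.

Section bmf_closure.
Context (R : realType) d (T : measurableType d).
Implicit Types f g : T -> R.

Lemma eq_bmf f g : f =1 g -> bmf f -> bmf g.
Proof. by move=> /funext ->. Qed.

Lemma bmf_cst (c : R) : bmf (fun _ : T => c).
Proof. by split; [exact: measurable_cst|exists `|c|]. Qed.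

Lemma bmfD f g : bmf f -> bmf g -> bmf (fun x => f x + g x).
Proof.
move=> [mf [M fM]] [mg [N gN]]; split; first exact: measurable_funD.
by exists (M + N) => x; rewrite (le_trans (ler_normD _ _))// lerD.
Qed.

Lemma bmfM f g : bmf f -> bmf g -> bmf (fun x => f x * g x).
Proof.
move=> [mf [M fM]] [mg [N gN]]; split; first exact: measurable_funM.
by exists (M * N) => x; rewrite normrM ler_pM.
Qed.

Lemma bmfN f : bmf f -> bmf (fun x => - f x).
Proof.
by move=> [mf [M fM]]; split; [exact: measurableT_comp|exists M => x; rewrite normrN].
Qed.

Lemma bmfB f g : bmf f -> bmf g -> bmf (fun x => f x - g x).
Proof. by move=> bf bg; apply: bmfD => //; exact: bmfN. Qed.

Lemma bmfZ (c : R) f : bmf f -> bmf (fun x => c * f x).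
Proof. exact: bmfM (bmf_cst c). Qed.

Lemma bmfX f n : bmf f -> bmf (fun x => f x ^+ n).
Proof.
move=> bf; elim: n => [|n IH]; first exact: bmf_cst.
by under eq_fun do rewrite exprS; exact: bmfM.
Qed.

Lemma bmf_norm f : bmf f -> bmf (fun x => `|f x|).
Proof.
move=> [mf [M fM]]; split; first exact: measurableT_comp.
by exists M => x; rewrite normr_id.
Qed.

Lemma bmf_sum (J : Type) (s : seq J) (Q : pred J) (F : J -> T -> R) :
  (forall j, Q j -> bmf (F j)) -> bmf (fun x => \sum_(j <- s | Q j) F j x).
Proof.
move=> bF; elim: s => [|j s IH].
  by apply: eq_bmf (bmf_cst _) => ?; rewrite big_nil.
apply: (@eq_bmf (fun x : T => if Q j then F j x + \sum_(i <- s | Q i) F i x else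
   \sum_(i <- s | Q i) F i x)) => [x|]; first by rewrite big_cons.
by case: (Q j) (bF j) => // /(_ isT) bFj; exact: bmfD.
Qed.

Lemma bmf_prod (J : Type) (s : seq J) (Q : pred J) (F : J -> T -> R) :
  (forall j, Q j -> bmf (F j)) -> bmf (fun x => \prod_(j <- s | Q j) F j x).
Proof.
move=> bF; elim: s => [|j s IH].
  by apply: eq_bmf (bmf_cst _) => ?; rewrite big_nil.
apply: (@eq_bmf (fun x : T => if Q j then F j x * \prod_(i <- s | Q i) F i x else
   \prod_(i <- s | Q i) F i x)) => [x|]; first by rewrite big_cons.
by case: (Q j) (bF j) => // /(_ isT) bFj; exact: bmfM.
Qed.

Lemma bmf_bool (b : T -> bool) : measurable [set x | b x] ->
  bmf (fun x => (b x)%:R : R).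
Proof.
move=> mb; split; last by exists 1 => x; case: (b x); rewrite ?normr1 ?normr0.
rewrite (_ : (fun x => _) = \1_[set x | b x]); first exact: measurable_indic.
by apply/funext => x; rewrite indic_bool.
Qed.

End bmf_closure.

Lemma bmf_comp (R : realType) d d' (T : measurableType d) (T' : measurableType d')
  (f : T' -> R) (h : T -> T') : measurable_fun setT h -> bmf f ->
  bmf (fun x => f (h x)).
Proof.
move=> mh [mf [M fM]]; split; first exact: measurableT_comp mf mh.
by exists M.
Qed.

Section expectation.
Context (R : realType) d (T : measurableType d) (P : probability T R).
Implicit Types f g : T -> R.

Lemma bmf_integrable f : bmf f -> P.-integrable setT (EFin \o f).
Proof.
move=> [mf [M fM]].
have iM : P.-integrable setT (EFin \o cst M) by exact: finite_measure_integrable_cst.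
apply: le_integrable iM => //; first exact/measurable_EFinP.
by move=> x _ /=; rewrite lee_fin (le_trans (fM x))// ler_norm.
Qed.

Lemma EE_EFin f : bmf f -> (\int[P]_x (f x)%:E)%E = (EE P f)%:E.
Proof.
move=> bf; rewrite /EE /Rintegral fineK//.
exact: integrable_fin_num (bmf_integrable bf).
Qed.

Lemma EE_cst c : EE P (fun=> c) = c.
Proof.
by rewrite /EE Rintegral_cst//= [X in fine X](_ : _ = 1%E) ?mulr1// probability_setT.
Qed.

Lemma EED f g : bmf f -> bmf g -> EE P (fun x => f x + g x) = EE P f + EE P g.
Proof. by move=> bf bg; rewrite /EE RintegralD//; exact: bmf_integrable. Qed.

Lemma EEZ c f : bmf f -> EE P (fun x => c * f x) = c * EE P f.
Proof. by move=> bf; rewrite /EE RintegralZl//; exact: bmf_integrable. Qed.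

Lemma EEB f g : bmf f -> bmf g -> EE P (fun x => f x - g x) = EE P f - EE P g.
Proof. by move=> bf bg; rewrite /EE RintegralB//; exact: bmf_integrable. Qed.

Lemma EE_sum (J : Type) (s : seq J) (Q : pred J) (F : J -> T -> R) :
  (forall j, Q j -> bmf (F j)) ->
  EE P (fun x => \sum_(j <- s | Q j) F j x) = \sum_(j <- s | Q j) EE P (F j).
Proof.
move=> bF; elim: s => [|j s IH].
  rewrite big_nil -[RHS](EE_cst 0); congr (EE P _).
  by apply/funext => x; rewrite big_nil.
transitivity (EE P (fun x : T => if Q j then F j x + \sum_(i <- s | Q i) F i x else
   \sum_(i <- s | Q i) F i x)).
  by congr (EE P _); apply/funext => x; rewrite big_cons.
rewrite big_cons; case: (Q j) (bF j) => // /(_ isT) bFj.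
by rewrite EED ?IH//; exact: bmf_sum.
Qed.

Lemma EE_ge0 f : (forall x, 0 <= f x) -> 0 <= EE P f.
Proof. by move=> f0; exact: Rintegral_ge0. Qed.

Lemma EE_le f g : bmf f -> bmf g -> (forall x, f x <= g x) -> EE P f <= EE P g.
Proof.
by move=> bf bg fg; apply: le_Rintegral => //; exact: bmf_integrable.
Qed.

Lemma EE_norm f : bmf f -> `|EE P f| <= EE P (fun x => `|f x|).
Proof. by move=> bf; apply: le_normr_Rintegral => //; exact: bmf_integrable. Qed.

Lemma EE_sqr f : bmf f -> (EE P f) ^+ 2 <= EE P (fun x => f x ^+ 2).
Proof.
move=> bf; set c := EE P f.
have : 0 <= EE P (fun x => (f x - c) ^+ 2) by apply: EE_ge0 => x; exact: sqr_ge0.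
rewrite (_ : (fun x => _) = (fun x => (f x ^+ 2 + (- (2 * c)) * f x) + c ^+ 2)); last first.
  by apply/funext => x; ring.
have b2 := bmfX 2 bf; have b3 := bmfZ (- (2 * c)) bf.
have b4 := bmf_cst T (c ^+ 2).
rewrite EED//; last exact: bmfD.
by rewrite EED// EEZ// EE_cst -/c; lra.
Qed.

Lemma EE_norm_sqr f : bmf f -> (EE P (fun x => `|f x|)) ^+ 2 <= EE P (fun x => f x ^+ 2).
Proof.
move=> bf; have := EE_sqr (bmf_norm bf).
by under [X in _ <= EE P X]eq_fun do rewrite -normrX ger0_norm ?sqr_ge0//.
Qed.

Lemma EE_bool (b : T -> bool) : measurable [set x | b x] ->
  P [set x | b x] = (EE P (fun x => (b x)%:R))%:E.
Proof.
move=> mb; rewrite -EE_EFin; last exact: bmf_bool.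
transitivity (\int[P]_x (\1_[set x | b x] x : R)%:E)%E; first by rewrite integral_indic// setIT.
apply: eq_integral => x _.
by rewrite indic_bool.
Qed.

Lemma EE_ae f g : bmf f -> bmf g -> (\forall x \ae P, f x = g x) -> EE P f = EE P g.
Proof.
move=> [mf _] [mg _] fg; congr fine; apply: ae_eq_integral => //.
- exact/measurable_EFinP.
- exact/measurable_EFinP.
- by apply: filterS fg => x /= -> _.
Qed.

Lemma EE_eq0 f : bmf f -> (forall x, 0 <= f x) -> EE P f = 0 ->
  \forall x \ae P, f x = 0.
Proof.
move=> bf f0 Ef.
have mf : measurable_fun setT (EFin \o f) by apply/measurable_EFinP; case: bf.
have /(ae_eq_integral_abs P measurableT mf) : (\int[P]_(x in setT) `|(EFin \o f) x| = 0)%E.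
  under eq_integral do rewrite /= ger0_norm//.
  by rewrite EE_EFin// Ef.
by apply: filterS => x /= /(_ I) [].
Qed.

End expectation.

Section change_of_variables.
Context (R : realType) d d' (T : measurableType d) (T' : measurableType d').

Lemma EE_push (P : probability T R) (P' : probability T' R) (h : T -> T')
  (f : T' -> R) : measurable_fun setT h ->
  (forall A, measurable A -> P' A = P (h @^-1` A)) -> bmf f ->
  EE P (fun x => f (h x)) = EE P' f.
Proof.
move=> mh P'E bf; have [mf [M fM]] := bf.
have bfh := bmf_comp mh bf.
have bM := bmf_cst T' M; have bMh := bmf_cst T M.
(* Shifting by the bound [M] makes the integrand non-negative, so the change of variables for
   non-negative functions applies. *)
suff E : EE P (fun x => f (h x) + M) = EE P' (fun x => f x + M).
  by move: E; rewrite !EED// !EE_cst => /addIr.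
apply: EFin_inj; rewrite -!EE_EFin; [|exact: bmfD..].
have mfM : measurable_fun setT (fun y => (f y + M)%:E).
  by apply/measurable_EFinP; have [] := bmfD bf bM.
have fM0 y : (0 <= (f y + M)%:E)%E.
  by rewrite lee_fin; have := fM y; rewrite ler_norml => /andP[]; lra.
have := @ge0_integral_pushforward _ _ _ _ R h mh P setT (fun y => (f y + M)%:E).
rewrite preimage_setT => /(_ measurableT mfM (fun y _ => fM0 y)) /= <-.
by apply: eq_measure_integral => A mA _; apply/esym/P'E.
Qed.

End change_of_variables.

Section fubini_expectation.
Context (R : realType) d d' (T : measurableType d) (T' : measurableType d').
Context (P : probability T R) (P' : probability T' R).

Lemma bmf_EE2 (f : T * T' -> R) : bmf f ->
  bmf (fun x => EE P' (fun y => f (x, y))).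
Proof.
move=> bf; have [mf [M fM]] := bf.
have bfx x : bmf (fun y => f (x, y)).
  by apply: (bmf_comp (h := fun y => (x, y))) bf; exact: measurable_pair1.
split.
  apply: (@eq_measurable_fun _ _ _ _ _
     (fun x => fine (\int[P']_y (f (x, y) + M)%:E) - M)).
    move=> x _; rewrite EE_EFin; last by apply: bmfD => //; exact: bmf_cst.
    by rewrite /= EED ?EE_cst ?addrK//; exact: bmf_cst.
  apply: measurable_funB => //; apply: measurableT_comp => //.
  apply: (@measurable_fun_fubini_tonelli_F _ _ _ _ _ P' (fun z => (f z + M)%:E)).
    by apply/measurable_EFinP; have [] := bmfD bf (bmf_cst _ M).
  move=> z; rewrite lee_fin.
  by have := fM z; rewrite ler_norml => /andP[]; lra.
exists M => x; apply: le_trans (EE_norm _ (bfx x)) _.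
rewrite -[leRHS](EE_cst P'); apply: EE_le => //; first exact: bmf_norm.
exact: bmf_cst.
Qed.

Lemma EE_fubini (f : T * T' -> R) : bmf f ->
  EE (P \x P')%E f = EE P (fun x => EE P' (fun y => f (x, y))).
Proof.
move=> bf; have [mf [M fM]] := bf.
have bfx x : bmf (fun y => f (x, y)).
  by apply: (bmf_comp (h := fun y => (x, y))) bf; exact: measurable_pair1.
have bM := bmf_cst (T * T')%type M.
have bM1 := bmf_cst T M; have bM2 := bmf_cst T' M; have bF := bmf_EE2 bf.
suff E : EE (P \x P')%E (fun z => f z + M) =
    EE P (fun x => EE P' (fun y => f (x, y)) + M).
  by move: E; rewrite !EED// !EE_cst => /addIr.
apply: EFin_inj; rewrite -!EE_EFin; [|exact: bmfD..].
rewrite fubini_tonelli1; last 2 first.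
- by apply/measurable_EFinP; have [] := bmfD bf bM.
- move=> z; rewrite lee_fin.
  by have := fM z; rewrite ler_norml => /andP[]; lra.
apply: eq_integral => x _; rewrite /fubini_F EE_EFin; last exact: bmfD.
by rewrite EED// EE_cst.
Qed.

End fubini_expectation.

(** * Limits of rapidly Cauchy sequences of functions *)

Lemma is_cvg_sups01 (R : realType) (u : nat -> R) :
  (forall n, 0 <= u n <= 1) -> cvgn (sups u).
Proof.
move=> u01; apply: nonincreasing_is_cvgn.
  by apply: nonincreasing_sups; exists 1 => _ [n _ <-]; case/andP: (u01 n).
exists 0 => _ [n _ <-]; apply: (@le_trans _ _ (u n)); first by case/andP: (u01 n).
apply: ub_le_sup; last by exists n => /=.
by exists 1 => _ [m _ <-]; case/andP: (u01 m).
Qed.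

Lemma limn_sup_dist (R : realType) (u : nat -> R) i c :
  (forall n, 0 <= u n <= 1) -> (forall n, (i <= n)%N -> `|u n - u i| <= c) ->
  `|limn_sup u - u i| <= c.
Proof.
move=> u01 uc.
have cs := is_cvg_sups01 u01.
have sE n : (i <= n)%N -> u i - c <= sups u n <= u i + c.
  move=> ni; apply/andP; split.
    apply: (@le_trans _ _ (u n)).
      by have := uc n ni; rewrite ler_norml => /andP[]; lra.
    apply: ub_le_sup; last by exists n => /=.
    by exists 1 => _ [m _ <-]; case/andP: (u01 m).
  apply: ge_sup; first by exists (u n); exists n => /=.
  move=> _ [m /= nm <-]; have := uc m (leq_trans ni nm).
  by rewrite ler_norml => /andP[]; lra.
have ni : \forall n \near \oo, (i <= n)%N by exists i.
rewrite ler_norml; apply/andP; split.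
  rewrite lerBrDl addrC; apply: limr_ge => //.
  by apply: filterS ni => n /sE /andP[]; rewrite addrC.
rewrite lerBlDl; apply: limr_le => //.
by apply: filterS ni => n /sE /andP[].
Qed.

Section L1_limit.
Context (R : realType) d (T : measurableType d) (P : probability T R).
Variable h : nat -> T -> R.
Hypothesis mh : forall n, measurable_fun setT (h n).
Hypothesis h01 : forall n x, 0 <= h n x <= 1.
Hypothesis hC : forall n, EE P (fun x => `|h n.+1 x - h n x|) <= 2^-1 ^+ n.

Lemma bmf01 (f : T -> R) : measurable_fun setT f -> (forall x, 0 <= f x <= 1) -> bmf f.
Proof.
by move=> mf f01; split => //; exists 1 => x; case/andP: (f01 x) => ? ?; rewrite ger0_norm.
Qed.

Lemma limn_sup_range x : 0 <= limn_sup (h ^~ x) <= 1.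
Proof.
have cs : cvgn (sups (h ^~ x)) by exact: is_cvg_sups01.
apply/andP; split.
  apply: limr_ge => //; near=> n.
  apply: (@le_trans _ _ (h n x)); first by case/andP: (h01 n x).
  apply: ub_le_sup; last by exists n => /=.
  by exists 1 => _ [m _ <-]; case/andP: (h01 m x).
apply: limr_le => //; near=> n.
apply: ge_sup; first by exists (h n x); exists n => /=.
by move=> _ [m _ <-]; case/andP: (h01 m x).
Unshelve. all: by end_near. Qed.

Lemma measurable_limn_sup01 : measurable_fun setT (fun x => limn_sup (h ^~ x)).
Proof.
apply: measurable_fun_limn_sup => // x _.
  by exists 1 => _ [n _ <-]; case/andP: (h01 n x).
by exists 0 => _ [n _ <-]; case/andP: (h01 n x).
Qed.

(** The series of the increments after [i] dominates the distance pointwise, trivially so where it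
    diverges, and its integral is bounded by the geometric tail, which sums to twice its first
    term. *)
Lemma EE_limn_sup i : EE P (fun x => `|limn_sup (h ^~ x) - h i x|) <= 2 * 2^-1 ^+ i.
Proof.
have bh n : bmf (h n) by exact: bmf01.
have bl : bmf (fun x => limn_sup (h ^~ x)).
  by apply: bmf01; [exact: measurable_limn_sup01|exact: limn_sup_range].
have bli := bmf_norm (bmfB bl (bh i)).
have bhn n := bmf_norm (bmfB (bh n.+1) (bh n)).
rewrite -lee_fin -EE_EFin//.
pose g (n : nat) x : \bar R := `|h (i + n).+1 x - h (i + n)%N x|%:E.
have mg n : measurable_fun setT (g n) by apply/measurable_EFinP; case: (bhn (i + n)%N).
have g0 n x : (0 <= g n x)%E by rewrite lee_fin.
apply: (@le_trans _ _ (\int[P]_x (\sum_(n <oo) g n x))%E).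
  apply: ge0_le_integral => //.
  - by apply/measurable_EFinP; case: bli.
  - exact: ge0_emeasurable_sum.
  - move=> x _; have S0 : (0 <= \sum_(n <oo) g n x)%E by exact: nneseries_ge0.
    move ES : (\sum_(n <oo) g n x)%E S0 => S.
    case: S ES => [s| |] ES// _; last by rewrite leey.
    rewrite lee_fin; apply: limn_sup_dist => // n /subnK <-.
    rewrite -lee_fin -ES addnC; move: (n - i)%N => {}n.
    apply: (@le_trans _ _ (\sum_(0 <= m < n) g m x)%E); last first.
      by apply: nneseries_lim_ge => m _.
    rewrite sumEFin lee_fin.
    elim: n => [|n IH]; first by rewrite addn0 subrr normr0 big_geq.
    rewrite big_nat_recr//= addnS.
    rewrite (_ : _ - _ = (h (i + n)%N x - h i x) + (h (i + n).+1 x - h (i + n)%N x)).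
      by rewrite (le_trans (ler_normD _ _))// lerD.
    by ring.
rewrite integral_nneseries//.
apply: (@le_trans _ _ (\sum_(n <oo) (2^-1 ^+ i * 2^-1 ^+ n)%:E)%E).
  apply: lee_nneseries => [n _ _|n _]; first by apply: integral_ge0 => x _.
  by rewrite /g EE_EFin// lee_fin -exprD.
apply: lime_le.
  by apply: is_cvg_nneseries => n _ _; rewrite lee_fin mulr_ge0// exprn_ge0.
apply: nearW => N; rewrite sumEFin lee_fin.
suff -> : \sum_(0 <= n < N) 2^-1 ^+ i * 2^-1 ^+ n = 2^-1 ^+ i * (2 - 2 * 2^-1 ^+ N) :> R.
  have q0 : 0 <= (2^-1 : R) ^+ i by rewrite exprn_ge0.
  have qN : 0 <= (2^-1 : R) ^+ N by rewrite exprn_ge0.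
  by nra.
rewrite -big_distrr/=; congr (_ * _).
elim: N => [|N IH]; first by rewrite big_geq// expr0 mulr1 subrr.
by rewrite big_nat_recr//= IH exprS; field.
Qed.

End L1_limit.

(** * The product measure on the cube *)

Notation cubeT R I := (g_sigma_algebraType (@coord_sets R I)).

Definition upd (R : Type) (I : eqType) (i : I) (t : R) (x : I -> R) : I -> R :=
  fun j => if j == i then t else x j.

(** Averaging [f (mix S y x)] over [y] is the conditional expectation of [f] given the coordinates
    outside [S]; conditioning on coordinates is expressed in this way. *)
Definition mix (R I : Type) (S : pred I) (y x : I -> R) : I -> R :=
  fun i => if S i then y i else x i.

Section cube_measurability.
Context (R : realType) (I : Type).

Lemma measurable_coord (i : I) : measurable_fun setT (fun x : cubeT R I => x i).
Proof.
move=> _ A mA; rewrite setTI; apply: sub_sigma_algebra.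
by exists i, A.
Qed.

Lemma measurable_cubeP d (T : measurableType d) (f : T -> cubeT R I) :
  (forall i, measurable_fun setT (fun t => f t i)) -> measurable_fun setT f.
Proof.
move=> mf; apply: (@measurability _ _ T (cubeT R I) setT f (@coord_sets R I)) => //.
move=> _ [_ [i [A [mA ->]]] <-].
by have := mf i measurableT A mA; rewrite !setTI.
Qed.

End cube_measurability.

Section cube_maps.
Context (R : realType) (I : Type).

Lemma measurable_reindex J (h : J -> I) :
  measurable_fun setT (fun x : cubeT R I => (fun j => x (h j)) : cubeT R J).
Proof. by apply: measurable_cubeP => j; exact: measurable_coord. Qed.

Lemma measurable_mix (S : pred I) :
  measurable_fun setT (fun z : cubeT R I * cubeT R I => mix S z.1 z.2 : cubeT R I).
Proof.
apply: measurable_cubeP => i; rewrite /mix; case: (S i).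
  exact: measurableT_comp (measurable_coord i) measurable_fst.
exact: measurableT_comp (measurable_coord i) measurable_snd.
Qed.

End cube_maps.

Lemma measurable_upd (R : realType) (I : eqType) (i : I) :
  measurable_fun setT (fun z : measurableTypeR R * cubeT R I => upd i z.1 z.2 : cubeT R I).
Proof.
apply: measurable_cubeP => j; rewrite /upd; case: (j == i); first exact: measurable_fst.
exact: measurableT_comp (measurable_coord j) measurable_snd.
Qed.

Definition lam (R : realType) : probability (measurableTypeR R) R := uniform_prob (@ltr01 R).
Arguments lam : simpl never.

Lemma lam_fin (R : realType) (A : set R) : measurable A -> lam R A \is a fin_num.
Proof. by move=> mA; exact: (fin_num_measure (lam R)). Qed.

Section cube_measure.
Context (R : realType) (I : finType).

Definition upd_mfun (i : I) : {mfun (measurableTypeR R * cubeT R I)%type >-> cubeT R I} :=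
  HB.pack (fun z : measurableTypeR R * cubeT R I => upd i z.1 z.2 : cubeT R I)
    (isMeasurableFun.Build _ _ _ _ _ (@measurable_upd R I i)).

(** The coordinates in [s] are replaced one at a time by uniform ones, starting from the origin, in
    parallel with the recursion of [iint]; coordinates outside [s] stay at 0. *)
Fixpoint mus (s : seq I) : probability (cubeT R I) R :=
  if s is i :: s' then distribution (lam R \x mus s')%E (upd_mfun i)
  else dirac ((fun=> 0) : cubeT R I).

Definition mu : probability (cubeT R I) R := mus (enum I).

Definition box (A : I -> set R) : set (cubeT R I) := [set x | forall i, A i (x i)].

Lemma measurable_box A : (forall i, measurable (A i)) -> measurable (box A).
Proof.
move=> mA.
rewrite (_ : box A = \bigcap_(i in [set: I]) ((fun x : cubeT R I => x i) @^-1` A i)); last first.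
  by apply/seteqP; split => [x Ax i _|x Ax i]; [exact: Ax|exact: (Ax i Logic.I)].
apply: fin_bigcap_measurable; first exact: finite_finset.
by move=> i _; rewrite -[X in measurable X]setTI; exact: measurable_coord.
Qed.

Lemma measurable_upd_box i (A : I -> set R) :
  (fun z : measurableTypeR R * cubeT R I => upd i z.1 z.2 : cubeT R I) @^-1` box A =
  A i `*` box (fun j => if j == i then setT else A j).
Proof.
apply/seteqP; split => [[t x] /= Ax|[t x] /= [At Ax] j].
  split; first by have := Ax i; rewrite /upd eqxx.
  by move=> j; have := Ax j; rewrite /upd; case: ifP.
by rewrite /upd; have := Ax j; case: eqP => [->|].
Qed.

Lemma mus_box s A : uniq s -> (forall i, measurable (A i)) ->
  mus s (box A) = (\prod_i if i \in s then fine (lam R (A i)) else \1_(A i) 0)%:E.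
Proof.
elim: s A => [|i s IH] A /=.
  move=> _ mA; rewrite diracE; congr _%:E.
  have [A0|] := pselect (box A (fun=> 0)).
    rewrite mem_set//= big1// => i _; rewrite indicE mem_set//; exact: A0.
  move=> nA; rewrite memNset//=.
  have /existsNP[i Ai] : ~ forall i, A i 0 by [].
  by rewrite (bigD1 i)//= indicE memNset// mul0r.
move=> /andP[is_ us] mA.
rewrite /distribution /pushforward /= measurable_upd_box.
have mB j : measurable (if j == i then setT else A j) by case: ifP.
rewrite product_measure1E; [|exact: mA|exact: measurable_box].
transitivity (lam R (A i) * mus s (box (fun j => if j == i then setT else A j)))%E => //.
rewrite IH// -[lam R (A i)]fineK; last exact: lam_fin.
rewrite -EFinM; congr _%:E.
rewrite (bigD1 i)//= (negbTE is_) eqxx indicE mem_set// mul1r.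
rewrite [RHS](bigD1 i)//= in_cons eqxx; congr (_ * _).
by apply: eq_bigr => j ji; rewrite in_cons (negbTE ji).
Qed.

Lemma mu_box A : (forall i, measurable (A i)) ->
  mu (box A) = (\prod_i fine (lam R (A i)))%:E.
Proof.
move=> mA; rewrite /mu mus_box//; last exact: enum_uniq.
by congr _%:E; apply: eq_bigr => i _; rewrite mem_enum.
Qed.

(** Boxes are stable under intersection and generate the sigma-algebra. The changes of variables on
    the cube are all checked on boxes by means of this lemma. *)
Lemma cube_uniq (P Q : probability (cubeT R I) R) :
  (forall A, (forall i, measurable (A i)) -> P (box A) = Q (box A)) ->
  forall B, measurable B -> P B = Q B.
Proof.
move=> PQ B mB.
pose G : set (set (cubeT R I)) := [set S | exists A, (forall i, measurable (A i)) /\ S = box A].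
apply: (measure_unique G (fun=> setT)) => //.
- apply/seteqP; split.
    apply: smallest_sub; first exact: smallest_sigma_algebra.
    move=> _ [i [A [mA ->]]]; apply: sub_sigma_algebra.
    exists (fun j => if j == i then A else setT); split; first by move=> j; case: ifP.
    apply/seteqP; split => x /= Ax; last by have := Ax i; rewrite eqxx.
    by move=> j; case: eqP => // ->.
  apply: smallest_sub; first exact: sigma_algebra_measurable.
  by move=> _ [A [mA ->]]; exact: measurable_box.
- move=> _ _ [A [mA ->]] [C [mC ->]]; exists (fun i => A i `&` C i); split.
    by move=> i; exact: measurableI.
  apply/seteqP; split => x /=; first by move=> [Ax Cx] i; split; [exact: Ax|exact: Cx].
  by move=> ACx; split => i; have [] := ACx i.
- by move=> _; exists (fun=> setT); split => //; apply/seteqP; split.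
- by apply/seteqP; split => // x _; exists 0%N.
- by move=> _ [A [mA ->]]; exact: PQ.
- by move=> _; rewrite (le_lt_trans (probability_le1 _ _))// ltry.
Qed.

End cube_measure.

Section cube_pushforward.
Context (R : realType).

Lemma mu_reindex (I J : finType) (h : J -> I) (B : set (cubeT R J)) : injective h ->
  measurable B ->
  mu R J B = mu R I ((fun x : cubeT R I => (fun j => x (h j)) : cubeT R J) @^-1` B).
Proof.
move=> hI mB.
pose hm : {mfun cubeT R I >-> cubeT R J} :=
  HB.pack (fun x : cubeT R I => (fun j => x (h j)) : cubeT R J)
    (isMeasurableFun.Build _ _ _ _ _ (measurable_reindex h)).
apply: (@cube_uniq R J (mu R J) (distribution (mu R I) hm)) => // A mA.
rewrite mu_box// /distribution /pushforward /=.
(* The box over [J] pulls back to a box over [I] that is unconstrained off the image of [h]. *)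
pose A' i := if [pick j | h j == i] is Some j then A j else setT.
have A'h j : A' (h j) = A j.
  by rewrite /A'; case: pickP => [j' /eqP/hI ->//|/(_ j)]; rewrite eqxx.
have A'n i : (forall j, h j != i) -> A' i = setT.
  by rewrite /A'; case: pickP => // j /eqP ji /(_ j); rewrite ji eqxx.
transitivity (mu R I (box A')); last first.
  congr (mu R I _); apply/seteqP; split => x /= Ax.
    by move=> j; have := Ax (h j); rewrite A'h.
  by move=> i; rewrite /A'; case: pickP => // j /eqP <-; exact: Ax.
rewrite mu_box; last by move=> i; rewrite /A'; case: pickP.
congr _%:E; rewrite [RHS](bigID (mem (codom h)))/= [X in _ = _ * X]big1 ?mulr1; last first.
  move=> i ih; rewrite A'n ?probability_setT// => j; apply: contraNneq ih => <-.
  exact: codom_f.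
rewrite -big_uniq; last by rewrite /codom /image_mem map_inj_uniq ?enum_uniq.
by rewrite big_map big_enum /=; apply: eq_bigr => j _; rewrite A'h.
Qed.

Lemma mu_upd (I : finType) (i : I) (B : set (cubeT R I)) : measurable B ->
  mu R I B = (lam R \x mu R I)%E ((fun z : measurableTypeR R * cubeT R I => upd i z.1 z.2) @^-1` B).
Proof.
move=> mB.
apply: (@cube_uniq R I (mu R I) (distribution (lam R \x mu R I)%E (upd_mfun R i))) => // A mA.
rewrite mu_box// /distribution /pushforward /= measurable_upd_box.
have mB' j : measurable (if j == i then setT else A j) by case: ifP.
rewrite product_measure1E; [|exact: mA|exact: measurable_box].
transitivity (lam R (A i) * mu R I (box (fun j => if j == i then setT else A j)))%E => //.
rewrite mu_box// -[lam R (A i)]fineK; last exact: lam_fin.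
rewrite -EFinM; congr _%:E.
rewrite (bigD1 i)//= [in RHS](bigD1 i)//= eqxx probability_setT mul1r; congr (_ * _).
by apply: eq_bigr => j /negbTE ->.
Qed.

Lemma mu_mix (I : finType) (S : pred I) (B : set (cubeT R I)) : measurable B ->
  mu R I B = (mu R I \x mu R I)%E
    ((fun z : cubeT R I * cubeT R I => mix S z.1 z.2 : cubeT R I) @^-1` B).
Proof.
move=> mB.
pose hm : {mfun (cubeT R I * cubeT R I)%type >-> cubeT R I} :=
  HB.pack (fun z : cubeT R I * cubeT R I => mix S z.1 z.2 : cubeT R I)
    (isMeasurableFun.Build _ _ _ _ _ (measurable_mix S)).
apply: (@cube_uniq R I (mu R I) (distribution (mu R I \x mu R I)%E hm)) => // A mA.
rewrite mu_box// /distribution /pushforward /=.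
rewrite (_ : _ @^-1` _ = box (fun i => if S i then A i else setT) `*`
   box (fun i => if S i then setT else A i)); last first.
  apply/seteqP; split => [[y x]/= Ax|[y x] /= [Ay Ax] i].
    by split => i; have := Ax i; rewrite /mix; case: (S i).
  by rewrite /mix; have := Ay i; have := Ax i; case: (S i).
have m1 i : measurable (if S i then A i else setT) by case: ifP.
have m2 i : measurable (if S i then setT else A i) by case: ifP.
rewrite product_measure1E//; [|exact: measurable_box..].
transitivity (mu R I (box (fun i => if S i then A i else setT)) *
   mu R I (box (fun i => if S i then setT else A i)))%E => //.
rewrite !mu_box// -EFinM -big_split/=; congr _%:E; apply: eq_bigr => i _.
by case: (S i); rewrite probability_setT ?mulr1 ?mul1r.
Qed.

End cube_pushforward.

Lemma bmf_indic (R : realType) d (T : measurableType d) (N : set T) :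
  measurable N -> bmf (\1_N : T -> R).
Proof.
move=> mN; split; first exact: measurable_indic.
by exists 1 => x; rewrite indicE; case: (_ \in _); rewrite ?normr1 ?normr0.
Qed.

Lemma EE_set (R : realType) d (T : measurableType d) (P : probability T R) (N : set T) :
  measurable N -> P N = (EE P \1_N)%:E.
Proof.
move=> mN; rewrite -EE_EFin; last exact: bmf_indic.
by rewrite integral_indic// setIT.
Qed.

Section cube_expectation.
Context (R : realType).
Implicit Types I J : finType.

Lemma EI_reindex I J (h : J -> I) (f : cubeT R J -> R) : injective h -> bmf f ->
  EE (mu R I) (fun x => f (fun j => x (h j))) = EE (mu R J) f.
Proof.
move=> hI bf; apply: EE_push bf; first exact: measurable_reindex.
by move=> A mA; exact: mu_reindex.
Qed.

Lemma bmf_mix I (S : pred I) (f : cubeT R I -> R) : bmf f ->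
  bmf (fun z : cubeT R I * cubeT R I => f (mix S z.1 z.2)).
Proof. by move=> bf; apply: bmf_comp bf; exact: measurable_mix. Qed.

Lemma bmf_mixl I (S : pred I) (f : cubeT R I -> R) x : bmf f ->
  bmf (fun y : cubeT R I => f (mix S y x)).
Proof.
move=> bf; apply: (@bmf_comp _ _ _ _ _ f) bf; apply: measurable_cubeP => i.
by rewrite /mix; case: (S i); [exact: measurable_coord|exact: measurable_cst].
Qed.

Lemma bmf_EE_mix I (S : pred I) (f : cubeT R I -> R) : bmf f ->
  bmf (fun x : cubeT R I => EE (mu R I) (fun y => f (mix S y x))).
Proof.
move=> bf; pose g (z : cubeT R I * cubeT R I) := f (mix S z.2 z.1).
apply: (@bmf_EE2 _ _ _ _ _ (mu R I) g).
apply: (@bmf_comp _ _ _ _ _ f) bf; apply: measurable_cubeP => i.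
rewrite /mix; case: (S i).
  exact: measurableT_comp (measurable_coord i) measurable_snd.
exact: measurableT_comp (measurable_coord i) measurable_fst.
Qed.

Lemma EI_mix I (S : pred I) (f : cubeT R I -> R) : bmf f ->
  EE (mu R I) (fun x => EE (mu R I) (fun y => f (mix S y x))) = EE (mu R I) f.
Proof.
move=> bf.
(* Taking the complement of [S] makes the outer variable of Fubini the one that is read off [S]. *)
pose f' (z : cubeT R I * cubeT R I) := f (mix (predC S) z.1 z.2).
have <- : EE (mu R I \x mu R I)%E f' = EE (mu R I) f.
  apply: (@EE_push R _ _ (cubeT R I * cubeT R I)%type (cubeT R I)
    (mu R I \x mu R I)%E (mu R I) (fun z => mix (predC S) z.1 z.2) f) => //.
    exact: measurable_mix.
  by move=> A mA; exact: mu_mix.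
rewrite EE_fubini; last exact: bmf_mix.
congr (EE _ _); apply/funext => x; congr (EE _ _); apply/funext => y.
by rewrite /f'; congr f; apply/funext => i; rewrite /mix/=; case: (S i).
Qed.

Lemma EI_indep I (S : pred I) (f g : cubeT R I -> R) : bmf f -> bmf g ->
  (forall x y, f (mix S y x) = f y) -> (forall x y, g (mix S y x) = g x) ->
  EE (mu R I) (fun x => f x * g x) = EE (mu R I) f * EE (mu R I) g.
Proof.
move=> bf bg fS gS; rewrite -(EI_mix S); last exact: bmfM.
rewrite (_ : (fun x => _) = (fun x => EE (mu R I) f * g x)) ?EEZ//.
apply/funext => x; rewrite [RHS]mulrC -EEZ//; congr (EE _ _); apply/funext => y.
by rewrite fS gS mulrC.
Qed.

(* Conditionally on the coordinates outside the disjoint blocks [S b], factors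
   that read the blocks separately are independent. *)
Lemma EI_blocks I (B : eqType) (s : seq B) (S : B -> pred I)
    (h : cubeT R I -> R) (u : B -> cubeT R I -> R) :
  uniq s -> bmf h -> (forall b, bmf (u b)) ->
  (forall b x y, b \in s -> h (mix (S b) y x) = h x) ->
  (forall b c x y, b \in s -> c \in s -> b != c -> u c (mix (S b) y x) = u c x) ->
  (forall b c i, b \in s -> c \in s -> b != c -> ~~ (S b i && S c i)) ->
  EE (mu R I) (fun x => h x * \prod_(b <- s) u b x) =
  EE (mu R I) (fun x => h x * \prod_(b <- s) EE (mu R I) (fun y => u b (mix (S b) y x))).
Proof.
elim: s h => [|b s IH] h; first by move=> *; congr (EE _ _); apply/funext => x; rewrite !big_nil.
move=> /= /andP[bs us] bh bu hS uS dS.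
rewrite -(EI_mix (S b)); last first.
  by apply: bmfM => //; apply: bmf_prod => j _; exact: bu.
have -> : (fun x => EE (mu R I) (fun y => h (mix (S b) y x) *
   \prod_(j <- b :: s) u j (mix (S b) y x))) =
  (fun x => (h x * EE (mu R I) (fun y => u b (mix (S b) y x))) * \prod_(j <- s) u j x).
  apply/funext => x.
  rewrite (_ : (fun y => _) = (fun y => (h x * \prod_(j <- s) u j x) * u b (mix (S b) y x))).
    by rewrite EEZ; [rewrite mulrAC|exact: bmf_mixl].
  apply/funext => y; rewrite hS ?mem_head// big_cons mulrA mulrAC; congr (_ * _ * _).
  apply: eq_big_seq => c cs; rewrite uS ?mem_head// ?in_cons ?cs ?orbT//.
  by apply: contraNneq bs => ->.
rewrite IH//.
- by congr (EE _ _); apply/funext => x; rewrite big_cons mulrA.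
- by apply: bmfM => //; exact: bmf_EE_mix.
- move=> c x y cs.
  have bc : b != c by apply: contraNneq bs => ->.
  rewrite hS ?in_cons ?cs ?orbT//; congr (_ * EE _ _); apply/funext => z.
  have -> : mix (S b) z (mix (S c) y x) = mix (S c) y (mix (S b) z x).
    apply/funext => i; rewrite /mix; have := dS b c i; rewrite mem_head in_cons cs orbT bc.
    by move=> /(_ isT isT isT); case: (S b i); case: (S c i).
  by rewrite uS ?mem_head// ?in_cons ?cs ?orbT// eq_sym.
- by move=> c e x y cs es ce; rewrite uS// in_cons ?cs ?es orbT.
- by move=> c e i cs es ce; rewrite dS// in_cons ?cs ?es orbT.
Qed.

End cube_expectation.

(** * Iterated integrals as expectations *)

Section iterated_integral.
Context (R : realType).

Lemma EE_lam (f : measurableTypeR R -> R) : bmf f -> (forall t, 0 <= f t) ->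
  (\int[@lebesgue_measure R]_(t in [set t : R | (0 <= t <= 1)%R]) (f t)%:E)%E =
  (EE (lam R) f)%:E.
Proof.
move=> bf f0; rewrite -EE_EFin// integral_uniform//.
- rewrite subr0 invr1 mul1e.
  by rewrite (_ : [set` _] = [set t : R | (0 <= t <= 1)%R])// -set_itvE.
- by apply/measurable_EFinP; case: bf.
Qed.

Lemma EE_upd (I : finType) (i : I) (f : cubeT R I -> R) : bmf f ->
  EE (mu R I) f = EE (lam R) (fun t => EE (mu R I) (fun y => f (upd i t y))).
Proof.
move=> bf.
have E : EE (lam R \x mu R I)%E (fun z : measurableTypeR R * cubeT R I => f (upd i z.1 z.2)) =
    EE (mu R I) f.
  apply: (@EE_push R _ _ (measurableTypeR R * cubeT R I)%type (cubeT R I)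
    (lam R \x mu R I)%E (mu R I) (fun z => upd i z.1 z.2) f) => //.
    exact: measurable_upd.
  by move=> A mA; exact: mu_upd.
rewrite -E EE_fubini//; apply: (@bmf_comp _ _ _ _ _ f) bf; exact: measurable_upd.
Qed.

Lemma mix_upd (I : finType) (i : I) (s : seq I) t (x y : I -> R) : i \notin s ->
  mix (mem (i :: s)) (upd i t y) x = mix (mem s) y (upd i t x).
Proof.
move=> is_; apply/funext => j; rewrite /mix /upd /= in_cons.
by case: eqP => [->|]; rewrite ?(negbTE is_).
Qed.

Lemma EE_mix_cons (I : finType) i (s : seq I) (f : cubeT R I -> R) x : i \notin s -> bmf f ->
  EE (mu R I) (fun y => f (mix (mem (i :: s)) y x)) =
  EE (lam R) (fun t => EE (mu R I) (fun y => f (mix (mem s) y (upd i t x)))).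
Proof.
move=> is_ bf; rewrite (EE_upd i); last exact: bmf_mixl.
by congr (EE _ _); apply/funext => t; congr (EE _ _); apply/funext => y; rewrite mix_upd.
Qed.

Lemma bmf_mix_upd (I : finType) i (s : seq I) (f : cubeT R I -> R) x : bmf f ->
  bmf (fun t : measurableTypeR R => EE (mu R I) (fun y => f (mix (mem s) y (upd i t x)))).
Proof.
move=> bf.
apply: (@bmf_EE2 _ _ _ _ _ _ (fun z : measurableTypeR R * cubeT R I =>
   f (mix (mem s) z.2 (upd i z.1 x)))).
apply: (@bmf_comp _ _ _ _ _ f) bf; apply: measurable_cubeP => j.
rewrite /mix; case: (mem s j).
  exact: measurableT_comp (measurable_coord j) measurable_snd.
by rewrite /upd; case: (j == i); [exact: measurable_fst|exact: measurable_cst].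
Qed.

Lemma iintE (I : finType) (s : seq I) (f : cubeT R I -> R) x : uniq s -> bmf f ->
  (forall x, 0 <= f x) ->
  iint s (fun x => (f x)%:E) x = (EE (mu R I) (fun y => f (mix (mem s) y x)))%:E.
Proof.
move=> us bf f0; elim: s us x => [_ x|i s IH /= /andP[is_ us] x].
  by rewrite /= (_ : (fun y => _) = (fun=> f x)) ?EE_cst.
rewrite EE_mix_cons// -EE_lam.
- by apply: eq_integral => t _; rewrite IH.
- exact: bmf_mix_upd.
- by move=> t; exact: EE_ge0.
Qed.

End iterated_integral.

(** * Integrands known only off a null set *)

Section nonmeasurable_integrand.
Context (R : realType).
Import HBNNSimple.

(* [\int] is total: on a nonnegative function it is the supremum over simple
   functions below, hence blind to null sets even without measurability. *)
Lemma ge0_integral_eq_off_null d (T : measurableType d) (m : {measure set T -> \bar R})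
    (D Z : set T) (F G : T -> \bar R) :
  measurable D -> measurable Z -> m Z = 0%E ->
  (forall t, D t -> (0 <= F t)%E) -> (forall t, D t -> (0 <= G t)%E) ->
  (forall t, D t -> ~ Z t -> F t = G t) ->
  (\int[m]_(t in D) F t = \int[m]_(t in D) G t)%E.
Proof.
move=> mD mZ mZ0.
suff H (F' G' : T -> \bar R) : (forall t, D t -> (0 <= F' t)%E) ->
    (forall t, D t -> (0 <= G' t)%E) ->
    (forall t, D t -> ~ Z t -> F' t = G' t) ->
    (\int[m]_(t in D) F' t <= \int[m]_(t in D) G' t)%E.
  move=> F0 G0 FG; apply/eqP; rewrite eq_le !H// => t Dt Zt.
  by rewrite FG.
move=> F0 G0 FG; rewrite !ge0_integralE//.
apply: ge_ereal_sup => _ [h /= hF <-].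
have mZC := measurableC mZ.
(* A simple function below [F'] is cut off on [Z]: it is then below [G'] and keeps its integral. *)
apply: (@le_trans _ _ (sintegral m (proj_nnsfun h mZC))); last first.
  apply: ereal_sup_ubound; exists (proj_nnsfun h mZC) => // t /=.
  rewrite mindicE patchE.
  have := hF t; rewrite patchE; case: ifPn => tD ht.
    have Dt : D t by move: tD; rewrite inE.
    have [Zt|Zt] := pselect (Z t).
      by rewrite memNset ?mulr0//=; exact: G0.
    by rewrite mem_set//= mulr1 -FG.
  apply: le_trans ht; rewrite lee_fin; case: (_ \in _); rewrite ?mulr1// mulr0.
  exact: fun_ge0.
rewrite -!integralT_nnsfun le_eqVlt; apply/orP; left; apply/eqP.
apply: ge0_ae_eq_integral => //.
- exact/measurable_EFinP.
- exact/measurable_EFinP.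
- by move=> x _; rewrite lee_fin; exact: fun_ge0.
- by move=> x _; rewrite lee_fin; exact: fun_ge0.
- exists Z; split => // t /= nt; apply: contrapT => Zt; apply: nt => _.
  by rewrite mindicE mem_set ?mulr1.
Qed.

Lemma iint_ge0 (I : finType) (s : seq I) (f : (I -> R) -> \bar R) x :
  (forall x, incube x -> (0 <= f x)%E) -> incube x -> (0 <= iint s f x)%E.
Proof.
move=> f0; elim: s x => [x cx|i s IH x cx] /=; first exact: f0.
apply: integral_ge0 => t /= t01; apply: IH => j.
by case: (j == i) => //; exact: cx.
Qed.

Lemma EE_lam_null (Z : set (measurableTypeR R)) : measurable Z -> lam R Z = 0%E ->
  @lebesgue_measure R (Z `&` [set t : R | 0 <= t <= 1]) = 0%E.
Proof.
move=> mZ Z0.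
have mD : measurable [set t : R | 0 <= t <= 1].
  by rewrite -set_itvcc; exact: measurable_itv.
rewrite -(integral_indic (@lebesgue_measure R) mD mZ) EE_lam; last 2 first.
- exact: bmf_indic.
- by move=> t; rewrite indicE.
by rewrite -EE_set.
Qed.

(** By Fubini almost every section of a null set is null. The induction carries the nullness of the
    fibre of [N] over the coordinates already fixed, and each one-dimensional integral discards the
    null set of bad values; measurability of [f] never enters. *)
Lemma iint_eq_off_null (I : finType) (s : seq I) (f : (I -> R) -> \bar R)
    (g : cubeT R I -> R) (N : set (cubeT R I)) x :
  uniq s -> bmf g -> (forall x, 0 <= g x) -> measurable N ->
  (forall x, incube x -> (0 <= f x)%E) ->
  (forall x, incube x -> ~ N x -> f x = (g x)%:E) ->
  incube x -> EE (mu R I) (fun y => \1_N (mix (mem s) y x)) = 0 ->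
  iint s f x = iint s (fun x => (g x)%:E) x.
Proof.
move=> us bg g0 mN f0 fg; elim: s us x => [_ x cx|i s IH /= /andP[is_ us] x cx].
  rewrite (_ : (fun y => _) = (fun=> \1_N x)) ?EE_cst => [/eqP|//].
  rewrite indicE pnatr_eq0 eqb0 notin_setE; exact: fg.
have bN : bmf (\1_N : cubeT R I -> R) by exact: bmf_indic.
rewrite EE_mix_cons// => E0.
have bu := bmf_mix_upd i s x bN.
have u0 t : 0 <= EE (mu R I) (fun y => \1_N (mix (mem s) y (upd i t x)) : R).
  by apply: EE_ge0 => y; rewrite indicE.
have [Z [mZ Z0 ZE]] := EE_eq0 bu u0 E0.
have mD : measurable [set t : R | 0 <= t <= 1].
  by rewrite -set_itvcc; exact: measurable_itv.
have cu t : 0 <= t <= 1 -> incube (upd i t x).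
  by move=> t01 j; rewrite /upd; case: (j == i) => //; exact: cx.
apply: (@ge0_integral_eq_off_null _ _ _ _ (Z `&` [set t : R | 0 <= t <= 1])) => //.
- exact: measurableI.
- exact: EE_lam_null.
- by move=> t t01; apply: iint_ge0 => //; exact: cu.
- by move=> t t01; apply: iint_ge0 => [y _|]; [rewrite lee_fin|exact: cu].
- move=> t t01 Zt; apply: IH => //; first exact: cu.
  by apply: contrapT => nE; apply: Zt; split => //; exact: ZE.
Qed.

End nonmeasurable_integrand.

Section null_sets.
Context (R : realType) (I : finType).

Lemma vol_mu (N : set (cubeT R I)) : measurable N -> vol N = mu R I N.
Proof.
move=> mN; have bN : bmf (\1_N : cubeT R I -> R) by exact: bmf_indic.
rewrite /vol (@iintE R I (enum I) (\1_N : cubeT R I -> R)) ?enum_uniq//.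
rewrite EE_set//; congr (_%:E); congr (EE _ _); apply/funext => y.
by congr (\1_N _); apply/funext => i; rewrite /mix /= mem_enum.
Qed.

Lemma nullP (S : set (I -> R)) : null S <->
  exists N : set (cubeT R I), [/\ measurable N, mu R I N = 0%E & S `&` @cube R I `<=` N].
Proof.
split=> [[N [mN [N0 SN]]]|[N [mN N0 SN]]]; exists N; split => //.
- by rewrite -vol_mu.
- by split => //; rewrite vol_mu.
Qed.

Lemma mu_cube : mu R I (@cube R I) = 1%E.
Proof.
rewrite (_ : @cube R I = box (fun=> [set t : R | 0 <= t <= 1])); last first.
  by apply/seteqP; split.
have mD : measurable [set t : R | 0 <= t <= 1].
  by rewrite -set_itvcc; exact: measurable_itv.
rewrite mu_box// big1// => i _.
suff -> : lam R [set t : R | 0 <= t <= 1] = 1%E by [].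
rewrite EE_set// -EE_lam; last 2 first.
- exact: bmf_indic.
- by move=> t; rewrite indicE.
rewrite integral_indic// setIid -set_itvcc.
by have := lebesgue_measure_itv (`[0:R, 1]); rewrite /= lte_fin ltr01 oppr0 adde0 => ->.
Qed.

Lemma measurable_cube : measurable (@cube R I : set (cubeT R I)).
Proof.
rewrite (_ : @cube R I = box (fun=> [set t : R | 0 <= t <= 1])); last first.
  by apply/seteqP; split.
by apply: measurable_box => _; rewrite -set_itvcc; exact: measurable_itv.
Qed.

End null_sets.

(** * Borel versions of hypergraphons *)

(** Bounds and symmetry are imposed at every point of the ambient space and not only on the cube, so
    that all integrands are total bounded measurable functions. *)
Definition hyperB (R : realType) (k : nat) (W : cubeT R (rlt k) -> R) : Prop :=
  [/\ measurable_fun setT W, (forall x, 0 <= W x <= 1) &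
      (forall (s : {perm 'I_k}) x, W (permpt s x) = W x)].

Lemma hyperB_bmf (R : realType) (k : nat) (W : cubeT R (rlt k) -> R) : hyperB W -> bmf W.
Proof. by case=> mW W01 _; exact: bmf01. Qed.

Lemma hyperB_hypergraphon (R : realType) (k : nat) (W : (rlt k -> R) -> R) :
  hyperB W -> hypergraphon W.
Proof.
move=> [mW W01 symW]; split=> [A mA|x _|s x _] //.
exists (@cube R (rlt k) `&` W @^-1` A); split.
  apply: (@measurableI _ (cubeT R (rlt k))); first exact: measurable_cube.
  by rewrite -[X in measurable X]setTI; exact: mW.
by rewrite setDv setU0; apply/nullP; exists set0; rewrite measure0 set0I; split.
Qed.

Section permuted_points.
Context (R : realType) (k : nat).

Lemma imset_rlt (s : {perm 'I_k}) (B : rlt k) :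
  (s @: val B != finset.set0) && (s @: val B != [set: 'I_k]%SET).
Proof.
case: B => B /= /andP[B0 BT]; apply/andP; split.
  by rewrite imset_eq0.
apply: contraNneq BT => sB.
have /= := congr1 (fun X : {set 'I_k} => #|X|) sB.
by rewrite eqEcard finset.subsetT /= card_imset => [->|]; last exact: perm_inj.
Qed.

Definition perm_rlt (s : {perm 'I_k}) (B : rlt k) : rlt k := Sub (s @: val B) (imset_rlt s B).

Lemma permptE (s : {perm 'I_k}) (x : rlt k -> R) : permpt s x = fun B => x (perm_rlt s B).
Proof.
apply/funext => B; rewrite /permpt insubT; first exact: imset_rlt.
by move=> ? /=; congr x; apply: val_inj.
Qed.

Lemma measurable_permpt (s : {perm 'I_k}) :
  measurable_fun setT (fun x : cubeT R (rlt k) => permpt s x : cubeT R (rlt k)).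
Proof.
apply: measurable_cubeP => B.
have -> : (fun x : cubeT R (rlt k) => permpt s x B) = (fun x => x (perm_rlt s B)).
  by apply/funext => x; rewrite permptE.
exact: measurable_coord.
Qed.

Lemma perm_rlt_inj (s : {perm 'I_k}) : injective (perm_rlt s).
Proof.
move=> B B' /(congr1 val) /= /imset_inj H; apply: val_inj; apply: H.
exact: perm_inj.
Qed.

Lemma permpt_comp (s s' : {perm 'I_k}) (x : rlt k -> R) :
  permpt s (permpt s' x) = permpt (s * s')%g x.
Proof.
rewrite !permptE; apply/funext => B; congr x; apply: val_inj => /=.
by rewrite -imset_comp; apply: eq_imset => i /=; rewrite permM.
Qed.

End permuted_points.

(** Counting thresholds recovers a number up to 1; after rescaling, a function is rebuilt from
    finitely many of its level sets with error 1/M. *)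
Lemma count_below (R : realDomainType) (y : R) (M : nat) : 0 <= y <= M%:R ->
  y <= \sum_(j < M) ((j%:R < y)%R : bool)%:R <= y + 1.
Proof.
elim: M => [|M IH] /andP[y0 yM].
  by rewrite big_ord0 yM /= (le_trans y0)// lerDl.
rewrite big_ord_recr/=; have [My|My] := ltP M%:R y.
  have -> : \sum_(i < M) ((i%:R < y)%R : bool)%:R = M%:R :> R.
    rewrite (eq_bigr (fun=> 1)) ?sumr_const ?card_ord// => i _.
    by rewrite (le_lt_trans _ My)// ler_nat ltnW.
  by rewrite natr1 yM /= -natr1 lerD2r ltW.
by rewrite addr0; apply: IH; rewrite y0.
Qed.

Lemma measure0_bigcup (R : realType) d (T : measurableType d) (P : probability T R)
    (F : nat -> set T) : (forall n, measurable (F n)) -> (forall n, P (F n) = 0%E) ->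
  P (\bigcup_n F n) = 0%E.
Proof.
move=> mF F0; apply/negligibleP; first exact: bigcupT_measurable.
by apply: negligible_bigcup => n; apply/(negligibleP _ (mF n)); exact: F0.
Qed.

Lemma measure0_finite (R : realType) d (T : measurableType d) (P : probability T R)
    (J : finType) (F : J -> set T) : (forall j, measurable (F j)) -> (forall j, P (F j) = 0%E) ->
  measurable (\bigcup_(j in [set: J]) F j) /\ P (\bigcup_(j in [set: J]) F j) = 0%E.
Proof.
move=> mF F0.
have -> : \bigcup_(j in [set: J]) F j = \bigcup_n (if insub n is Some i then F (@enum_val J predT i) else set0).
  apply/seteqP; split => x /=.
    move=> [j _ Fj]; exists (val (enum_rank j)) => //.
    by rewrite valK enum_rankK.
  by move=> [n _]; case: insubP => // i _ _ Fi; exists (enum_val i).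
have mG n : measurable (if insub n is Some i then F (@enum_val J predT i) else set0).
  by case: insubP.
split; first exact: bigcupT_measurable.
apply: measure0_bigcup => // n; case: insubP => [i _ _|_]; first exact: F0.
exact: measure0.
Qed.

(** Each superlevel set at a threshold j/(n+1) agrees with a Borel set off a null set. The averages
    of the indicators of these Borel sets over [j] converge to [W] off a countable union of null
    sets, and their upper limit is Borel. Averaging over all permutations then makes the symmetry
    exact; the exceptional set is enlarged to the union of its permuted preimages. *)
Lemma hypergraphon_borel (R : realType) (k : nat) (W : (rlt k -> R) -> R) : hypergraphon W ->
  exists W' : cubeT R (rlt k) -> R, hyperB W' /\ exists N : set (cubeT R (rlt k)),
    [/\ measurable N, mu R (rlt k) N = 0%E &
        forall x, incube x -> ~ N x -> W x = W' x].
Proof.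
move=> [lW W01 symW]; pose I := rlt k.
have step (q : R) : exists BN : set (cubeT R I) * set (cubeT R I),
    [/\ measurable BN.1, measurable BN.2, mu R I BN.2 = 0%E &
      forall x, incube x -> ~ BN.2 x -> (BN.1 x <-> q < W x)].
  have [|B [mB /nullP[N [mN N0 SN]]]] := lW [set t | q < t].
    by rewrite -set_itvoy; exact: measurable_itv.
  exists (B, N); split => //= x cx nN; split => [Bx|qW].
    apply: contrapT => nq; apply: nN; apply: SN; split => //; right.
    by split => // -[_].
  apply: contrapT => nB; apply: nN; apply: SN; split => //; left.
  by split.
have [BN hBN] := choice step.
pose N := \bigcup_n \bigcup_j (BN (j%:R / n.+1%:R)).2.
have m2 n : measurable (\bigcup_j (BN (j%:R / n.+1%:R)).2).
  by apply: bigcup_measurable => j _; have [] := hBN (j%:R / n.+1%:R).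
have mN : measurable N by exact: bigcupT_measurable.
have N0 : mu R I N = 0%E.
  apply: measure0_bigcup => // n; apply: measure0_bigcup => j; by have [] := hBN (j%:R / n.+1%:R).
pose Wn n (x : cubeT R I) : R :=
  n.+1%:R^-1 * \sum_(j < n.+1) \1_((BN (j%:R / n.+1%:R)).1) x.
have Wn01 n x : 0 <= Wn n x <= 1.
  have S0 : 0 <= \sum_(j < n.+1) \1_((BN (j%:R / n.+1%:R)).1) x :> R.
    by apply: sumr_ge0 => j _; rewrite indicE.
  rewrite mulr_ge0//= ler_pdivrMl// mulr1.
  apply: (@le_trans _ _ (\sum_(j < n.+1) 1)); last by rewrite sumr_const card_ord.
  by apply: ler_sum => j _; rewrite indicE; case: (_ \in _).
have mWn n : measurable_fun setT (Wn n).
  apply: (proj1 (bmfZ _ _)); apply: bmf_sum => j _; apply: bmf_indic.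
  by have [] := hBN (j%:R / n.+1%:R).
pose W0 (x : cubeT R I) := limn_sup (fun n => Wn n x).
have W001 x : 0 <= W0 x <= 1 by exact: limn_sup_range.
have mW0 : measurable_fun setT W0 by exact: measurable_limn_sup01.
have W0E x : incube x -> ~ N x -> W0 x = W x.
  move=> cx nN; apply: (cvg_limn_inf_sup _).2.
  apply/cvgrPdist_le => e e0; near=> n.
  have n0 : 0 < n.+1%:R :> R by [].
  apply: (@le_trans _ _ n.+1%:R^-1); last first.
    by apply/ltW; near: n; exact: near_infty_natSinv_lt (PosNum e0).
  have cw : 0 <= W x * n.+1%:R <= n.+1%:R.
    by case/andP: (W01 x cx) => w0 w1; rewrite mulr_ge0//= ler_piMl.
  have := count_below cw.
  have -> : \sum_(j < n.+1) ((j%:R < W x * n.+1%:R)%R : bool)%:R = n.+1%:R * Wn n x :> R.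
    rewrite /Wn mulrA divff ?mul1r ?gt_eqF//; apply: eq_bigr => j _.
    have [_ _ _ /(_ x cx)] := hBN (j%:R / n.+1%:R).
    have nN' : ~ (BN (j%:R / n.+1%:R)).2 x by move=> Nx; apply: nN; exists n => //; exists j.
    move=> /(_ nN') [BW WB]; rewrite -ltr_pdivrMr// indicE; case: ltP => jW.
      by rewrite mem_set//; exact: WB.
    by rewrite memNset// => /BW; rewrite ltNge jW.
  move=> /andP[h1 h2]; rewrite ler_norml; apply/andP; split.
    rewrite -(ler_pM2r n0) mulNr mulVf ?gt_eqF//; lra.
  by rewrite -(ler_pM2r n0) mulVf ?gt_eqF//; lra.
pose c : R := #|{perm 'I_k}|%:R.
have c0 : 0 < c by rewrite ltr0n; apply/card_gt0P; exists 1%g.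
pose W' (x : cubeT R I) := c^-1 * \sum_(s : {perm 'I_k}) W0 (permpt s x).
exists W'; split.
  split.
  - apply: (proj1 (bmfZ _ _)); apply: bmf_sum => s _.
    by apply: (@bmf_comp _ _ _ _ _ W0); [exact: measurable_permpt|exact: bmf01].
  - move=> x; have S0 : 0 <= \sum_(s : {perm 'I_k}) W0 (permpt s x).
      by apply: sumr_ge0 => s _; case/andP: (W001 (permpt s x)).
    apply/andP; split; first by rewrite mulr_ge0// invr_ge0 ltW.
    rewrite /W' ler_pdivrMl// mulr1.
    rewrite /c -sum1_card natr_sum ler_sum// => s _.
    by case/andP: (W001 (permpt s x)).
  - move=> s x; congr (_ * _).
    rewrite [RHS](reindex_inj (mulIg s)) /=.
    by apply: eq_bigr => s' _; rewrite permpt_comp.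
pose N' := \bigcup_(s in [set: {perm 'I_k}]) ((fun x : cubeT R I => permpt s x : cubeT R I) @^-1` N).
have [mN' N'0] : measurable N' /\ mu R I N' = 0%E.
  apply: measure0_finite => s; first by rewrite -[X in measurable X]setTI; exact: measurable_permpt.
  rewrite -[RHS]N0 [RHS](mu_reindex (@perm_rlt_inj k s) mN); congr (mu R I _).
  by apply/seteqP; split => x; rewrite /preimage /= permptE.
exists N'; split => // x cx nN.
have E s : W0 (permpt s x) = W x.
  rewrite -(symW s)// W0E//; first by move=> B; rewrite permptE; exact: cx.
  by move=> Ns; apply: nN; exists s.
rewrite /W' (eq_bigr (fun=> W x)) => [|s _]; last exact: E.
by rewrite sumr_const -/c -[W x *+ _]mulr_natl mulrA mulVf ?mul1r// gt_eqF.
Unshelve. all: by end_near. Qed.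

(** * Exchangeable set systems *)

Lemma enum_set_inj (T : finType) (k : nat) (A : {set T}) : #|A| = k ->
  exists e : 'I_k -> T, injective e /\ e @: [set: 'I_k]%SET = A.
Proof.
move=> <-; exists (@enum_val T (mem A)); split; first exact: enum_val_inj.
apply/setP => a; apply/imsetP/idP => [[i _ ->]|aA]; first exact: enum_valP.
by exists (enum_rank_in aA a) => //; rewrite enum_rankK_in.
Qed.

(** * Conditional expectation and energy on a finite weighted set *)

Section conditional_expectation.
Context (R : realType) (O : finType) (w : O -> R).
Hypothesis w0 : forall o, 0 <= w o.

Definition wsum (g : O -> R) : R := \sum_o w o * g o.

(** Conditional expectation of [xi] given [Z] under the weight [w]. On a fibre of total weight 0 the
    quotient is 0 by convention, which no weighted sum can see. *)
Definition cexp (O' : eqType) (Z : O -> O') (xi : O -> R) (o : O) : R :=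
  (\sum_(o' | Z o' == Z o) w o' * xi o') / (\sum_(o' | Z o' == Z o) w o').

Lemma wsumD g h : wsum (fun o => g o + h o) = wsum g + wsum h.
Proof. by rewrite /wsum -big_split; apply: eq_bigr => o _; rewrite mulrDr. Qed.

Lemma wsumZ c g : wsum (fun o => c * g o) = c * wsum g.
Proof. by rewrite /wsum big_distrr; apply: eq_bigr => o _ /=; rewrite mulrCA. Qed.

Lemma wsumB g h : wsum (fun o => g o - h o) = wsum g - wsum h.
Proof.
by rewrite -mulN1r -wsumZ -wsumD; apply: eq_bigr => o _; rewrite mulN1r.
Qed.

Lemma wsum_le g h : (forall o, g o <= h o) -> wsum g <= wsum h.
Proof. by move=> gh; apply: ler_sum => o _; rewrite ler_wpM2l. Qed.

Lemma wsum_ge0 g : (forall o, 0 <= g o) -> 0 <= wsum g.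
Proof. by move=> g0; apply: sumr_ge0 => o _; rewrite mulr_ge0. Qed.

Lemma wsum_cexp (O' : finType) (Z : O -> O') xi g :
  (forall o o', Z o = Z o' -> g o = g o') ->
  wsum (fun o => cexp Z xi o * g o) = wsum (fun o => xi o * g o).
Proof.
move=> gZ; rewrite /wsum.
rewrite (partition_big Z xpredT)//= [RHS](partition_big Z xpredT)//=.
apply: eq_bigr => z _.
have [[u0 /eqP u0z]|no] := pselect (exists o, Z o == z); last first.
  by rewrite !big_pred0// => o; apply/negP => oz; apply: no; exists o.
have gE o : Z o == z -> g o = g u0 by move=> /eqP oz; apply: gZ; rewrite oz.
rewrite (eq_bigr (fun o => w o * (cexp Z xi u0 * g u0))); last first.
  by move=> o oz; rewrite (gE o oz) /cexp (eqP oz) u0z.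
rewrite [RHS](eq_bigr (fun o => w o * xi o * g u0)); last first.
  by move=> o oz; rewrite (gE o oz) mulrA.
rewrite -!big_distrl/= mulrA; congr (_ * _); rewrite /cexp u0z.
have [D0|D0] := eqVneq (\sum_(o | Z o == z) w o) 0; last by rewrite mulrC divfK.
rewrite D0 mul0r big1// => o oz; move: D0 => /eqP.
by rewrite psumr_eq0// => /allP /(_ o (mem_index_enum o)) /implyP /(_ oz) /eqP ->; rewrite mul0r.
Qed.

Lemma cexp_meas (O' O'' : eqType) (Z : O -> O') (Z' : O -> O'') xi :
  (forall o o', Z' o = Z' o' -> Z o = Z o') ->
  forall o o', Z' o = Z' o' -> cexp Z xi o = cexp Z xi o'.
Proof. by move=> ZZ' o o' /ZZ' oo'; rewrite /cexp oo'. Qed.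

Lemma cexp01 (O' : eqType) (Z : O -> O') xi : (forall o, 0 <= xi o <= 1) ->
  forall o, 0 <= cexp Z xi o <= 1.
Proof.
move=> xi01 o; have D0 : 0 <= \sum_(o' | Z o' == Z o) w o' by exact: sumr_ge0.
have N0 : 0 <= \sum_(o' | Z o' == Z o) w o' * xi o'.
  by apply: sumr_ge0 => o' _; rewrite mulr_ge0//; case/andP: (xi01 o').
apply/andP; split; first by rewrite divr_ge0.
rewrite /cexp; move: D0; rewrite le_eqVlt => /predU1P[<-|D0].
  by rewrite invr0 mulr0 ler01.
rewrite ler_pdivrMr// mul1r ler_sum// => o' _.
by rewrite ler_piMr//; case/andP: (xi01 o').
Qed.

(** By [wsum_cexp] this is the second moment of [cexp Z xi]; it grows when [Z] is refined. *)
Definition energy (O' : eqType) (Z : O -> O') xi := wsum (fun o => xi o * cexp Z xi o).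

Section refinement.
Context (O' O'' : finType) (Z : O -> O') (Z' : O -> O'') (xi : O -> R).
Hypothesis ZZ' : forall o o', Z' o = Z' o' -> Z o = Z o'.

(** Pythagoras for nested conditional expectations: all the cross terms reduce to energies by
    [wsum_cexp]. *)
Lemma energy_diff : wsum (fun o => (cexp Z' xi o - cexp Z xi o) ^+ 2) =
  energy Z' xi - energy Z xi.
Proof.
have e1 : wsum (fun o => cexp Z' xi o * cexp Z' xi o) = energy Z' xi.
  by apply: wsum_cexp; exact: cexp_meas.
have e2 : wsum (fun o => cexp Z' xi o * cexp Z xi o) = energy Z xi.
  by apply: wsum_cexp; exact: cexp_meas.
have e3 : wsum (fun o => cexp Z xi o * cexp Z xi o) = energy Z xi.
  by apply: wsum_cexp; exact: cexp_meas.
rewrite (_ : (fun o => _) = (fun o => (cexp Z' xi o * cexp Z' xi o +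
   (-2) * (cexp Z' xi o * cexp Z xi o)) + cexp Z xi o * cexp Z xi o)); last first.
  by apply/funext => o; ring.
by rewrite !wsumD wsumZ e1 e2 e3; ring.
Qed.

Lemma energy_le : energy Z xi <= energy Z' xi.
Proof. by rewrite -subr_ge0 -energy_diff; apply: wsum_ge0 => o; exact: sqr_ge0. Qed.

Hypothesis w1 : \sum_o w o = 1.

Lemma wsum_sqr g : wsum g ^+ 2 <= wsum (fun o => g o ^+ 2).
Proof.
set c := wsum g.
have : 0 <= wsum (fun o => (g o - c) ^+ 2) by apply: wsum_ge0 => o; exact: sqr_ge0.
rewrite (_ : (fun o => (g o - c) ^+ 2) = (fun o => (g o ^+ 2 + (-2 * c) * g o) + c ^+ 2 * 1)); last first.
  by apply/funext => o; ring.
rewrite !wsumD !wsumZ -/c; have -> : wsum (fun=> 1) = 1.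
  by rewrite /wsum -[RHS]w1; apply: eq_bigr => o _; rewrite mulr1.
by rewrite expr2; lra.
Qed.

(** As [g] is a function of [Z'], the variable [xi] may be replaced by its conditional expectation
    given [Z']; Cauchy-Schwarz and Pythagoras then bound the correlation by the gain in energy. *)
Lemma wsum_cexp_near g : (forall o o', Z' o = Z' o' -> g o = g o') ->
  (forall o, `|g o| <= 1) ->
  (wsum (fun o => (xi o - cexp Z xi o) * g o)) ^+ 2 <= energy Z' xi - energy Z xi.
Proof.
move=> gZ g1.
have -> : wsum (fun o => (xi o - cexp Z xi o) * g o) =
    wsum (fun o => (cexp Z' xi o - cexp Z xi o) * g o).
  rewrite (_ : (fun o => (xi o - cexp Z xi o) * g o) = (fun o => xi o * g o - cexp Z xi o * g o)).
    rewrite (_ : (fun o => (cexp Z' xi o - _) * g o) = (fun o => cexp Z' xi o * g o - cexp Z xi o * g o)).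
      by rewrite !wsumB (wsum_cexp xi gZ).
    by apply/funext => o; rewrite mulrBl.
  by apply/funext => o; rewrite mulrBl.
rewrite -energy_diff; apply: le_trans (wsum_sqr _) _.
apply: wsum_le => o; rewrite exprMn ler_piMr ?sqr_ge0//.
by rewrite -real_normK ?num_real// expr_le1.
Qed.

End refinement.

End conditional_expectation.

Definition pb (T T' : finType) (f : T -> T') (H : {set {set T'}}) : {set {set T}} :=
  [set A : {set T} | f @: A \in H].

Lemma pb_comp (T T' T'' : finType) (f : T -> T') (g : T' -> T'') H :
  pb f (pb g H) = pb (g \o f) H.
Proof. by apply/setP => A; rewrite !inE imset_comp. Qed.

(** Indexing by all finite types turns relabellings, restrictions and the adjunction of reference
    vertices into instances of one invariance under injections. *)
Definition law (R : realType) := forall T : finType, {set {set T}} -> R.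

(* Invariance under bijections is exchangeability, under inclusions it is consistency. *)
Definition exch (R : realType) (P : law R) : Prop :=
  [/\ (forall T H, 0 <= P T H), (forall T, \sum_H P T H = 1) &
      (forall (T T' : finType) (f : T -> T') (g : {set {set T}} -> R), injective f ->
         wsum (P T') (fun H => g (pb f H)) = wsum (P T) g)].

(** With [Rf] a set of reference vertices, this is the information below [A]: the sets containing
    [A] are hidden, since they are what is to be predicted. *)
Definition trace (V : finType) (A Rf : {set V}) (H : {set {set V}}) : {set {set V}} :=
  [set C in H | (C \subset A :|: Rf) && ~~ (A \subset C)].

Lemma trace_pb (V V' : finType) (f : V -> V') (A Rf : {set V}) (H H' : {set {set V'}}) :
  injective f ->
  (trace (f @: A) (f @: Rf) H == trace (f @: A) (f @: Rf) H') =
  (trace A Rf (pb f H) == trace A Rf (pb f H')).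
Proof.
move=> fI; apply/eqP/eqP => /setP E; apply/setP => C.
  have := E (f @: C); rewrite !inE -imsetU.
  have sub (X Y : {set V}) : (f @: X \subset f @: Y) = (X \subset Y).
    apply/idP/idP; last exact: imsetS.
    move=> /fintype.subsetP XY; apply/fintype.subsetP => x xX.
    by have /imsetP[y yY /fI ->] := XY _ (imset_f f xX).
  by rewrite !sub.
rewrite !inE -imsetU; case: (boolP (C \subset f @: (A :|: Rf))) => CA; last by rewrite !andbF.
have CE : C = f @: (f @^-1: C).
  apply/setP => c; apply/idP/imsetP => [cC|[v]]; last by rewrite inE => vC ->.
  have /imsetP[v _ cv] := fintype.subsetP CA _ cC.
  by exists v => //; rewrite inE -cv.
have := E (f @^-1: C); rewrite !inE -CE.
have -> : f @^-1: C \subset A :|: Rf.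
  apply/fintype.subsetP => v; rewrite inE => vC.
  by have /imsetP[u uA /fI ->] := fintype.subsetP CA _ vC.
have -> : (A \subset f @^-1: C) = (f @: A \subset C).
  apply/fintype.subsetP/fintype.subsetP => [AC _ /imsetP[a aA ->]|AC a aA].
    by have := AC _ aA; rewrite inE.
  by rewrite inE AC// imset_f.
by [].
Qed.

Section exchangeable.
Context (R : realType) (P : law R).
Arguments P : clear implicits.
Hypothesis hP : exch P.

Lemma cexp_pb (V V' : finType) (f : V -> V') (A Rf : {set V}) xi H : injective f ->
  cexp (P V') (trace (f @: A) (f @: Rf)) (fun H => xi (pb f H)) H =
  cexp (P V) (trace A Rf) xi (pb f H).
Proof.
move=> fI; have [_ _ PE] := hP; rewrite /cexp.
have S (g : {set {set V}} -> R) :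
    \sum_(H' | trace (f @: A) (f @: Rf) H' == trace (f @: A) (f @: Rf) H) P V' H' * g (pb f H') =
    \sum_(H' | trace A Rf H' == trace A Rf (pb f H)) P V H' * g H'.
  rewrite big_mkcond [RHS]big_mkcond /=.
  transitivity (wsum (P V) (fun H' => if trace A Rf H' == trace A Rf (pb f H) then g H' else 0)).
    rewrite -(PE _ _ f _ fI); apply: eq_bigr => H' _.
    by rewrite trace_pb//; case: ifP => //; rewrite mulr0.
  by apply: eq_bigr => H' _; case: ifP => //; rewrite mulr0.
congr (_ / _); first exact: S.
have := S (fun=> 1); under eq_bigr do rewrite mulr1.
by move=> ->; apply: eq_bigr => H' _; rewrite mulr1.
Qed.

Lemma energy_pb (V V' : finType) (f : V -> V') (A Rf : {set V}) xi : injective f ->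
  energy (P V') (trace (f @: A) (f @: Rf)) (fun H => xi (pb f H)) =
  energy (P V) (trace A Rf) xi.
Proof.
move=> fI; have [_ _ PE] := hP; rewrite /energy -(PE _ _ f _ fI).
by apply: eq_bigr => H _; rewrite cexp_pb.
Qed.

Lemma energy_trace_le (V : finType) (A Rf Rf' : {set V}) xi : Rf \subset Rf' ->
  energy (P V) (trace A Rf) xi <= energy (P V) (trace A Rf') xi.
Proof.
have [P0 _ _] := hP.
move=> RR'; apply: energy_le => // H H' /setP E; apply/setP => C.
have := E C; rewrite !inE; case: (boolP (C \subset A :|: Rf)) => CA; last by rewrite !andbF.
by rewrite (fintype.subset_trans CA (finset.setUS _ RR')).
Qed.

End exchangeable.

(** * Densities and degrees *)

Lemma same_image_perm (T : finType) (k : nat) (e e' : 'I_k -> T) :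
  injective e -> injective e' -> e @: [set: 'I_k]%SET = e' @: [set: 'I_k]%SET ->
  exists s : {perm 'I_k}, forall i, e i = e' (s i).
Proof.
move=> eI eI' ee'.
have /boolp.choice[s sE] : forall i, exists j, e i = e' j.
  move=> i; have : e i \in e' @: [set: 'I_k]%SET by rewrite -ee' imset_f.
  by case/imsetP => j _ ->; exists j.
have sI : injective s by move=> i j /(congr1 e'); rewrite -!sE => /eI.
by exists (perm sI) => i; rewrite permE.
Qed.

Lemma rlt_card k (B : rlt k) : (0 < #|val B| < k)%N.
Proof.
case/andP: (valP B) => B0 BT; rewrite card_gt0 B0 /= ltnNge; apply: contra BT => kB.
by rewrite eqEcard finset.subsetT cardsT card_ord.
Qed.

Lemma img_set_enum (n k : nat) (A : {set 'I_n}) : #|A| = k ->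
  exists e : 'I_k -> 'I_n, [/\ injective e, e @: [set: 'I_k]%SET = A &
    forall B : {set 'I_k}, img_set A B = e @: B].
Proof.
move=> Ak; pose e (i : 'I_k) : 'I_n := enum_val (cast_ord (esym Ak) i).
have eI : injective e by move=> i j /enum_val_inj /cast_ord_inj.
have eA : e @: [set: 'I_k]%SET = A.
  apply/eqP; rewrite eqEcard card_imset// cardsT card_ord Ak leqnn andbT.
  by apply/fintype.subsetP => _ /imsetP[i _ ->]; exact: enum_valP.
exists e; split => // B.
have eidx i : index (e i) (enum A) = i.
  rewrite /e /enum_val index_uniq ?enum_uniq// -cardE; exact: ltn_ord.
apply/setP => a; rewrite inE; apply/idP/imsetP.
  move=> /andP[aA /exists_inP[i iB /eqP ia]]; exists i => //.
  move: aA; rewrite -[in X in X -> _]eA => /imsetP[j _ aj]; move: ia; rewrite aj eidx => ij.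
  by congr e; apply: val_inj.
move=> [i iB ->]; have -> /= : e i \in A by rewrite -eA imset_f.
by apply/exists_inP; exists i => //; rewrite eidx.
Qed.

Section edge_weight.
Context (R : realType) (k : nat) (W : cubeT R (rlt k) -> R).

(* [W] read off the coordinates indexed by the subsets of [A]; the enumeration of
   [A] that is picked is irrelevant since [W] is symmetric. *)
Definition wt (T : finType) (A : {set T}) (x : cubeT R {set T}) : R :=
  if [pick e : {ffun 'I_k -> T} | injectiveb e && (e @: [set: 'I_k]%SET == A)] is Some e
  then W (fun B => x (e @: val B)) else 0.

(** The integral runs over coordinates for all subsets of [T], of which [wt] reads only the
    non-empty proper subsets of edges; vertex types can thus be changed by plain reindexing. *)
Definition tau (T : finType) (E : {set {set T}}) : R :=
  EE (mu R {set T}) (fun x => \prod_(A in E) wt A x).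

Hypothesis hW : hyperB W.

Lemma wtE (T : finType) (e : 'I_k -> T) x : injective e ->
  wt (e @: [set: 'I_k]%SET) x = W (fun B => x (e @: val B)).
Proof.
move=> eI; rewrite /wt; case: pickP => [e' /andP[/injectiveP eI' /eqP ee']|]; last first.
  move=> /(_ (finfun e)) /negP[]; apply/andP; split.
    by apply/injectiveP => i j; rewrite !ffunE => /eI.
  by apply/eqP; apply: eq_imset => i; rewrite ffunE.
have [s sE] := same_image_perm eI eI' (esym ee').
have [_ _ symW] := hW; rewrite -(symW s) permptE; congr W.
apply/funext => B; congr x; rewrite /= -imset_comp; apply: eq_imset => i /=.
by rewrite sE.
Qed.

Lemma wt_map (T T' : finType) (f : T -> T') (A : {set T}) x : injective f -> #|A| = k ->
  wt (f @: A) x = wt A (fun B => x (f @: B)).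
Proof.
move=> fI /enum_set_inj[e [eI <-]]; rewrite -imset_comp (wtE x (inj_comp fI eI)).
by rewrite (wtE _ eI); congr W; apply/funext => B; rewrite -imset_comp.
Qed.

Lemma wt01 (T : finType) (A : {set T}) x : 0 <= wt A x <= 1.
Proof.
by have [_ W01 _] := hW; rewrite /wt; case: pickP => // *; rewrite lexx ler01.
Qed.

Lemma bmf_wt (T : finType) (A : {set T}) : bmf (wt A).
Proof.
rewrite /wt; case: pickP => [e _|_]; last exact: bmf_cst.
apply: (@bmf_comp _ _ _ _ _ W); last exact: hyperB_bmf.
exact: measurable_reindex.
Qed.

Lemma wt_local (T : finType) (A : {set T}) x x' : #|A| = k ->
  (forall B : {set T}, B != finset.set0 -> B \proper A -> x B = x' B) -> wt A x = wt A x'.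
Proof.
move=> /enum_set_inj[e [eI <-]] xx'; rewrite !wtE//; congr W; apply/funext => B.
have /andP[B0 Bk] := rlt_card B.
apply: xx'; first by rewrite imset_eq0 -card_gt0.
by rewrite properEcard imsetS ?finset.subsetT//= !card_imset// cardsT card_ord.
Qed.

Lemma pull_wt (n : nat) (A : {set 'I_n}) x : #|A| = k -> W (pull A x) = wt A x.
Proof.
move=> /img_set_enum[e [eI <- eB]]; rewrite wtE//; congr W.
by apply/funext => B; rewrite /pull eB.
Qed.

End edge_weight.

Section borel_version.
Context (R : realType) (k : nat) (W : (rlt k -> R) -> R) (W' : cubeT R (rlt k) -> R).
Context (N : set (cubeT R (rlt k))).
Hypothesis W01 : forall x, incube x -> 0 <= W x <= 1.
Hypothesis hW' : hyperB W'.
Hypothesis mN : measurable N.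
Hypothesis N0 : mu R (rlt k) N = 0%E.
Hypothesis WW' : forall x, incube x -> ~ N x -> W x = W' x.

Lemma EE_null d (T : measurableType d) (P : probability T R) (M : set T) : measurable M ->
  P M = 0%E -> EE P \1_M = 0.
Proof. by move=> mM; rewrite EE_set// => -[]. Qed.

Lemma pull_measurable n (A : {set 'I_n}) :
  measurable_fun setT (fun x : cubeT R {set 'I_n} => pull A x : cubeT R (rlt k)).
Proof. exact: measurable_reindex. Qed.

Lemma img_set_inj n (A : {set 'I_n}) : #|A| = k ->
  injective (fun B : rlt k => img_set A (val B)).
Proof.
move=> /img_set_enum[e [eI _ eB]] B B'; rewrite !eB => /(imset_inj eI) BB'.
exact: val_inj.
Qed.

Lemma mix_pull n (A : {set 'I_n}) (x y : {set 'I_n} -> R) : #|A| = k ->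
  pull (k := k) A (mix (mem (enum [pred B : {set 'I_n} | (B != finset.set0) && (#|B| < k)%N])) y x) =
  pull A y.
Proof.
move=> /img_set_enum[e [eI _ eB]]; apply/funext => B; rewrite /pull /mix /=.
have /andP[B0 Bk] := rlt_card B.
by rewrite mem_enum inE eB imset_eq0 card_imset// Bk -card_gt0 B0.
Qed.

(** The coordinates below one edge form an injective reindexing, so [N] pulls back to a null set for
    each edge. Off the finite union of these sets the two integrands agree, and [iint] does not see
    that union. *)
Lemma tW_tau (F : kgraph k) : tW F W = tau W' (kE F).
Proof.
have kF A : A \in kE F -> #|A| = k by move: (kunif F) => /forall_inP H /H /eqP.
pose g (x : cubeT R {set 'I_(kv F)}) := \prod_(A in kE F) W' (pull A x).
have bg : bmf g.
  apply: bmf_prod => A _; apply: (@bmf_comp _ _ _ _ _ W'); first exact: pull_measurable.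
  exact: hyperB_bmf.
have W'0 x : 0 <= W' x by have [_ /(_ x) /andP[]] := hW'.
have g0 x : 0 <= g x by apply: prodr_ge0.
pose NA (A : {set 'I_(kv F)}) : set (cubeT R {set 'I_(kv F)}) :=
  if #|A| == k then (fun x => pull A x) @^-1` N else set0.
have mNA A : measurable (NA A).
  rewrite /NA; case: ifP => // _; rewrite -[X in measurable X]setTI.
  exact: pull_measurable.
have NA0 A : mu R _ (NA A) = 0%E.
  rewrite /NA; case: ifPn => [/eqP Ak|_]; last exact: measure0.
  by rewrite -[RHS]N0 [RHS](mu_reindex (@img_set_inj _ _ Ak) mN).
have [mN' N'0] := measure0_finite mNA NA0.
set N' := \bigcup_(A in _) _ in mN' N'0.
rewrite /tW (@iint_eq_off_null _ _ _ _ g N')//; last first.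
- apply/eqP; rewrite eq_le; apply/andP; split; last by apply: EE_ge0 => y; rewrite indicE.
  rewrite -[leRHS](EE_null mN' N'0) le_eqVlt; apply/orP; left; apply/eqP; congr (EE _ _).
  apply/funext => y; rewrite !indicE; congr (nat_of_bool _)%:R.
  by apply/idP/idP; rewrite !inE => -[A _]; rewrite /NA; case: ifPn => // /eqP Ak;
    rewrite /preimage/= ?mix_pull// => NA'; exists A => //; rewrite /NA Ak eqxx /preimage /= ?mix_pull.
- by move=> i; rewrite lexx ler01.
- move=> x cx nN; congr (_%:E); apply: eq_bigr => A AE; apply: WW'.
    by move=> B; exact: cx.
  by move=> NAx; apply: nN; exists A => //; rewrite /NA (kF _ AE) eqxx.
- move=> x cx; rewrite lee_fin; apply: prodr_ge0 => A AE.
  by have /andP[] := W01 (x := pull A x) (fun B => cx _).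
- exact: enum_uniq.
rewrite iintE ?enum_uniq//= /tau; congr (EE _ _); apply/funext => y.
by apply: eq_bigr => A AE; rewrite mix_pull ?kF// pull_wt ?kF.
Qed.

Lemma Wzero_EE : Wzero W <-> EE (mu R (rlt k)) W' = 0.
Proof.
have [mW' W'01 _] := hW'; have bW' := hyperB_bmf hW'.
split.
  move=> /nullP[M [mM M0 WM]].
  apply/eqP; rewrite eq_le; apply/andP; split; last first.
    by apply: EE_ge0 => x; case/andP: (W'01 x).
  have mNC : measurable (N `|` M `|` ~` (@cube R (rlt k) : set (cubeT R (rlt k)))).
    by apply: measurableU; [exact: measurableU|apply: measurableC; exact: measurable_cube].
  have c0 : mu R (rlt k) (~` (@cube R (rlt k))) = 0%E.
    by rewrite probability_setC ?mu_cube ?subee//; exact: measurable_cube.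
  have : mu R (rlt k) (N `|` M `|` ~` (@cube R (rlt k))) = 0%E.
    rewrite null_set_setU ?null_set_setU//; [exact: measurableU|].
    by apply: measurableC; exact: measurable_cube.
  move=> /(EE_null mNC) <-; apply: EE_le => //; first exact: bmf_indic.
  move=> x; rewrite indicE; case: (boolP (x \in _)) => xN.
    by case/andP: (W'01 x).
  move: xN; rewrite notin_setE => xN.
  have cx : incube x by apply: contrapT => ncx; apply: xN; right.
  rewrite -WW'//; last by move=> Nx; apply: xN; left; left.
  rewrite leNgt; apply/negP => Wx; apply: xN; left; right.
  by apply: WM; split.
move=> E0; have [M [mM M0 WM]] := EE_eq0 bW' (fun x => proj1 (andP (W'01 x))) E0.
apply/nullP; exists (N `|` M); split; first exact: measurableU.
  by rewrite null_set_setU.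
move=> x [/= Wx cx]; have [Nx|nNx] := pselect (N x); [by left|right].
by apply: WM => /= W'x; move: Wx; rewrite WW'// W'x ltxx.
Qed.

End borel_version.

(** * The degree function of a hypergraphon and its threshold *)

Section degree.
Context (R : realType) (k l : nat).
Hypothesis lk : (l < k)%N.

(** The default 0 sits exactly on the coordinates selected by [offl], which [mix offl]
    overwrites. *)
Definition ext (x : rle k l -> R) : rlt k -> R :=
  fun B => oapp x 0 (insub (val B) : option (rle k l)).

Definition offl : pred (rlt k) :=
  fun B => ~~ (val B \subset [set i : 'I_k | (i < l)%N]).

Definition degB (W : cubeT R (rlt k) -> R) (x : cubeT R (rle k l)) : R :=
  EE (mu R (rlt k)) (fun y => W (mix offl y (ext x))).

Lemma rle_rlt (B : rle k l) : (val B != finset.set0) && (val B != [set: 'I_k]%SET).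
Proof.
case: B => B /= /andP[-> Bl] /=; apply: contraTneq Bl => ->.
apply/negP => /fintype.subsetP /(_ (Ordinal lk)); rewrite !inE /= ltnn.
by move=> /(_ isT).
Qed.

Definition rle2lt (B : rle k l) : rlt k := Sub (val B) (rle_rlt B).

Lemma rle2lt_inj : injective rle2lt.
Proof. by move=> B B' /(congr1 val) /= BB'; apply: val_inj. Qed.

Lemma mix_ext (y z : rlt k -> R) : mix offl y (ext (fun C => z (rle2lt C))) = mix offl y z.
Proof.
apply/funext => B; rewrite /mix /offl; case: ifPn => // /negPn Bl; rewrite /ext.
have BP : (val B != finset.set0) && (val B \subset [set i : 'I_k | (i < l)%N]).
  by rewrite Bl andbT; case/andP: (valP B).
case: insubP => [C _ CB|]; last by move=> /negP[]; exact: BP.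
by rewrite /= (_ : rle2lt C = B)//; apply: val_inj.
Qed.

Lemma measurable_ext : measurable_fun setT (fun z : cubeT R (rle k l) * cubeT R (rlt k) =>
  mix offl z.2 (ext z.1) : cubeT R (rlt k)).
Proof.
apply: measurable_cubeP => B; rewrite /mix; case: (offl B).
  exact: measurableT_comp (measurable_coord B) measurable_snd.
rewrite /ext; case: insub => [C|]; last exact: measurable_cst.
exact: measurableT_comp (measurable_coord C) measurable_fst.
Qed.

Lemma bmf_degB f : bmf f -> bmf (degB f).
Proof.
move=> bf; apply: (@bmf_EE2 _ _ _ _ _ _ (fun z : cubeT R (rle k l) * cubeT R (rlt k) =>
  f (mix offl z.2 (ext z.1)))).
by apply: bmf_comp bf; exact: measurable_ext.
Qed.

Lemma EE_degB f : bmf f -> EE (mu R (rle k l)) (degB f) = EE (mu R (rlt k)) f.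
Proof.
move=> bf; rewrite -(EI_reindex rle2lt_inj); last exact: bmf_degB.
rewrite -(EI_mix offl bf); congr (EE _ _); apply/funext => z.
by rewrite /degB; congr (EE _ _); apply/funext => y; rewrite mix_ext.
Qed.

Lemma degB01 W x : hyperB W -> 0 <= degB W x <= 1.
Proof.
move=> hW; have [_ W01 _] := hW.
rewrite EE_ge0 => [|y]; last by case/andP: (W01 (mix offl y (ext x))).
rewrite -[leRHS](EE_cst (mu R (rlt k))); apply: EE_le; last 2 first.
- exact: bmf_cst.
- by move=> y; case/andP: (W01 (mix offl y (ext x))).
- by apply: bmf_mixl; exact: hyperB_bmf.
Qed.

End degree.

Section deltaW_char.
Context (R : realType) (k l : nat) (W : (rlt k -> R) -> R) (W' : cubeT R (rlt k) -> R).
Context (N : set (cubeT R (rlt k))).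
Hypothesis lk : (l < k)%N.
Hypothesis W01 : forall x, incube x -> 0 <= W x <= 1.
Hypothesis hW' : hyperB W'.
Hypothesis mN : measurable N.
Hypothesis N0 : mu R (rlt k) N = 0%E.
Hypothesis WW' : forall x, incube x -> ~ N x -> W x = W' x.

Lemma incube_ext (x : rle k l -> R) : incube x -> incube (ext x).
Proof.
move=> cx B; rewrite /ext; case: insub => [C|] /=; first exact: cx.
by rewrite lexx ler01.
Qed.

Lemma degW_degB : exists A : set (cubeT R (rle k l)),
  [/\ measurable A, mu R (rle k l) A = 0%E &
      forall x, incube x -> ~ A x -> degW W x = degB W' x].
Proof.
have bN : bmf (\1_N : cubeT R (rlt k) -> R) by exact: bmf_indic.
have bd := bmf_degB l bN.
have d0 x : 0 <= @degB R k l \1_N x by apply: EE_ge0 => y; rewrite indicE.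
have [|A [mA A0 HA]] := EE_eq0 (P := mu R (rle k l)) bd d0.
  by rewrite EE_degB// (EE_null mN N0).
exists A; split => // x cx nA.
have dx : degB \1_N x = 0 by apply: contrapT => dx; apply: nA; exact: HA.
have [mW' W'01 _] := hW'; have bW' := hyperB_bmf hW'.
have memE : mem (enum [pred B : rlt k | ~~ (val B \subset [set i : 'I_k | (i < l)%N])]) =
    offl l :> (rlt k -> bool).
  by apply/funext => B; rewrite /= mem_enum.
rewrite /degW (@iint_eq_off_null _ _ _ _ W' N) ?enum_uniq//.
- by rewrite iintE ?enum_uniq//= => [|z]; [rewrite memE|case/andP: (W'01 z)].
- by move=> z; case/andP: (W'01 z).
- by move=> z /W01 /andP[]; rewrite lee_fin.
- by move=> z cz nN; rewrite WW'.
- exact: incube_ext.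
- by rewrite memE.
Qed.

(** An essential infimum turned into a gap: the degree avoids the interval ]0, d[ almost surely.
    From this form both the limit and the sampling argument proceed. *)
Lemma deltaW_ge (d : R) : ~ Wzero W -> (d%:E <= deltaW l W)%E <->
  mu R (rle k l) [set x | 0 < degB W' x < d] = 0%E.
Proof.
move=> nW; have [A0 [mA0 A00 HA0]] := degW_degB.
have [mD _] := bmf_degB l (hyperB_bmf hW').
have mS (c : R) : measurable [set x : cubeT R (rle k l) | 0 < degB W' x < c].
  rewrite (_ : [set x | _] = degB W' @^-1` `]0, c[).
    by rewrite -[X in measurable X]setTI; apply: mD => //; exact: measurable_itv.
  by apply/seteqP; split => x /=; rewrite in_itv.
rewrite /deltaW asboolF//; split => [dW|S0]; last first.
  pose A := A0 `|` [set x | 0 < degB W' x < d].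
  apply: (@le_trans _ _ (ereal_inf [set (degW W x)%:E | x in
                   [set x | incube x /\ ~ A x /\ 0 < degW W x]])).
    apply: le_ereal_inf_tmp => _ [x [cx [nA dx]] <-]; rewrite lee_fin leNgt; apply/negP => xd.
    apply: nA; have [|nA0] := pselect (A0 x); [by left|right].
    by rewrite /= -HA0// dx xd.
  apply: ereal_sup_ubound; exists A => //; apply/nullP; exists A; split.
  - exact: measurableU.
  - by rewrite null_set_setU.
  - by move=> x [].
(* The supremum over null sets need not be attained by one null set a priori, so [d] is approached
   strictly from below. *)
have H n : mu R (rle k l) [set x | 0 < degB W' x < d - n.+1%:R^-1] = 0%E.
  have : ((d - n.+1%:R^-1)%:E < ereal_sup
         [set ereal_inf
                [set (degW W x)%:E | x in
                   [set x | incube x /\ ~ A x /\ (0 < degW W x)%R]]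
         | A in [set A : set (rle k l -> R) | null A]])%E.
    by apply: lt_le_trans dW; rewrite lte_fin ltrBlDr ltrDl invr_gt0.
  move=> /ereal_sup_gt[_ [A /nullP[M [mM M0 AM]] <-]] dA.
  apply/eqP; rewrite eq_le measure_ge0 andbT.
  have c0 : mu R (rle k l) (~` (@cube R (rle k l))) = 0%E.
    by rewrite probability_setC ?mu_cube ?subee//; exact: measurable_cube.
  have mC : measurable (~` (@cube R (rle k l)) : set (cubeT R (rle k l))).
    by apply: measurableC; exact: measurable_cube.
  have mU : measurable (A0 `|` M `|` ~` (@cube R (rle k l)) : set (cubeT R (rle k l))).
    by apply: measurableU => //; exact: measurableU.
  rewrite (_ : 0%E = mu R (rle k l) (A0 `|` M `|` ~` (@cube R (rle k l)))); last first.
    by rewrite null_set_setU ?null_set_setU//; exact: measurableU.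
  apply: le_measure; rewrite ?inE// => x /= /andP[x0 xd].
  have [cx|] := pselect (incube x); last by right.
  left; have [|nA0] := pselect (A0 x); [by left|right].
  apply: AM; split => //; apply: contrapT => nA.
  move: dA; apply/negP; rewrite -leNgt.
  apply: (@le_trans _ _ (degW W x)%:E); last by rewrite HA0// lee_fin ltW.
  by apply: ereal_inf_lbound; exists x => //; split => //; rewrite HA0.
rewrite (_ : [set x | _] = \bigcup_n [set x | 0 < degB W' x < d - n.+1%:R^-1]).
  by apply: measure0_bigcup.
apply/seteqP; split => x /=; last first.
  move=> [n _ /andP[-> xd]]; rewrite (lt_trans xd)// ltrBlDr ltrDl invr_gt0//.
move=> /andP[x0 xd]; have d0 : 0 < d - degB W' x by rewrite subr_gt0.
have [n _ /(_ n (leqnn n)) /= nd] := near_infty_natSinv_lt (PosNum d0).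
by exists n => //=; rewrite x0 /= ltrBrDl -ltrBrDr; exact: nd.
Qed.

(** The infimum over an empty set being infinite, the upper bound uses that [W] is non-zero: a
    threshold above 1 would leave no possible positive degree, so the degree and then [W] would
    vanish almost everywhere. *)
Lemma deltaW_range : (0 <= deltaW l W <= 1)%E.
Proof.
have [wz|nW] := pselect (Wzero W).
  by rewrite /deltaW asboolT// lexx lee01.
have bD := bmf_degB l (hyperB_bmf hW').
apply/andP; split.
  have E : [set x : cubeT R (rle k l) | 0 < degB W' x < 0] = set0.
    by apply/seteqP; split => x //= /andP[]; case: ltgtP.
  by apply/deltaW_ge => //; rewrite E measure0.
rewrite leNgt; apply/negP => d1; apply: nW.
have D1 : mu R (rle k l) [set x | 0 < degB W' x < 2] = 0%E.
  have [d [d1' dd]] : exists d : R, 1 < d /\ (d%:E <= deltaW l W)%E.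
    move: d1; case: (deltaW l W) => [r| |]//=; rewrite ?lte_fin => r1.
      by exists r.
    by exists 2; rewrite leey; split => //; rewrite ltr1n.
  have nW : ~ Wzero W.
    move=> wz; move: dd; rewrite /deltaW asboolT// lee_fin; apply/negP.
    by rewrite -ltNge (lt_trans ltr01).
  rewrite -(proj1 (deltaW_ge d nW) dd); congr (mu R _ _).
  apply/seteqP; split => x /= /andP[-> _] /=; have /andP[_ D1] := degB01 (l := l) x hW'.
    exact: le_lt_trans d1'.
  by rewrite (le_lt_trans D1)// ltr1n.
apply/(Wzero_EE hW' mN N0 WW'); rewrite -(@EE_degB _ _ l)//; last exact: hyperB_bmf.
rewrite -[RHS](EE_cst (mu R (rle k l))); apply: EE_ae => //; first exact: bmf_cst.
exists [set x | 0 < degB W' x < 2]; split => //.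
  rewrite (_ : [set x | _] = degB W' @^-1` `]0, 2[).
    by rewrite -[X in measurable X]setTI; apply: bD.1 => //; exact: measurable_itv.
  by apply/seteqP; split => x /=; rewrite in_itv.
move=> x /= /eqP D0; have /andP[D0' D1'] := degB01 (l := l) x hW'.
by rewrite lt_neqAle eq_sym D0 D0' (le_lt_trans D1')// ltr1n.
Qed.

End deltaW_char.

Lemma hypergraphon_normal (R : realType) (k : nat) (W : (rlt k -> R) -> R) : hypergraphon W ->
  exists W' : cubeT R (rlt k) -> R, [/\ hyperB W',
    forall F : kgraph k, tW F W = tau W' (kE F),
    Wzero W <-> EE (mu R (rlt k)) W' = 0 &
    forall l, (l < k)%N -> ((0 <= deltaW l W <= 1)%E /\ forall d : R, ~ Wzero W ->
      ((d%:E <= deltaW l W)%E <-> mu R (rle k l) [set x | 0 < degB W' x < d] = 0%E))].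
Proof.
move=> hW; have [W' [hW' [N [mN N0 WW']]]] := hypergraphon_borel hW.
have [_ W01 _] := hW; exists W'; split => //.
- exact: tW_tau WW'.
- exact: Wzero_EE WW'.
- move=> l lk; split; first exact: deltaW_range WW'.
  by move=> d nW; exact: deltaW_ge WW' _ _.
Qed.

(** * Representation of exchangeable set systems *)

(** Natural numbers code finite sets of reference vertices, so that all the sets with trace [A] are
    listed as one sequence of bits, uniformly in the number of references available. *)
Definition declist (i : nat) : seq nat := odflt [::] (unpickle i).

Definition dec (M i : nat) : {set 'I_M} := [set r : 'I_M | (r : nat) \in declist i]%SET.

(** The elements are listed in increasing order, so that the code of a set does not depend on
    [M]. *)
Definition code (M : nat) (C : {set 'I_M}) : nat :=
  pickle [seq i <- iota 0 M | i \in [seq val r | r in C]].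

(** With at least this many references [dec M i] is the whole coded set; with fewer it may be
    truncated. Hence the side conditions on [needs]. *)
Definition need (i : nat) : nat := \max_(r <- declist i) r.+1.

Definition needs (q : nat) : nat := \max_(i < q) need i.

Lemma need_lt i r : r \in declist i -> (r < need i)%N.
Proof. by move=> ri; rewrite /need (big_rem r ri) /= leq_max leqnn. Qed.

Lemma needs_le q i : (i < q)%N -> (need i <= needs q)%N.
Proof. by move=> iq; have := leq_bigmax (F := fun i : 'I_q => need i) (Ordinal iq). Qed.

Lemma codeK M (C : {set 'I_M}) : dec M (code C) = C.
Proof.
apply/setP => r; rewrite inE /declist /code pickleK /= mem_filter mem_iota add0n ltn_ord /= andbT.
by rewrite (mem_map val_inj) mem_enum.
Qed.

Lemma dec_widen M M' (le : (M <= M')%N) i : (need i <= M)%N ->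
  widen_ord le @: dec M i = dec M' i.
Proof.
move=> ni; apply/setP => r; apply/imsetP/idP => [[u]|].
  by rewrite !inE => ui ->.
rewrite inE => ri; have rM : (r < M)%N := leq_trans (need_lt ri) ni.
by exists (Ordinal rM); [rewrite inE|exact: val_inj].
Qed.

Lemma code_widen M M' (le : (M <= M')%N) (C : {set 'I_M}) : code (widen_ord le @: C) = code C.
Proof.
have iotaE : iota 0 M' = iota 0 M ++ iota M (M' - M) by rewrite -[in LHS](subnKC le) iotaD add0n.
rewrite /code; congr pickle; rewrite iotaE filter_cat.
have -> : [seq i <- iota M (M' - M) | i \in [seq val r | r in widen_ord le @: C]] = [::].
  apply/eqP; rewrite -[_ == _]negbK -has_filter; apply/hasPn => i; rewrite mem_iota => /andP[Mi _].
  apply/mapP => -[r]; rewrite mem_enum => /imsetP[u _ ->] /= iu.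
  by move: Mi; rewrite iu leqNgt ltn_ord.
rewrite cats0; apply: eq_in_filter => i; rewrite mem_iota add0n => iM.
apply/mapP/mapP => -[r]; rewrite mem_enum.
  by move=> /imsetP[u uC ->] ->; exists u; rewrite ?mem_enum.
by move=> rC ->; exists (widen_ord le r) => //; rewrite mem_enum imset_f.
Qed.

Lemma imset_inl_inr (T T' : finType) (M M' : nat) (f : T + 'I_M -> T' + 'I_M')
    (g : T -> T') (h : 'I_M -> 'I_M') (A : {set T}) (C : {set 'I_M}) :
  (forall t, t \in A -> f (inl t) = inl (g t)) -> (forall r, f (inr r) = inr (h r)) ->
  f @: (inl @: A :|: inr @: C) = inl @: (g @: A) :|: inr @: (h @: C).
Proof.
move=> fl fr; rewrite imsetU -!imset_comp; congr (_ :|: _).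
  by apply: eq_in_imset => t tA /=; rewrite fl.
by apply: eq_imset => r /=; rewrite fr.
Qed.

(** * Bits recording the sets with a given trace *)

Section bits.
Context (T : finType) (M : nat).

Definition bit (A : {set T}) (H : {set {set (T + 'I_M)%type}}) (i : nat) : bool :=
  inl @: A :|: inr @: dec M i \in H.

Definition bits (A : {set T}) (q : nat) (H : {set {set (T + 'I_M)%type}}) : seq bool :=
  mkseq (bit A H) q.

End bits.

Definition smap (T T' : finType) (f : T -> T') (M : nat) (v : T + 'I_M) : T' + 'I_M :=
  match v with inl t => inl (f t) | inr r => inr r end.

Definition wmap (T : finType) (M M' : nat) (le : (M <= M')%N) (v : T + 'I_M) : T + 'I_M' :=
  match v with inl t => inl t | inr r => inr (widen_ord le r) end.

(* Turns the vertices outside [A] into additional reference vertices. *)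
Definition kmap (T : finType) (A : {set T}) (M : nat) (v : T + 'I_M) : T + 'I_(M + #|T|) :=
  match v with
  | inl t => if t \in A then inl t else inr (rshift M (enum_rank t))
  | inr r => inr (lshift #|T| r)
  end.

Lemma smap_inj (T T' : finType) (f : T -> T') (M : nat) : injective f -> injective (smap f (M := M)).
Proof. by move=> fI [t|r] [t'|r'] //= [] => [/fI ->|->]. Qed.

Lemma wmap_inj (T : finType) (M M' : nat) (le : (M <= M')%N) : injective (wmap (T := T) le).
Proof. by move=> [t|r] [t'|r'] //= [] => [->//|rr']; congr inr; apply: val_inj. Qed.

Lemma kmap_inj (T : finType) (A : {set T}) (M : nat) : injective (@kmap T A M).
Proof.
move=> [t|r] [t'|r'] /=.
- case: (t \in A); case: (t' \in A) => E //.
    by case: E => ->.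
  by case: E => /addnI/ord_inj/enum_rank_inj ->.
- by case: ifP => tA // [] rr'; have := ltn_ord r'; rewrite -rr' ltnNge leq_addr.
- by case: ifP => tA // [] rr'; have := ltn_ord r; rewrite rr' ltnNge leq_addr.
- by move=> [] rr'; congr inr; apply: val_inj.
Qed.

Lemma bits_smap (T T' : finType) (f : T -> T') (M : nat) (A : {set T}) q H :
  bits (M := M) (f @: A) q H = bits A q (pb (smap f (M := M)) H).
Proof.
apply: eq_mkseq => i; rewrite /bit inE.
rewrite (@imset_inl_inr _ _ _ _ _ f id)//; congr (_ :|: _ \in H).
by rewrite imset_id.
Qed.

Lemma eq_in_mkseq (S : Type) (f g : nat -> S) q : (forall i, (i < q)%N -> f i = g i) ->
  mkseq f q = mkseq g q.
Proof. by move=> fg; apply/eq_in_map => i; rewrite mem_iota add0n => /andP[_ /fg]. Qed.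

Lemma bits_wmap (T : finType) (M M' : nat) (le : (M <= M')%N) (A : {set T}) q H :
  (needs q <= M)%N -> bits A q H = bits A q (pb (wmap le) H).
Proof.
move=> qM; apply: eq_in_mkseq => i iq; rewrite /bit inE.
rewrite (@imset_inl_inr _ _ _ _ _ id (widen_ord le))// imset_id dec_widen//.
exact: leq_trans (needs_le iq) qM.
Qed.

Lemma bits_kmap (T : finType) (M : nat) (A : {set T}) q H :
  (needs q <= M)%N -> bits A q H = bits A q (pb (@kmap T A M) H).
Proof.
move=> qM; apply: eq_in_mkseq => i iq; rewrite /bit inE.
rewrite (@imset_inl_inr _ _ _ _ _ id (lshift #|T|))//; last by move=> t /= ->.
have -> : lshift #|T| = widen_ord (leq_addr #|T| M) :> ('I_M -> _).
  by apply/funext => r; apply: val_inj.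
rewrite imset_id dec_widen//; exact: leq_trans (needs_le iq) qM.
Qed.

(** * Energies as seen from the reference vertices *)

Section energies.
Context (R : realType) (P : law R).
Arguments P : clear implicits.
Hypothesis hP : exch P.

Definition xi (T : finType) (M : nat) (A : {set T}) (s : seq bool)
  (H : {set {set (T + 'I_M)%type}}) : R := (bits A (size s) H == s)%:R.

Definition lref (T : finType) (M : nat) (A : {set T}) : {set (T + 'I_M)%type} := inl @: A.

Definition refs (T : finType) (M : nat) : {set (T + 'I_M)%type} := inr @: [set: 'I_M]%SET.

(* The conditional probability that the first bits of [A] are [s], given the part
   of the system below [A] as seen from [M] reference vertices. *)
Definition cpr (T : finType) (M : nat) (A : {set T}) (s : seq bool) :
  {set {set (T + 'I_M)%type}} -> R :=
  cexp (P (T + 'I_M)%type) (trace (lref M A) (refs T M)) (xi A s).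

Definition cM (T : finType) (M : nat) (A : {set T}) (s : seq bool) : R :=
  energy (P (T + 'I_M)%type) (trace (lref M A) (refs T M)) (xi A s).

Lemma xi01 (T : finType) M (A : {set T}) s H : 0 <= xi (M := M) A s H <= 1.
Proof. by rewrite /xi; case: eqP => _; rewrite ?lexx ?ler01. Qed.

Lemma smap_lref (T T' : finType) (f : T -> T') M (A : {set T}) :
  smap f (M := M) @: lref M A = lref M (f @: A).
Proof. by rewrite /lref -!imset_comp; apply: eq_imset. Qed.

Lemma smap_refs (T T' : finType) (f : T -> T') M : smap f (M := M) @: refs T M = refs T' M.
Proof. by rewrite /refs -!imset_comp; apply: eq_imset. Qed.

Lemma cpr_smap (T T' : finType) (f : T -> T') M (A : {set T}) s H : injective f ->
  cpr (M := M) (f @: A) s H = cpr A s (pb (smap f (M := M)) H).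
Proof.
move=> fI; rewrite /cpr -(cexp_pb hP _ _ _ _ (smap_inj fI)) smap_lref smap_refs.
by congr cexp; apply/funext => H'; rewrite /xi bits_smap.
Qed.

Lemma cM_smap (T T' : finType) (f : T -> T') M (A : {set T}) s : injective f ->
  cM M (f @: A) s = cM M A s.
Proof.
move=> fI; rewrite /cM -(energy_pb hP _ _ _ (smap_inj fI)) smap_lref smap_refs.
by congr energy; apply/funext => H'; rewrite /xi bits_smap.
Qed.

(** By exchangeability only the size of [A] matters, even across vertex types; a rate of convergence
    of the energies found for one set thus serves all sets of that size. *)
Lemma cM_card (T T' : finType) M (A : {set T}) (A' : {set T'}) s : #|A| = #|A'| ->
  cM M A s = cM M A' s.
Proof.
move=> AA'; have [e [eI <-]] := enum_set_inj (erefl #|A|).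
by have [e' [eI' <-]] := enum_set_inj (esym AA'); rewrite !cM_smap.
Qed.

Lemma cM_le (T : finType) M M' (A : {set T}) s : (needs (size s) <= M)%N -> (M <= M')%N ->
  cM M A s <= cM M' A s.
Proof.
move=> sM le; rewrite /cM -(energy_pb hP _ _ _ (@wmap_inj T _ _ le)).
have -> : wmap le @: lref M A = lref M' A by rewrite /lref -!imset_comp; apply: eq_imset.
have -> : (fun H => xi A s (pb (wmap (T := T) le) H)) = xi A s.
  by apply/funext => H'; rewrite /xi -bits_wmap.
apply: energy_trace_le => //.
by rewrite /refs -imset_comp; apply/fintype.subsetP => _ /imsetP[r _ ->]; exact: imset_f.
Qed.

Lemma cM01 (T : finType) M (A : {set T}) s : 0 <= cM M A s <= 1.
Proof.
have [P0 P1 _] := hP; rewrite /cM /energy; apply/andP; split.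
  apply: wsum_ge0 => // H; have /andP[x0 _] := xi01 A s H; rewrite mulr_ge0//.
  by have /andP[] := cexp01 (P0 _) (trace (lref M A) (refs T M)) (xi01 A s) H.
rewrite -(P1 (T + 'I_M)%type) ler_sum// => H _; rewrite ler_piMr//.
have /andP[x0 x1] := xi01 A s H.
have /andP[c0 c1] := cexp01 (P0 _) (trace (lref M A) (refs T M)) (xi01 A s) H.
by rewrite mulr_ile1.
Qed.

(** Once the vertices outside [A] are renamed as references, knowing every set that does not contain
    [A] is knowing part of what [M + #|T|] references see. *)
Lemma energy_kmap (T : finType) M (A : {set T}) s : (needs (size s) <= M)%N ->
  energy (P (T + 'I_M)%type) (trace (lref M A) (finset.setC (lref M A))) (xi A s) <=
  cM (M + #|T|) A s.
Proof.
move=> sM; rewrite -(energy_pb hP _ _ _ (@kmap_inj T A M)).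
have -> : @kmap T A M @: lref M A = lref (M + #|T|) A.
  by rewrite /lref -!imset_comp; apply: eq_in_imset => t /= ->.
have -> : (fun H => xi A s (pb (@kmap T A M) H)) = xi A s.
  by apply/funext => H'; rewrite /xi -bits_kmap.
apply: energy_trace_le => //.
apply/fintype.subsetP => _ /imsetP[[t|r] tA ->] /=; last exact: imset_f.
case: ifP => tA'; last exact: imset_f.
by move: tA; rewrite inE imset_f.
Qed.

(* Approximate conditional independence: given what [M] reference vertices see, the
   bits of [A] are nearly uncorrelated with everything not containing [A]. *)
Lemma cpr_near (T : finType) M (A : {set T}) s (g : {set {set (T + 'I_M)%type}} -> R) :
  (needs (size s) <= M)%N ->
  (forall H H' : {set {set (T + 'I_M)%type}}, 
    (forall C : {set (T + 'I_M)%type}, ~~ (lref M A \subset C) -> (C \in H) = (C \in H')) -> g H = g H') ->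
  (forall H, `|g H| <= 1) ->
  (wsum (P (T + 'I_M)%type) (fun H => (xi A s H - cpr A s H) * g H)) ^+ 2 <=
  cM (M + #|T|) A s - cM M A s.
Proof.
have [P0 P1 _] := hP; move=> sM gA g1.
apply: le_trans (lerB (energy_kmap A sM) (lexx _)).
apply: wsum_cexp_near => // H H' /setP E.
  apply/setP => C; have := E C; rewrite !inE.
  case: (boolP (C \subset lref M A :|: refs T M)) => CA; last by rewrite !andbF.
  have -> : C \subset lref M A :|: finset.setC (lref M A).
    by rewrite finset.setUCr finset.subsetT.
  by [].
apply: gA => C CA; have := E C; rewrite !inE CA andbT.
have -> : C \subset lref M A :|: finset.setC (lref M A).
  by rewrite finset.setUCr finset.subsetT.
by rewrite !andbT.
Qed.

(** As [M] grows the conditional probabilities form a martingale: they condition the same indicator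
    on finer and finer information, and Pythagoras applies. *)
Lemma cpr_mart (T : finType) M M' (A : {set T}) s (le : (M <= M')%N) :
  (needs (size s) <= M)%N ->
  wsum (P (T + 'I_M')%type) (fun H => (cpr A s H - cpr A s (pb (wmap le) H)) ^+ 2) =
  cM M' A s - cM M A s.
Proof.
have [P0 P1 _] := hP; move=> sM.
have E H : cpr A s (pb (wmap (T := T) le) H) =
   cexp (P (T + 'I_M')%type) (trace (lref M' A) (wmap le @: refs T M)) (xi A s) H.
  rewrite /cpr -(cexp_pb hP _ _ _ _ (@wmap_inj T _ _ le)).
  have -> : wmap le @: lref M A = lref M' A by rewrite /lref -!imset_comp; apply: eq_imset.
  by congr cexp; apply/funext => H'; rewrite /xi -bits_wmap.
have EM : cM M A s =
    energy (P (T + 'I_M')%type) (trace (lref M' A) (wmap le @: refs T M)) (xi A s).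
  rewrite /cM -(energy_pb hP _ _ _ (@wmap_inj T _ _ le)).
  have -> : wmap le @: lref M A = lref M' A by rewrite /lref -!imset_comp; apply: eq_imset.
  by congr energy; apply/funext => H'; rewrite /xi -bits_wmap.
rewrite EM /cM -energy_diff//; first by apply: eq_bigr => H _; rewrite E.
move=> H H' /setP HH'; apply/setP => C; have := HH' C; rewrite !inE.
case: (boolP (C \subset lref M' A :|: (wmap le @: refs T M))) => CA; last by rewrite !andbF.
rewrite (fintype.subset_trans CA)//; apply: finset.setUS.
by rewrite /refs -imset_comp; apply/fintype.subsetP => _ /imsetP[r _ ->]; exact: imset_f.
Qed.

End energies.

(** * Drawing a bit sequence from one uniform coordinate *)

Section interval_splitting.
Context (R : realType).
Implicit Types (p : seq bool -> R) (s : seq bool) (t : R).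

(** Left end of the interval of length [p s] attached to [s]. The interval of [rcons s true]
    occupies the left part of it and that of [rcons s false] the rest. *)
Definition off p s : R :=
  \sum_(i < size s) (if nth false s i then 0 else p (rcons (take i s) true)).

Definition splitbit p t s : bool := t < off p s + p (rcons s true).

(* The bits obtained by locating [t] in nested subintervals of [0, 1) of lengths [p s]. *)
Fixpoint pre p t q : seq bool :=
  if q is q'.+1 then rcons (pre p t q') (splitbit p t (pre p t q')) else [::].

Lemma off_rcons p s c : off p (rcons s c) = off p s + (if c then 0 else p (rcons s true)).
Proof.
rewrite /off size_rcons big_ord_recr /= nth_rcons ltnn eqxx -cats1 take_size_cat//.
congr (_ + _); apply: eq_bigr => i _.
by rewrite nth_cat ltn_ord take_cat ltn_ord.
Qed.

Lemma size_pre p t q : size (pre p t q) = q.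
Proof. by elim: q => //= q IH; rewrite size_rcons IH. Qed.

Lemma preE p t q : pre p t q = mkseq (fun i => splitbit p t (pre p t i)) q.
Proof. by elim: q => //= q IH; rewrite [in RHS]mkseqS -IH. Qed.

Definition consistent p : Prop :=
  [/\ p [::] = 1, (forall s, 0 <= p s) &
      forall s, p s = p (rcons s true) + p (rcons s false)].

Lemma off_bounds p s : consistent p -> 0 <= off p s /\ off p s + p s <= 1.
Proof.
move=> [p1 p0 pc]; elim/last_ind: s => [|s c [IH1 IH2]].
  by rewrite /off big_ord0 p1 add0r.
rewrite off_rcons; have ps := pc s; have := p0 (rcons s true); have := p0 (rcons s false).
by case: c => pf pt; split; lra.
Qed.

Lemma pre_eq p t s : consistent p -> 0 <= t < 1 ->
  (pre p t (size s) == s) = (off p s <= t < off p s + p s).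
Proof.
move=> [p1 p0 pc] t01; elim/last_ind: s => [|s c IH].
  by rewrite /off big_ord0 p1 add0r eqxx.
rewrite size_rcons /= eqseq_rcons IH off_rcons /splitbit.
have ps := pc s; have pt := p0 (rcons s true); have pf := p0 (rcons s false).
have [E|nE] := eqVneq (pre p t (size s)) s.
  rewrite E; move: IH; rewrite E eqxx => IH; case/andP: (esym IH) => ta tb.
  case: c; rewrite -IH /= ?addr0; first by rewrite ta /= eqb_id.
  by rewrite eqbF_neg -leNgt -addrA -ps tb andbT.
move: IH; rewrite (negbTE nE) => IH; rewrite -IH /=; apply/esym/negbTE/negP => /andP[ta tb].
suff: off p s <= t < off p s + p s by rewrite -IH.
by case: c ta tb => ta tb; apply/andP; split; lra.
Qed.

End interval_splitting.

Section splitting_measurability.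
Context (R : realType) d (X : measurableType d) (p : X -> seq bool -> R) (tx : X -> R).
Hypothesis mp : forall s, measurable_fun setT (fun x => p x s).
Hypothesis mt : measurable_fun setT tx.

Lemma measurable_ltr_set (f g : X -> R) : measurable_fun setT f -> measurable_fun setT g ->
  measurable [set x | f x < g x].
Proof.
move=> mf mg; have mB := measurable_funB mg mf.
rewrite (_ : [set x | _] = (g \- f) @^-1` `]0, +oo[).
  by rewrite -[X in measurable X]setTI; apply: mB => //; exact: measurable_itv.
by apply/seteqP; split => x /=; rewrite in_itv /= andbT subr_gt0.
Qed.

Lemma measurable_off s : measurable_fun setT (fun x => off (p x) s).
Proof.
apply: measurable_sum => i; case: (nth false s i) => //.
Qed.

Lemma measurable_splitbit s : measurable [set x | splitbit (p x) (tx x) s].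
Proof.
apply: measurable_ltr_set => //; apply: measurable_funD => //; exact: measurable_off.
Qed.

Lemma measurable_pre q s : measurable [set x | pre (p x) (tx x) q = s].
Proof.
elim: q s => [|q IH] s /=.
  case: s => [|c s].
    by rewrite (_ : [set x | _] = setT)//; apply/seteqP; split.
  by rewrite (_ : [set x | _] = set0)//; apply/seteqP; split.
case/lastP: s => [|s c].
  rewrite (_ : [set x | _] = set0)//; apply/seteqP; split => // x /= /(congr1 size).
  by rewrite size_rcons.
have mS : measurable [set x | splitbit (p x) (tx x) s = c].
  case: c; first exact: measurable_splitbit.
  rewrite (_ : [set x | _] = ~` [set x | splitbit (p x) (tx x) s]).
    exact/measurableC/measurable_splitbit.
  by apply/seteqP; split => x /=; case: (splitbit _ _ _).
rewrite (_ : [set x | _] = [set x | pre (p x) (tx x) q = s] `&`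
   [set x | splitbit (p x) (tx x) s = c]); first exact: measurableI.
apply/seteqP; split => x /=; first by move=> /rcons_inj[] <-.
by move=> [E <-]; rewrite E.
Qed.

Lemma measurable_bit_pre q : measurable [set x | splitbit (p x) (tx x) (pre (p x) (tx x) q)].
Proof.
rewrite (_ : [set x | _] = \bigcup_(s in [set: q.-tuple bool])
   [set x | pre (p x) (tx x) q.+1 = rcons s true]).
  apply: fin_bigcup_measurable => [|s _]; last exact: measurable_pre.
  exact: finite_finset.
apply/seteqP; split => x /=.
  move=> b; exists (Tuple (introT eqP (size_pre (p x) (tx x) q))) => //=.
  by rewrite b.
by move=> [u _ /=]; move=> /rcons_inj[].
Qed.

End splitting_measurability.

Section interval_probability.
Context (R : realType) (I : finType) (i : I).

Lemma EE_itv (a b : R) : 0 <= a -> a <= b -> b <= 1 ->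
  EE (mu R I) (fun x => (a <= x i < b)%R%:R) = b - a.
Proof.
move=> a0 ab b1.
have mI : bmf (fun t : measurableTypeR R => (a <= t < b)%R%:R : R).
  apply: bmf_bool; rewrite -set_itvco; exact: measurable_itv.
have bf : bmf (fun x : cubeT R I => (a <= x i < b)%R%:R : R).
  by apply: (@bmf_comp _ _ _ _ _ (fun t : measurableTypeR R => (a <= t < b)%R%:R : R));
   [exact: measurable_coord|exact: mI].
rewrite (EE_upd i bf).
rewrite (_ : (fun t => _) = (fun t => (a <= t < b)%R%:R)); last first.
  by apply/funext => t; rewrite /upd eqxx EE_cst.
apply: EFin_inj; rewrite -(EE_lam mI)//.
transitivity (\int[@lebesgue_measure R]_(t in [set t : R | (0 <= t <= 1)%R])
    (\1_(`[a, b[%classic) t)%:E)%E.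
  by apply: eq_integral => t _; rewrite -indic_bool set_itvco.
have mD : measurable [set t : R | 0 <= t <= 1].
  by rewrite -set_itvcc; exact: measurable_itv.
have mJ := @measurable_itv R `[a, b[.
rewrite integral_indic//.
rewrite setIidl.
  have := @lebesgue_measure_itv R `[a, b[; rewrite /= lte_fin => ->.
  by case: ltgtP ab => // [-> _]; rewrite subrr.
by move=> t /=; rewrite in_itv /= => /andP[at_ tb]; apply/andP; split; lra.
Qed.

Lemma EE_pre (p : seq bool -> R) s : consistent p ->
  EE (mu R I) (fun x => (pre p (x i) (size s) == s)%:R) = p s.
Proof.
move=> cp; have [p1 p0 pc] := cp; have [ ob1 ob2] := off_bounds s cp.
have mpre : measurable [set x : cubeT R I | pre p (x i) (size s) == s].
  have := @measurable_pre R _ (cubeT R I) (fun=> p) (fun x => x i) _ _ (size s) s.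
  have E : [set x : cubeT R I | pre p (x i) (size s) = s] =
     [set x : cubeT R I | pre p (x i) (size s) == s].
    by apply/seteqP; split => x /= /eqP.
  rewrite E; apply => //; exact: measurable_coord.
have bf := bmf_bool R mpre.
have mI : measurable [set x : cubeT R I | off p s <= x i < off p s + p s].
  have := @measurable_coord R I i measurableT _ (measurable_itv `[off p s, off p s + p s[).
  rewrite setTI; congr measurable; apply/seteqP; split => x; by rewrite /= in_itv.
rewrite -[RHS](_ : (off p s + p s) - off p s = _); last by ring.
rewrite -EE_itv//; last by rewrite lerDl.
apply: EE_ae => //; first exact: bmf_bool.
have mc : measurable [set x : cubeT R I | ~ (0 <= x i < 1)].
  rewrite (_ : [set x | _] = ~` ((fun x : cubeT R I => x i) @^-1` `[0, 1[)).
    by apply: measurableC; rewrite -[X in measurable X]setTI;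
      apply: (@measurable_coord R I i) => //; exact: measurable_itv.
  by apply/seteqP; split => x; rewrite /= in_itv.
have m01 : measurable [set x : cubeT R I | 0 <= x i < 1].
  by rewrite -[X in measurable X]setCK; exact: measurableC.
exists [set x : cubeT R I | ~ (0 <= x i < 1)]; split => //.
  transitivity (mu R I (~` [set x : cubeT R I | 0 <= x i < 1])) => //.
  by rewrite probability_setC// EE_bool// EE_itv// subr0 subee.
by move=> x /= nE t01; apply: nE; rewrite pre_eq.
Qed.

End interval_probability.

Lemma bmf_setval (R : realType) d (X : measurableType d) (U : finType) (F : X -> {set U})
    (g : {set U} -> R) : (forall u, measurable [set x | u \in F x]) -> bmf (fun x => g (F x)).
Proof.
move=> mF.
have mK K : measurable [set x | F x == K].
  rewrite (_ : [set x | F x == K] = \bigcap_(u in [set: U])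
     (if u \in K then [set x | u \in F x] else ~` [set x | u \in F x])).
    apply: fin_bigcap_measurable => [|u _]; first exact: finite_finset.
    by case: ifP => _; [exact: mF|exact/measurableC/mF].
  apply/seteqP; split => x /=; first by move=> /eqP E u _; case: ifPn => uK /=; rewrite E //; exact/negP.
  move=> H; apply/eqP/setP => u; have := H u Logic.I; case: ifPn => uK /=; first by move=> ->.
  by move=> /negP/negbTE.
apply: (@eq_bmf _ _ _ (fun x => \sum_(K : {set U}) g K * (F x == K)%:R)).
  move=> x; rewrite (bigD1 (F x))//= eqxx mulr1 big1 ?addr0// => K /negbTE.
  by rewrite eq_sym => ->; rewrite mulr0.
by apply: bmf_sum => K _; apply: bmfZ; exact: bmf_bool.
Qed.

(** * Set systems sorted by the size of their traces *)

Section set_systems.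
Context (T : finType) (M : nat).
Implicit Types (C : {set (T + 'I_M)%type}) (H : {set {set (T + 'I_M)%type}}).

Definition linl C : {set T} := inl @^-1: C.
Definition linr C : {set 'I_M} := inr @^-1: C.
Definition cut (j : nat) H : {set {set (T + 'I_M)%type}} := [set C in H | (#|linl C| < j)%N]%SET.

Lemma linlrK C : inl @: linl C :|: inr @: linr C = C.
Proof.
apply/setP => -[t|r]; rewrite !inE; apply/orP/idP.
- by case=> /imsetP[u] //; rewrite inE => uC [->].
- by move=> tC; left; apply/imsetP; exists t; rewrite ?inE.
- by case=> /imsetP[u] //; rewrite inE => uC [->].
- by move=> rC; right; apply/imsetP; exists r; rewrite ?inE.
Qed.

End set_systems.

Section set_system_maps.
Context (T : finType) (M : nat).
Implicit Types (C : {set (T + 'I_M)%type}) (H : {set {set (T + 'I_M)%type}}).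

Lemma linl_smap (T' : finType) (f : T -> T') C : linl (smap f (M := M) @: C) = f @: linl C.
Proof.
apply/setP => t; rewrite inE; apply/imsetP/imsetP.
  by case=> -[u|r] uC // [->]; exists u => //; rewrite inE.
by case=> u; rewrite inE => uC ->; exists (inl u).
Qed.

Lemma linr_smap (T' : finType) (f : T -> T') C : linr (smap f (M := M) @: C) = linr C.
Proof.
apply/setP => t; rewrite !inE; apply/imsetP/idP.
  by case=> -[u|r] uC // [->].
by move=> tC; exists (inr t).
Qed.

Lemma linl_wmap M' (le : (M <= M')%N) C : linl (wmap le @: C) = linl C.
Proof.
apply/setP => t; rewrite !inE; apply/imsetP/idP.
  by case=> -[u|r] uC // [->].
by move=> tC; exists (inl t).
Qed.

Lemma linr_wmap M' (le : (M <= M')%N) C : linr (wmap le @: C) = widen_ord le @: linr C.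
Proof.
apply/setP => t; rewrite inE; apply/imsetP/imsetP.
  by case=> -[u|r] uC // [->]; exists r => //; rewrite inE.
by case=> u; rewrite inE => uC ->; exists (inr u).
Qed.

Lemma cut_wmap j M' (le : (M <= M')%N) (H : {set {set (T + 'I_M')%type}}) :
  pb (wmap le) (cut j H) = cut j (pb (wmap (T := T) le) H).
Proof. by apply/setP => C; rewrite !inE linl_wmap. Qed.

(** A set inside [A] plus the references that does not contain [A] meets [T] in a proper subset of
    [A]. The information below a set of size [j] is therefore already represented at stage [j]. *)
Lemma trace_cut j (A : {set T}) H : #|A| = j ->
  trace (lref M A) (refs T M) (cut j H) = trace (lref M A) (refs T M) H.
Proof.
move=> Aj; apply/setP => C; rewrite !inE.
case: (boolP (C \subset lref M A :|: refs T M)) => CA; last by rewrite !andbF.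
case: (boolP (lref M A \subset C)) => AC; first by rewrite !andbF.
rewrite !andbT; case: (C \in H) => //=; rewrite -Aj; apply: proper_card.
rewrite properE; apply/andP; split.
  apply/fintype.subsetP => t; rewrite inE => tC.
  have := fintype.subsetP CA _ tC; rewrite inE => /orP[] /imsetP[u uA] // [->] //.
apply: contra AC => /fintype.subsetP AC; apply/fintype.subsetP => _ /imsetP[t tA ->].
by have := AC _ tA; rewrite inE.
Qed.

End set_system_maps.

Definition repr (R : realType) := forall T : finType, {set T} -> cubeT R {set T} -> nat -> bool.

Section representation.
Context (R : realType) (P : law R).
Arguments P : clear implicits.
Hypothesis hP : exch P.

Definition Gx (Psi : repr R) (j : nat) (T : finType) (M : nat) (x : cubeT R {set T}) :
  {set {set (T + 'I_M)%type}} :=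
  [set C : {set (T + 'I_M)%type} | (#|linl C| < j)%N && @Psi T (linl C) x (code (linr C))]%SET.

(* The bits [Psi T A x] encode the sets with trace [A] on [T] whose other elements are
   reference vertices taken from an infinite reservoir; [isrepr j] says that the sets
   of trace smaller than [j] then have the law prescribed by [P]. *)
Definition isrepr (j : nat) (Psi : repr R) : Prop :=
  [/\ (forall T A q, measurable [set x | @Psi T A x q]),
      (forall (T T' : finType) (f : T -> T') (A : {set T}) (x : cubeT R {set T'}) q,
         injective f -> @Psi T' (f @: A) x q = @Psi T A (fun B => x (f @: B)) q) &
      (forall (T : finType) M g, EE (mu R {set T}) (fun x => g (Gx Psi j M x)) =
         wsum (P (T + 'I_M)%type) (fun H => g (cut j H)))].

Section step.
Context (j : nat) (Psi : repr R).
Hypothesis hPsi : isrepr j Psi.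

Lemma pb_smap_Gx (T T' : finType) (f : T -> T') M (x : cubeT R {set T'}) : injective f ->
  pb (smap f (M := M)) (Gx Psi j M x) = Gx Psi j M (fun B => x (f @: B)).
Proof.
have [_ nat_ _] := hPsi => fI; apply/setP => C.
by rewrite !inE linl_smap linr_smap card_imset// nat_.
Qed.

Lemma pb_wmap_Gx (T : finType) M M' (le : (M <= M')%N) (x : cubeT R {set T}) :
  pb (wmap le) (Gx Psi j M' x) = Gx Psi j M x.
Proof. by apply/setP => C; rewrite !inE linl_wmap linr_wmap code_widen. Qed.

Lemma bmf_Gx (T : finType) M (g : {set {set (T + 'I_M)%type}} -> R) :
  bmf (fun x => g (Gx Psi j M x)).
Proof.
have [mPsi _ _] := hPsi; apply: bmf_setval => C.
case: (boolP (#|linl C| < j)%N) => Cj; last first.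
  rewrite (_ : [set x | _] = set0)//; apply/seteqP; split => x //=.
  by rewrite inE (negbTE Cj).
rewrite (_ : [set x | _] = [set x | @Psi T (linl C) x (code (linr C))])//.
by apply/seteqP; split => x /=; rewrite inE Cj.
Qed.

(** Naturality along the injection that enumerates [A] expresses the bits of [A] through the
    coordinates of its subsets alone. *)
Lemma Psi_local (T : finType) (A : {set T}) (x x' : cubeT R {set T}) q :
  (forall B : {set T}, B \subset A -> x B = x' B) -> @Psi T A x q = @Psi T A x' q.
Proof.
have [_ nat_ _] := hPsi => xx'.
have -> : A = (fun i : 'I_#|A| => enum_val i) @: [set: 'I_#|A|]%SET.
  apply/eqP; rewrite eq_sym eqEcard card_imset ?cardsT ?card_ord ?leqnn ?andbT; last exact: enum_val_inj.
  by apply/fintype.subsetP => _ /imsetP[i _ ->]; exact: enum_valP.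
rewrite !nat_; [|exact: enum_val_inj..].
congr (@Psi _ _ _ _); apply/funext => B; apply: xx'.
by apply/fintype.subsetP => _ /imsetP[i _ ->]; exact: enum_valP.
Qed.

Lemma Gx_local (T : finType) M (x x' : cubeT R {set T}) :
  (forall B : {set T}, (#|B| < j)%N -> x B = x' B) -> Gx Psi j M x = Gx Psi j M x'.
Proof.
move=> xx'; apply/setP => C; rewrite !inE; case: (boolP (#|linl C| < j)%N) => //= Cj.
apply: Psi_local => B BC; apply: xx'; exact: leq_ltn_trans (subset_leq_card BC) Cj.
Qed.

Definition cond_bits (T : finType) M (A : {set T}) s (x : cubeT R {set T}) : R :=
  cpr P A s (Gx Psi j M x).

Lemma cpr_cut (T : finType) M (A : {set T}) s (H : {set {set (T + 'I_M)%type}}) : #|A| = j ->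
  cpr P A s (cut j H) = cpr P A s H.
Proof. by move=> Aj; rewrite /cpr /cexp trace_cut. Qed.

Lemma cpr01 (T : finType) M (A : {set T}) s (H : {set {set (T + 'I_M)%type}}) :
  0 <= cpr P A s H <= 1.
Proof. by have [P0 _ _] := hP; apply: cexp01 => // H'; exact: xi01. Qed.

Lemma px01 (T : finType) M (A : {set T}) s x : 0 <= cond_bits M A s x <= 1.
Proof. exact: cpr01. Qed.

Lemma bmf_px (T : finType) M (A : {set T}) s : bmf (cond_bits M A s).
Proof. exact: bmf_Gx. Qed.

Lemma px_nat (T T' : finType) (f : T -> T') M (A : {set T}) s (x : cubeT R {set T'}) :
  injective f -> cond_bits M (f @: A) s x = cond_bits M A s (fun B => x (f @: B)).
Proof. by move=> fI; rewrite /cond_bits cpr_smap// pb_smap_Gx. Qed.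

Lemma EE_px_diff (T : finType) M M' (A : {set T}) s : #|A| = j ->
  (needs (size s) <= M)%N -> (M <= M')%N ->
  EE (mu R {set T}) (fun x => (cond_bits M' A s x - cond_bits M A s x) ^+ 2) = cM P M' A s - cM P M A s.
Proof.
have [_ _ law_] := hPsi => Aj sM le.
pose g (K : {set {set (T + 'I_M')%type}}) := (cpr P A s K - cpr P A s (pb (wmap le) K)) ^+ 2.
have -> : (fun x => (cond_bits M' A s x - cond_bits M A s x) ^+ 2) = (fun x => g (Gx Psi j M' x)).
  by apply/funext => x; rewrite /g pb_wmap_Gx.
rewrite law_ -(cpr_mart hP A le sM); apply: eq_bigr => H _.
by rewrite /g cut_wmap !cpr_cut.
Qed.

End step.

(** The energies increase with [M] and stay below 1, hence converge. The gap is asked to be a square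
    so that Cauchy-Schwarz turns it into an L1 distance of 2^-i; the running maximum over [i'] makes
    the thresholds monotone. *)
Lemma cM_rate (j : nat) : exists sub : seq bool -> nat -> nat,
  forall (T : finType) (A : {set T}) s i, #|A| = j -> [/\ (needs (size s) <= sub s i)%N,
    (sub s i <= sub s i.+1)%N &
    forall M M', (sub s i <= M)%N -> (M <= M')%N ->
      cM P M' A s - cM P M A s <= (2^-1 ^+ i) ^+ 2].
Proof.
pose A0 := [set: 'I_j]%SET.
have rate (s : seq bool) : forall i, exists m, (needs (size s) <= m)%N /\
    forall M M', (m <= M)%N -> (M <= M')%N -> cM P M' A0 s - cM P M A0 s <= (2^-1 ^+ i) ^+ 2.
  move=> i; pose e : R := (2^-1 ^+ i) ^+ 2.
  have e0 : 0 < e by rewrite !exprn_gt0.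
  pose S := [set cM P M A0 s | M in [set M | (needs (size s) <= M)%N]].
  have hS : has_sup S.
    split; first by exists (cM P (needs (size s)) A0 s); exists (needs (size s)) => /=.
    by exists 1 => _ [M _ <-]; have /andP[] := cM01 hP M A0 s.
  have [_ [m /= nm <-] mS] := sup_adherent e0 hS.
  exists m; split => // M M' mM MM'; rewrite lerBlDr.
  have h1 : cM P m A0 s <= cM P M A0 s by exact: cM_le.
  have h2 : cM P M' A0 s <= sup S.
    apply: ub_le_sup; first by case: hS.
    by exists M' => //=; rewrite (leq_trans nm)// (leq_trans mM).
  by move: mS; rewrite ltrBlDr => mS; rewrite (le_trans h2)// ltW// (lt_le_trans mS)// addrC lerD2l.
have /boolp.choice[m hm] : forall si : seq bool * nat, exists m, (needs (size si.1) <= m)%N /\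
    forall M M', (m <= M)%N -> (M <= M')%N -> cM P M' A0 si.1 - cM P M A0 si.1 <= (2^-1 ^+ si.2) ^+ 2.
  by move=> [s i]; exact: rate.
exists (fun s i => \max_(i' < i.+1) m (s, i' : nat))%N => T A s i Aj.
have ms : (m (s, i) <= \max_(i' < i.+1) m (s, i' : nat))%N.
  by have := leq_bigmax (F := fun i' : 'I_i.+1 => m (s, i' : nat)) ord_max.
have [n1 n2] := hm (s, i); split.
- exact: leq_trans ms.
- by rewrite [X in (_ <= X)%N]big_ord_recr /= leq_maxl.
- move=> M M' sM MM'; rewrite !(@cM_card _ _ hP T _ _ A A0) ?cardsT ?card_ord//.
  by apply: n2 => //; exact: leq_trans sM.
Qed.

End representation.

Lemma le0_half_pow (R : realType) (x c : R) : 0 <= c ->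
  (forall i, x <= c * 2^-1 ^+ i) -> x <= 0.
Proof.
move=> c0 H; rewrite leNgt; apply/negP => x0.
have c1 : 0 < c + 1 by rewrite ltr_wpDl.
have [i _ /(_ i (leqnn i)) /= ie] := near_infty_natSinv_expn_lt (PosNum (divr_gt0 x0 c1)).
have := H i; apply/negP; rewrite -ltNge.
move: ie; rewrite ltr_pdivlMr// div1r -exprVn; apply: le_lt_trans.
by rewrite mulrC ler_wpM2l ?exprn_ge0// lerDl.
Qed.

Lemma add3_le9 (R : realDomainType) (a b c q : R) :
  a <= 3 * q -> b <= 3 * q -> c <= 3 * q -> a + (b + c) <= 9 * q.
Proof. by move=> *; lra. Qed.

Lemma prod_diff (R : realDomainType) (B : eqType) (r : seq B) (a b : B -> R) :
  (forall i, 0 <= a i <= 1) -> (forall i, 0 <= b i <= 1) ->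
  `|\prod_(i <- r) a i - \prod_(i <- r) b i| <= \sum_(i <- r) `|a i - b i|.
Proof.
move=> a01 b01; elim: r => [|i r IH]; first by rewrite !big_nil subrr normr0.
rewrite !big_cons.
have -> : a i * \prod_(j <- r) a j - b i * \prod_(j <- r) b j =
  (a i - b i) * \prod_(j <- r) a j + b i * (\prod_(j <- r) a j - \prod_(j <- r) b j) by ring.
apply: le_trans (ler_normD _ _) _; rewrite !normrM; apply: lerD.
  rewrite ler_piMr// ger0_norm; first by apply: prodr_ile1.
  by apply: prodr_ge0 => j _; case/andP: (a01 j).
by apply: le_trans IH; rewrite ler_piMl// ger0_norm; case/andP: (b01 i).
Qed.

Lemma ae_finite (R : realType) d (X : measurableType d) (Q : probability X R) (J : finType)
    (F : J -> X -> Prop) : (forall i, \forall x \ae Q, F i x) -> \forall x \ae Q, forall i, F i x.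
Proof.
move=> FF.
have /boolp.choice[N hN] : forall i, exists N, [/\ measurable N, Q N = 0%E & ~` F i `<=` N].
  by move=> i; have [N [mN N0 FN]] := FF i; exists N; split => // x nF; apply: FN.
have [mU U0] : measurable (\bigcup_(i in [set: J]) N i) /\ Q (\bigcup_(i in [set: J]) N i) = 0%E.
  by apply: measure0_finite => i; have [] := hN i.
exists (\bigcup_(i in [set: J]) N i); split => // x /= /existsNP[i nF].
by exists i => //; have [_ _] := hN i; apply.
Qed.

(** A function of the family [phi] is expanded over its possible values [sg], with indicators.
    Pinning [sg] to [dflt] outside [J] leaves exactly one non-zero term. *)
Lemma sum_assignments (R : comRingType) (A : finType) (B : finType) (J : {pred A}) (dflt : B)
    (phi : A -> B) (G : {ffun A -> B} -> R) :
  \sum_(sg : {ffun A -> B}) G sg * [forall a, (a \notin J) ==> (sg a == dflt)]%:R *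
      \prod_(a <- enum J) (phi a == sg a)%:R =
  G [ffun a => if a \in J then phi a else dflt].
Proof.
set s0 := finfun _; rewrite (bigD1 s0)//= [X in _ + X]big1 ?addr0.
  have -> : [forall a, (a \notin J) ==> (s0 a == dflt)].
    by apply/forallP => a; apply/implyP => aJ; rewrite ffunE (negbTE aJ).
  rewrite mulr1 big_seq big1 ?mulr1// => a; rewrite mem_enum => aJ.
  by rewrite ffunE aJ eqxx.
move=> sg sgn; case: (boolP [forall a, (a \notin J) ==> (sg a == dflt)]) => [/forallP H|_]; last first.
  by rewrite mulr0 mul0r.
suff /existsP[a /andP[aJ na]] : [exists a, (a \in J) && (phi a != sg a)].
  by rewrite (big_rem a) ?mem_enum//= (negbTE na) mul0r mulr0.
apply: contraNT sgn => /existsPn na; apply/eqP/ffunP => a; rewrite ffunE.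
case: ifPn => aJ; first by have := na a; rewrite aJ /= negbK => /eqP.
by have := H a; rewrite aJ /= => /eqP.
Qed.

(** * Limiting conditional probabilities of the bits *)

Section step.
Context (R : realType) (P : law R).
Arguments P : clear implicits.
Hypothesis hP : exch P.
Context (j : nat) (Psi : repr R).
Hypothesis hPsi : isrepr P j Psi.
Context (sub : seq bool -> nat -> nat).
Hypothesis hsub : forall (T : finType) (A : {set T}) s i, #|A| = j ->
  [/\ (needs (size s) <= sub s i)%N, (sub s i <= sub s i.+1)%N &
    forall M M', (sub s i <= M)%N -> (M <= M')%N ->
      cM P M' A s - cM P M A s <= (2^-1 ^+ i) ^+ 2].

Notation px := (cond_bits P j Psi).

(** An upper limit rather than an almost sure limit: it is defined for every [x], so naturality and
    locality hold without exceptional sets. *)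
Definition cond_lim (T : finType) (A : {set T}) (x : cubeT R {set T}) s : R :=
  limn_sup (fun i => px (sub s i) A s x).

Lemma EE_px_near (T : finType) (A : {set T}) s i M M' : #|A| = j ->
  (sub s i <= M)%N -> (M <= M')%N ->
  EE (mu R {set T}) (fun x => `|px M' A s x - px M A s x|) <= 2^-1 ^+ i.
Proof.
move=> Aj sM MM'; have [n1 n2 n3] := hsub s i Aj.
rewrite -(@ler_pXn2r _ 2)// ?nnegrE ?exprn_ge0//; last by apply: EE_ge0.
apply: le_trans (EE_norm_sqr _ _) _.
  by apply: bmfB; exact: bmf_px.
by rewrite (EE_px_diff hP hPsi)// ?n3// (leq_trans n1).
Qed.

Lemma pinf01 (T : finType) (A : {set T}) x s : 0 <= cond_lim A x s <= 1.
Proof. by apply: (@limn_sup_range _ _ _ (fun i => px (sub s i) A s)) => i z; exact: px01. Qed.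

Lemma bmf_pinf (T : finType) (A : {set T}) s : bmf (cond_lim A ^~ s).
Proof.
apply: bmf01 => [|x]; last exact: pinf01.
apply: (@measurable_limn_sup01 _ _ _ (fun i => px (sub s i) A s)) => i.
  by have [] := bmf_px hPsi (sub s i) A s.
by move=> z; exact: px01.
Qed.

(** The factor 3 is 2 for the limit against stage [sub s i], plus 1 for stage [sub s i] against
    stage [M]. *)
Lemma EE_pinf_px (T : finType) (A : {set T}) s i M : #|A| = j -> (sub s i <= M)%N ->
  EE (mu R {set T}) (fun x => `|cond_lim A x s - px M A s x|) <= 3 * 2^-1 ^+ i.
Proof.
move=> Aj sM; have [n1 n2 n3] := hsub s i Aj.
have b1 := bmf_pinf A s; have b2 := bmf_px hPsi M A s; have b3 := bmf_px hPsi (sub s i) A s.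
apply: (@le_trans _ _ (EE (mu R {set T}) (fun x =>
    `|cond_lim A x s - px (sub s i) A s x| + `|px M A s x - px (sub s i) A s x|))).
  apply: EE_le.
  - exact/bmf_norm/bmfB.
  - by apply: bmfD; exact/bmf_norm/bmfB.
  - by move=> x; rewrite [X in _ <= _ + X]distrC; exact: ler_distD.
rewrite EED; [|exact/bmf_norm/bmfB|exact/bmf_norm/bmfB].
have h1 := EE_px_near Aj (leqnn _) sM.
suff h2 : EE (mu R {set T}) (fun x => `|cond_lim A x s - px (sub s i) A s x|) <= 2 * 2^-1 ^+ i.
  by apply: le_trans (lerD h2 h1) _; rewrite -[X in _ + X]mul1r -mulrDl natr1.
apply: (@EE_limn_sup _ _ _ (mu R {set T}) (fun i => px (sub s i) A s)).
- by move=> n; have [] := bmf_px hPsi (sub s n) A s.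
- by move=> n x; exact: px01.
- by move=> n; apply: EE_px_near => //; have [] := hsub s n Aj.
Qed.

Lemma pinf_nat (T T' : finType) (f : T -> T') (A : {set T}) s (x : cubeT R {set T'}) :
  injective f -> cond_lim (f @: A) x s = cond_lim A (fun B => x (f @: B)) s.
Proof. by move=> fI; congr limn_sup; apply/funext => i; rewrite (px_nat hP hPsi). Qed.

Lemma pinf_local (T : finType) (A : {set T}) s (x x' : cubeT R {set T}) :
  (forall B : {set T}, (#|B| < j)%N -> x B = x' B) -> cond_lim A x s = cond_lim A x' s.
Proof.
move=> xx'; congr limn_sup; apply/funext => i.
by rewrite /cond_bits (Gx_local hPsi _ xx').
Qed.

Lemma cpr_rcons (T : finType) M (A : {set T}) s (H : {set {set (T + 'I_M)%type}}) :
  cpr P A s H = cpr P A (rcons s true) H + cpr P A (rcons s false) H.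
Proof.
rewrite /cpr /cexp -mulrDl -big_split; congr (_ / _); apply: eq_bigr => H' _ /=.
rewrite -mulrDr; congr (_ * _); rewrite /xi !size_rcons.
rewrite /bits mkseqS !eqseq_rcons.
by case: (_ == s); case: (bit _ _ _); rewrite ?addr0 ?add0r.
Qed.

(** Additivity is exact for finitely many references, and each of the three terms is within
    [3 * 2^-1 ^+ i] of its limit in L1, whence the total of 9. *)
Lemma pinf_add (T : finType) (A : {set T}) s : #|A| = j ->
  \forall x \ae mu R {set T}, cond_lim A x s = cond_lim A x (rcons s true) + cond_lim A x (rcons s false).
Proof.
move=> Aj; pose D x := cond_lim A x s - (cond_lim A x (rcons s true) + cond_lim A x (rcons s false)).
have bD : bmf D by apply: bmfB; [|apply: bmfD]; exact: bmf_pinf.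
suff E0 : EE (mu R {set T}) (fun x => `|D x|) = 0.
  have := EE_eq0 (bmf_norm bD) (fun x => normr_ge0 _) E0.
  by apply: filterS => x /eqP; rewrite normr_eq0 subr_eq0 => /eqP.
apply/eqP; rewrite eq_le EE_ge0// andbT; apply: (@le0_half_pow _ _ 9) => // i.
set s1 := rcons s true; set s0 := rcons s false.
pose M := maxn (sub s i) (maxn (sub s1 i) (sub s0 i)).
have h := @EE_pinf_px T A s i M Aj (leq_maxl _ _).
have h1 : EE (mu R {set T}) (fun x => `|cond_lim A x s1 - px M A s1 x|) <= 3 * 2^-1 ^+ i.
  by apply: EE_pinf_px => //; rewrite /M !leq_max leqnn orbT.
have h0 : EE (mu R {set T}) (fun x => `|cond_lim A x s0 - px M A s0 x|) <= 3 * 2^-1 ^+ i.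
  by apply: EE_pinf_px => //; rewrite /M !leq_max leqnn !orbT.
have bd s' : bmf (fun x => `|cond_lim A x s' - px M A s' x|).
  by apply/bmf_norm/bmfB; [exact: bmf_pinf|exact: bmf_px].
apply: (@le_trans _ _ (EE (mu R {set T}) (fun x =>
    `|cond_lim A x s - px M A s x| + (`|cond_lim A x s1 - px M A s1 x| + `|cond_lim A x s0 - px M A s0 x|)))).
  apply: EE_le => [||x]; first exact: bmf_norm.
    by apply: bmfD; [exact: bd|apply: bmfD; exact: bd].
  have -> : D x = (cond_lim A x s - px M A s x) -
     ((cond_lim A x s1 - px M A s1 x) + (cond_lim A x s0 - px M A s0 x)).
    by rewrite /D /cond_bits (cpr_rcons A s) -/s1 -/s0; ring.
  apply: le_trans (ler_normB _ _) _; rewrite lerD2l; exact: ler_normD.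
rewrite EED; [rewrite EED; [|exact: bd|exact: bd]|exact: bd|apply: bmfD; exact: bd].
exact: add3_le9.
Qed.

Lemma pinf_nil (T : finType) (A : {set T}) : #|A| = j ->
  \forall x \ae mu R {set T}, cond_lim A x [::] = 1.
Proof.
move=> Aj; have [P0 P1 _] := hP; have [_ _ law_] := hPsi.
have bD : bmf (fun x => cond_lim A x [::] - 1) by apply: bmfB; [exact: bmf_pinf|exact: bmf_cst].
suff E0 : EE (mu R {set T}) (fun x => `|cond_lim A x [::] - 1|) = 0.
  have := EE_eq0 (bmf_norm bD) (fun x => normr_ge0 _) E0.
  by apply: filterS => x /eqP; rewrite normr_eq0 subr_eq0 => /eqP.
apply/eqP; rewrite eq_le EE_ge0// andbT; apply: (@le0_half_pow _ _ 3) => // i.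
pose M := sub [::] i.
have h := @EE_pinf_px T A [::] i M Aj (leqnn _).
have h1 : EE (mu R {set T}) (fun x => `|px M A [::] x - 1|) = 0.
  rewrite (law_ T M (fun K => `|cpr P A [::] K - 1|)) /wsum big1// => H _.
  (* On fibres of weight 0 the conditional probability of the empty word is 0 instead of 1, but
     these carry no mass. *)
  rewrite cpr_cut//; have [PH|PH] := eqVneq (P _ H) 0; first by rewrite PH mul0r.
  suff -> : cpr P A [::] H = 1 by rewrite subrr normr0 mulr0.
  rewrite /cpr /cexp (eq_bigr (fun H' => P _ H')) => [|H' _]; last by rewrite /xi /bits eqxx mulr1.
  rewrite divff// (bigD1 H)//= paddr_eq0 ?PH//=; last exact: sumr_ge0.
  by rewrite (negbTE PH).
have bp : bmf (fun x => `|px M A [::] x - 1|).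
  by apply/bmf_norm/bmfB; [exact: bmf_px|exact: bmf_cst].
have bd : bmf (fun x => `|cond_lim A x [::] - px M A [::] x|).
  by apply/bmf_norm/bmfB; [exact: bmf_pinf|exact: bmf_px].
apply: (@le_trans _ _ (EE (mu R {set T}) (fun x =>
    `|cond_lim A x [::] - px M A [::] x| + `|px M A [::] x - 1|))).
  apply: EE_le => [||x]; first exact: bmf_norm.
    exact: bmfD.
  exact: ler_distD.
by rewrite EED// h1 addr0.
Qed.

Lemma pinf_consistent (T : finType) (A : {set T}) : #|A| = j ->
  \forall x \ae mu R {set T}, consistent (cond_lim A x).
Proof.
move=> Aj; have h1 := pinf_nil Aj.
have h2 : \forall x \ae mu R {set T}, forall n : nat,
    let s := odflt [::] (unpickle n) in
    cond_lim A x s = cond_lim A x (rcons s true) + cond_lim A x (rcons s false).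
  by apply/ae_foralln => n; exact: pinf_add.
apply: filterS2 h1 h2 => x x1 x2; split => // s; first by case/andP: (pinf01 A x s).
by have := x2 (pickle s); lazy zeta; rewrite pickleK.
Qed.

Definition refine_repr : repr R := fun T A x q =>
  if #|A| == j then splitbit (cond_lim A x) (x A) (pre (cond_lim A x) (x A) q) else @Psi T A x q.

Lemma Psi'_measurable T A q : measurable [set x | @refine_repr T A x q].
Proof.
have [mPsi _ _] := hPsi; rewrite /refine_repr; case: (#|A| == j) => //.
apply: (@measurable_bit_pre R _ (cubeT R {set T}) (fun x => cond_lim A x) (fun x => x A)).
  by move=> s; have [] := bmf_pinf A s.
exact: measurable_coord.
Qed.

Lemma Psi'_nat (T T' : finType) (f : T -> T') (A : {set T}) (x : cubeT R {set T'}) q :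
  injective f -> @refine_repr T' (f @: A) x q = @refine_repr T A (fun B => x (f @: B)) q.
Proof.
move=> fI; have [_ nat_ _] := hPsi; rewrite /refine_repr card_imset//; case: ifP => _; last exact: nat_.
have -> : cond_lim (f @: A) x = cond_lim A (fun B => x (f @: B)); last by [].
by apply/funext => s; exact: pinf_nat.
Qed.

(* Replacing one at a time the conditional probabilities by the true bits. *)
Lemma cpr_telescope (T : finType) (M i : nat) (r : seq {set T}) (sg : {set T} -> seq bool)
    (g : {set {set (T + 'I_M)%type}} -> R) : uniq r ->
  (forall A, A \in r -> #|A| = j /\ (sub (sg A) i <= M)%N) ->
  (forall H H' : {set {set (T + 'I_M)%type}},
    (forall C : {set (T + 'I_M)%type}, (forall A, A \in r -> ~~ (lref M A \subset C)) ->
      (C \in H) = (C \in H')) -> g H = g H') ->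
  (forall H, `|g H| <= 1) ->
  `|wsum (P (T + 'I_M)%type) (fun H => g H * \prod_(A <- r) xi R A (sg A) H) -
    wsum (P (T + 'I_M)%type) (fun H => g H * \prod_(A <- r) cpr P A (sg A) H)| <=
  (size r)%:R * 2^-1 ^+ i.
Proof.
have [P0 P1 _] := hP.
elim: r g => [|A r IH] g; first by move=> *; rewrite mul0r -wsumB /wsum big1 ?normr0// => H _;
  rewrite !big_nil subrr mulr0.
move=> /= /andP[Ar ur] hr gl g1.
have [Aj sA] := hr A (mem_head _ _); have [n1 n2 n3] := hsub (sg A) i Aj.
have xi1 B s H : `|xi (M := M) R B s H| <= 1.
  by rewrite ger0_norm; case/andP: (xi01 R B s H).
have -> : (fun H => g H * \prod_(B <- A :: r) xi R B (sg B) H) =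
  (fun H => (g H * xi R A (sg A) H) * \prod_(B <- r) xi R B (sg B) H).
  by apply/funext => H; rewrite big_cons mulrA.
have H1 : `|wsum (P (T + 'I_M)%type) (fun H => (g H * xi R A (sg A) H) * \prod_(B <- r) xi R B (sg B) H) -
    wsum (P (T + 'I_M)%type) (fun H => (g H * xi R A (sg A) H) * \prod_(B <- r) cpr P B (sg B) H)| <=
    (size r)%:R * 2^-1 ^+ i.
  apply: IH => //.
  - by move=> B Br; apply: hr; rewrite in_cons Br orbT.
  - move=> H H' HH'; congr (_ * _).
      apply: gl => C hC; apply: HH' => B Br; apply: hC; rewrite in_cons Br orbT//.
    (* The bits of [A] concern sets with trace [A], which contain no other set of size [j]; they may
       therefore be absorbed into the test function [g]. *)
    rewrite /xi; congr ((_ == _)%:R); apply: eq_mkseq => q; rewrite /bit; apply: HH' => B Br.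
    have [Bj _] := hr B (@mem_behead _ (A :: r) _ Br).
    apply: contraNN Ar => /fintype.subsetP BA; suff -> : A = B by [].
    apply/eqP; rewrite eq_sym eqEcard Aj Bj leqnn andbT; apply/fintype.subsetP => t tB.
    have := BA _ (imset_f inl tB); rewrite inE => /orP[] /imsetP[u uA] // [->] //.
  - by move=> H; rewrite normrM mulr_ile1.
have H2 : `|wsum (P (T + 'I_M)%type) (fun H => (g H * xi R A (sg A) H) * \prod_(B <- r) cpr P B (sg B) H) -
    wsum (P (T + 'I_M)%type) (fun H => g H * \prod_(B <- A :: r) cpr P B (sg B) H)| <= 2^-1 ^+ i.
  rewrite -wsumB.
  have -> : (fun H => g H * xi R A (sg A) H * \prod_(B <- r) cpr P B (sg B) H -
      g H * \prod_(B <- A :: r) cpr P B (sg B) H) =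
    (fun H => (xi R A (sg A) H - cpr P A (sg A) H) * (g H * \prod_(B <- r) cpr P B (sg B) H)).
    by apply/funext => H; rewrite big_cons; ring.
  rewrite -(@ler_pXn2r _ 2)// ?nnegrE ?exprn_ge0// real_normK ?num_real//.
  (* One replacement costs the square root of an energy gap, and beyond [sub (sg A) i] this gap is
     at most the square of 2^-i. *)
  apply: le_trans (n3 _ _ sA (leq_addr #|T| M)).
  apply: (cpr_near hP) => //.
  - exact: leq_trans sA.
  - move=> H H' HH'; congr (_ * _).
      by apply: gl => C hC; apply: HH'; apply: hC; rewrite mem_head.
    apply: eq_big_seq => B Br; have [Bj _] := hr B (@mem_behead _ (A :: r) _ Br).
    rewrite -(cpr_cut _ _ H Bj) -[RHS](cpr_cut _ _ _ Bj); congr cpr.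
    apply/setP => C; rewrite !inE; case: (boolP (#|linl C| < j)%N) => Cj; last by rewrite !andbF.
    rewrite HH'//; apply/negP => /fintype.subsetP AC; move: Cj; rewrite ltnNge => /negP; apply.
    rewrite -Aj; apply: subset_leq_card; apply/fintype.subsetP => t tA.
    by have := AC _ (imset_f inl tA); rewrite inE.
  - move=> H; rewrite normrM mulr_ile1// ger0_norm; last first.
      by apply: prodr_ge0 => B _; case/andP: (cpr01 hP B (sg B) H).
    by apply: prodr_ile1 => B _; exact: cpr01.
apply: le_trans (ler_distD (wsum (P (T + 'I_M)%type)
  (fun H => (g H * xi R A (sg A) H) * \prod_(B <- r) cpr P B (sg B) H)) _ _) _.
by rewrite -natr1 mulrDl mul1r lerD.
Qed.

End step.

Lemma eq_le_ring (R : numDomainType) (a b : R) : a = b -> a <= b.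
Proof. by move=> ->. Qed.

(** * The law of the refined representation *)

Section step_law.
Context (R : realType) (P : law R).
Arguments P : clear implicits.
Hypothesis hP : exch P.
Context (j : nat) (Psi : repr R).
Hypothesis hPsi : isrepr P j Psi.
Context (sub : seq bool -> nat -> nat).
Hypothesis hsub : forall (T : finType) (A : {set T}) s i, #|A| = j ->
  [/\ (needs (size s) <= sub s i)%N, (sub s i <= sub s i.+1)%N &
    forall M M', (sub s i <= M)%N -> (M <= M')%N ->
      cM P M' A s - cM P M A s <= (2^-1 ^+ i) ^+ 2].

Notation px := (cond_bits P j Psi).
Notation pinf := (cond_lim P j Psi sub).
Notation Psi' := (refine_repr P j Psi sub).

Section fixed_dimension.
Context (T : finType) (M : nat).
Notation V := (T + 'I_M)%type.

Definition layer : seq {set T} := enum [pred A : {set T} | #|A| == j].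

Lemma layerP A : (A \in layer) = (#|A| == j).
Proof. by rewrite mem_enum. Qed.

Definition upre (q : nat) (s : {set T} -> seq bool) (A : {set T}) (x : cubeT R {set T}) : R :=
  (pre (pinf A x) (x A) q == s A)%:R.

Lemma bmf_upre q s A : bmf (upre q s A).
Proof.
apply: bmf_bool; rewrite (_ : [set x | _] = [set x : cubeT R {set T} | pre (pinf A x) (x A) q = s A]).
  apply: (@measurable_pre R _ (cubeT R {set T}) (fun x => pinf A x) (fun x => x A)).
    by move=> s'; have [] := bmf_pinf hP hPsi sub A s'.
  exact: measurable_coord.
by apply/seteqP; split => x /= /eqP.
Qed.

Lemma mix_low (A B : {set T}) (y x : cubeT R {set T}) : #|A| = j -> (#|B| < j)%N ->
  mix (pred1 A) y x B = x B.
Proof.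
by move=> Aj Bj; rewrite /mix /=; case: eqP => // BA; move: Bj; rewrite BA Aj ltnn.
Qed.

(** Given the coordinates of smaller sets, the coordinates of the sets of size [j] are independent,
    and each draws the prefix [s A] with its limiting conditional probability. *)
Lemma EE_bits_pinf q (s : {set T} -> seq bool) (h : {set {set V}} -> R) :
  (forall A, A \in layer -> size (s A) = q) ->
  EE (mu R {set T}) (fun x => h (Gx Psi j M x) * \prod_(A <- layer) upre q s A x) =
  EE (mu R {set T}) (fun x => h (Gx Psi j M x) * \prod_(A <- layer) pinf A x (s A)).
Proof.
move=> sq.
have Gl A x y : A \in layer -> Gx Psi j M (mix (pred1 A) y x) = Gx Psi j M x.
  rewrite layerP => /eqP Aj; apply: (Gx_local hPsi) => B Bj; exact: mix_low.
have pl A A' s' x y : A \in layer -> pinf A' (mix (pred1 A) y x) s' = pinf A' x s'.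
  rewrite layerP => /eqP Aj; apply: (pinf_local hPsi) => B Bj; exact: mix_low.
rewrite (@EI_blocks R {set T} _ layer (fun A => pred1 A) (fun x => h (Gx Psi j M x)) (upre q s));
  first last.
- by move=> A A' B _ _; apply: contraNN => /= /andP[/eqP <- /eqP <-].
- move=> A A' x y AL _; rewrite eq_sym /upre => nA.
  have -> : pinf A' (mix (pred1 A) y x) = pinf A' x by apply/funext => s'; exact: pl.
  by rewrite /mix /= (negbTE nA).
- by move=> A x y AL; rewrite Gl.
- by move=> A; exact: bmf_upre.
- exact: (bmf_Gx hPsi).
- exact: enum_uniq.
have bEE A : bmf (fun x : cubeT R {set T} =>
    EE (mu R {set T}) (fun y => upre q s A (mix (pred1 A) y x))).
  exact/bmf_EE_mix/bmf_upre.
apply: EE_ae.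
- by apply: bmfM; [exact: (bmf_Gx hPsi)|apply: bmf_prod => A _; exact: bEE].
- by apply: bmfM; [exact: (bmf_Gx hPsi)|apply: bmf_prod => A _; exact: (bmf_pinf hP hPsi)].
have ha : \forall x \ae mu R {set T}, forall A : {set T}, #|A| = j -> consistent (pinf A x).
  apply: ae_finite => A; have [Aj|nAj] := eqVneq #|A| j.
    by apply: filterS (pinf_consistent hP hPsi hsub Aj) => x cx _.
  by apply: aeW => x /eqP; rewrite (negbTE nAj).
apply: filterS ha => x hx; congr (_ * _); apply: eq_big_seq => A AL.
have Aj : #|A| = j by apply/eqP; rewrite -layerP.
rewrite -(EE_pre A (s A) (hx A Aj)); congr (EE _ _); apply/funext => y.
rewrite /upre (sq A AL) (_ : pinf A _ = pinf A x); last by apply/funext => s'; exact: pl.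
by rewrite /mix /= eqxx.
Qed.

Context (M' : nat) (le : (M <= M')%N).

(** Each set of size [j] contributes 3 for replacing the limiting probability by the one seen from
    [M'] references, and 1 for replacing that one by the true bits. *)
Lemma EE_bits_near i q (s : {set T} -> seq bool) (h : {set {set V}} -> R) :
  (forall K, `|h K| <= 1) -> (forall A, A \in layer -> size (s A) = q) ->
  (forall A, A \in layer -> (sub (s A) i <= M')%N) ->
  `|EE (mu R {set T}) (fun x => h (Gx Psi j M x) * \prod_(A <- layer) upre q s A x) -
    wsum (P (T + 'I_M')%type) (fun H => h (cut j (pb (wmap le) H)) *
      \prod_(A <- layer) xi R A (s A) H)| <= (4 * (size layer)%:R) * 2^-1 ^+ i.
Proof.
move=> h1 sq sM; have [_ _ law_] := hPsi; rewrite EE_bits_pinf//.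
have Lj A : A \in layer -> #|A| = j by rewrite layerP => /eqP.
pose g (K : {set {set (T + 'I_M')%type}}) : R :=
  h (pb (wmap le) K) * \prod_(A <- layer) cpr P A (s A) K.
have e1 : `|EE (mu R {set T}) (fun x => h (Gx Psi j M x) * \prod_(A <- layer) pinf A x (s A)) -
    EE (mu R {set T}) (fun x => g (Gx Psi j M' x))| <= (3 * (size layer)%:R) * 2^-1 ^+ i.
  have b1 : bmf (fun x => h (Gx Psi j M x) * \prod_(A <- layer) pinf A x (s A)).
    by apply: bmfM; [exact: (bmf_Gx hPsi)|apply: bmf_prod => A _; exact: (bmf_pinf hP hPsi)].
  have b2 : bmf (fun x => g (Gx Psi j M' x)) by exact: (bmf_Gx hPsi).
  rewrite -EEB//; apply: le_trans (EE_norm _ (bmfB b1 b2)) _.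
  have b3 A : bmf (fun x => `|pinf A x (s A) - px M' A (s A) x|).
    by apply/bmf_norm/bmfB; [exact: (bmf_pinf hP hPsi)|exact: (bmf_px hPsi)].
  apply: (@le_trans _ _ (EE (mu R {set T}) (fun x =>
     \sum_(A <- layer) `|pinf A x (s A) - px M' A (s A) x|))).
    apply: EE_le => [||x]; first exact/bmf_norm/bmfB.
      by apply: bmf_sum => A _; exact: b3.
    rewrite /g pb_wmap_Gx -mulrBr normrM.
    apply: (@le_trans _ _ (1 * `|\prod_(A <- layer) pinf A x (s A) - \prod_(A <- layer) px M' A (s A) x|)).
      by rewrite ler_wpM2r.
    rewrite mul1r; apply: prod_diff => A; first exact: pinf01.
    exact: px01.
  rewrite EE_sum; last by move=> A _; exact: b3.
  apply: (@le_trans _ _ (\sum_(A <- layer) 3 * 2^-1 ^+ i)).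
    by rewrite big_seq [leRHS]big_seq; apply: ler_sum => A AL;
      apply: (EE_pinf_px hP hPsi hsub); [exact: Lj|exact: sM].
  by rewrite big_const_seq count_predT iter_addr_0 -[leLHS]mulr_natl; apply: eq_le_ring; ring.
rewrite law_ in e1.
have e2 : `|wsum (P (T + 'I_M')%type) (fun H => h (cut j (pb (wmap le) H)) *
      \prod_(A <- layer) xi R A (s A) H) -
    wsum (P (T + 'I_M')%type) (fun H => h (cut j (pb (wmap le) H)) *
      \prod_(A <- layer) cpr P A (s A) H)| <= (size layer)%:R * 2^-1 ^+ i.
  apply: (cpr_telescope hP hsub (enum_uniq _)) => [A AL|H H' HH'|H]; last exact: h1.
    by split; [exact: Lj|exact: sM].
  congr h; apply/setP => C; rewrite !inE; case: (boolP (#|linl C| < j)%N) => Cj; last by rewrite !andbF.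
  rewrite HH'// => A AL; apply/negP => /fintype.subsetP AC; move: Cj; rewrite ltnNge => /negP; apply.
  rewrite -(Lj A AL); apply: subset_leq_card; apply/fintype.subsetP => t tA.
  have /imsetP[[u|r] uC //= [->]] := AC _ (imset_f inl tA).
  by rewrite inE.
have gE : wsum (P (T + 'I_M')%type) (fun H => g (cut j H)) =
    wsum (P (T + 'I_M')%type) (fun H => h (cut j (pb (wmap le) H)) *
      \prod_(A <- layer) cpr P A (s A) H).
  apply: eq_bigr => H _; congr (_ * _); rewrite /g cut_wmap; congr (_ * _).
  by apply: eq_big_seq => A AL; rewrite cpr_cut// Lj.
rewrite gE distrC in e1; rewrite distrC.
apply: le_trans (ler_distD (wsum (P (T + 'I_M')%type) (fun H => h (cut j (pb (wmap le) H)) *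
      \prod_(A <- layer) cpr P A (s A) H)) _ _) _.
apply: le_trans (lerD e2 e1) _; apply: eq_le_ring; ring.
Qed.

End fixed_dimension.

(** Neither side depends on [i], while the error bound tends to 0 with [i]; hence an exact
    identity. *)
Lemma EE_bits_law (T : finType) M M' (le : (M <= M')%N) q (s : {set T} -> seq bool)
    (h : {set {set (T + 'I_M)%type}} -> R) :
  (forall A, A \in layer T -> size (s A) = q) -> (needs q <= M')%N ->
  EE (mu R {set T}) (fun x => h (Gx Psi j M x) * \prod_(A <- layer T) upre q s A x) =
  wsum (P (T + 'I_M')%type) (fun H => h (cut j (pb (wmap le) H)) *
      \prod_(A <- layer T) xi R A (s A) H).
Proof.
have [_ _ PE] := hP => sq qM.
(* Normalizes [h] to be bounded by 1, as the replacement argument requires. *)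
pose c : R := 1 + \sum_K `|h K|.
have c0 : 0 < c by rewrite ltr_wpDr// sumr_ge0.
have hc K : `|c^-1 * h K| <= 1.
  rewrite normrM gtr0_norm ?invr_gt0// ler_pdivrMl// mulr1 /c (bigD1 K)//=.
  by rewrite addrCA lerDl addr_ge0// sumr_ge0.
have bE : bmf (fun x => h (Gx Psi j M x) * \prod_(A <- layer T) upre q s A x).
  by apply: bmfM; [exact: (bmf_Gx hPsi)|apply: bmf_prod => A _; exact: bmf_upre].
apply: (mulfI (x := c^-1)); first by rewrite invr_eq0 gt_eqF.
rewrite -EEZ// -wsumZ.
under [X in EE _ X = _]eq_fun do rewrite mulrA.
under [X in _ = wsum _ X]eq_fun do rewrite mulrA.
apply/eqP; rewrite -subr_eq0 -normr_eq0 eq_le normr_ge0 andbT.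
apply: (@le0_half_pow _ _ (4 * (size (layer T))%:R)) => [|i]; first by rewrite mulr_ge0.
(* The reservoir is enlarged past all the thresholds for this [i]; by consistency the expectation on
   the right does not change. *)
pose M2 := maxn M' (\max_(A <- layer T) sub (s A) i)%N.
have le2 : (M' <= M2)%N by exact: leq_maxl.
have sM A : A \in layer T -> (sub (s A) i <= M2)%N.
  by move=> AL; rewrite /M2 (big_rem A)//= !leq_max leqnn !orbT.
have le3 : (M <= M2)%N by exact: leq_trans le2.
have := @EE_bits_near T M M2 le3 i q s (fun K => c^-1 * h K) hc sq sM.
congr (`|_ - _| <= _).
rewrite -(PE _ _ _ _ (@wmap_inj T _ _ le2)); apply: eq_bigr => H _; congr (_ * (_ * h _ * _)).
  rewrite pb_comp; congr (cut j (pb _ _)); apply/funext => -[t|r] //=.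
  by congr inr; apply: val_inj.
apply: eq_big_seq => A AL; rewrite /xi (sq A AL) -bits_wmap//.
Qed.

Lemma Psi'_law (T : finType) M (g : {set {set (T + 'I_M)%type}} -> R) :
  EE (mu R {set T}) (fun x => g (Gx Psi' j.+1 M x)) =
  wsum (P (T + 'I_M)%type) (fun H => g (cut j.+1 H)).
Proof.
have [_ _ PE] := hP.
(* With [q] bits per set of size [j], every set having this trace and any subset of the [M]
   references is recorded; [needs q] references suffice to decode them. *)
pose q := (\max_(C : {set 'I_M}) code C).+1.
have cq (C : {set 'I_M}) : (code C < q)%N by rewrite ltnS; exact: leq_bigmax.
pose M' := maxn M (needs q).
have le : (M <= M')%N by exact: leq_maxl.
have qM : (needs q <= M')%N by exact: leq_maxr.
pose J := [pred A : {set T} | #|A| == j].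
pose rec (K : {set {set (T + 'I_M)%type}}) (sg : {ffun {set T} -> q.-tuple bool}) :
    {set {set (T + 'I_M)%type}} :=
  [set C : {set (T + 'I_M)%type} | if (#|linl C| < j)%N then C \in K else
    (#|linl C| == j) && nth false (sg (linl C)) (code (linr C))]%SET.
pose d0 : q.-tuple bool := [tuple of nseq q false].
pose px_ (x : cubeT R {set T}) (A : {set T}) : q.-tuple bool :=
  Tuple (introT eqP (size_pre (pinf A x) (x A) q)).
have sb (H : {set {set (T + 'I_M')%type}}) A : size (bits A q H) == q by rewrite size_mkseq.
pose pH (H : {set {set (T + 'I_M')%type}}) (A : {set T}) : q.-tuple bool := Tuple (sb H A).
have xE x : Gx Psi' j.+1 M x = rec (Gx Psi j M x) [ffun A => if A \in J then px_ x A else d0].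
  apply/setP => C; rewrite !inE ltnS /refine_repr; case: (ltngtP #|linl C| j) => //= Cj.
  rewrite ffunE inE Cj eqxx.
  have -> : tval (px_ x (linl C)) = mkseq (fun i => splitbit (pinf (linl C) x) (x (linl C))
    (pre (pinf (linl C) x) (x (linl C)) i)) q by exact: preE.
  by rewrite nth_mkseq.
have HE H : cut j.+1 (pb (wmap le) H) =
    rec (cut j (pb (wmap le) H)) [ffun A => if A \in J then pH H A else d0].
  apply/setP => C; rewrite !inE ltnS; case: (ltngtP #|linl C| j) => //= Cj; rewrite ?andbT ?andbF//.
  rewrite ffunE inE Cj eqxx /= nth_mkseq// /bit.
  have -> : dec M' (code (linr C)) = widen_ord le @: linr C by rewrite -(code_widen le) codeK.
  by rewrite -[in LHS](linlrK C) (@imset_inl_inr _ _ _ _ _ id (widen_ord le))// imset_id.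
pose us (sg : {ffun {set T} -> q.-tuple bool}) (A : {set T}) : seq bool := sg A.
pose G K (sg : {ffun {set T} -> q.-tuple bool}) := g (rec K sg) *
  [forall A : {set T}, (A \notin J) ==> (sg A == d0)]%:R.
have -> : (fun x => g (Gx Psi' j.+1 M x)) = (fun x => \sum_(sg : {ffun {set T} -> q.-tuple bool})
    G (Gx Psi j M x) sg * \prod_(A <- layer T) upre q (us sg) A x).
  apply/funext => x; rewrite xE.
  rewrite -(sum_assignments J d0 (px_ x) (fun sg => g (rec (Gx Psi j M x) sg))); apply: eq_bigr => sg _.
  by congr (_ * _); apply: eq_bigr => A _; rewrite /upre -val_eqE.
rewrite EE_sum; last first.
  move=> sg _; apply: bmfM; first exact: (bmf_Gx hPsi (fun K => G K sg)).
  by apply: bmf_prod => A _; exact: bmf_upre.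
rewrite -(PE _ _ _ _ (@wmap_inj T _ _ le)).
have -> : (fun H => g (cut j.+1 (pb (wmap (T := T) le) H))) =
   (fun H => \sum_(sg : {ffun {set T} -> q.-tuple bool})
    G (cut j (pb (wmap le) H)) sg * \prod_(A <- layer T) xi R A (us sg A) H).
  apply/funext => H; rewrite HE.
  rewrite -(sum_assignments J d0 (pH H) (fun sg => g (rec (cut j (pb (wmap le) H)) sg))); apply: eq_bigr => sg _.
  by congr (_ * _); apply: eq_bigr => A _; rewrite /xi /us size_tuple -val_eqE.
rewrite /wsum; under [RHS]eq_bigr do rewrite big_distrr.
rewrite exchange_big /=; apply: eq_bigr => sg _.
by rewrite (@EE_bits_law T M M' le q (us sg) (fun K => G K sg))// => A _; rewrite /us size_tuple.
Qed.

Lemma isrepr_step : isrepr P j.+1 Psi'.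
Proof.
split; [exact: Psi'_measurable|move=> T T' f A x q fI; exact: Psi'_nat|exact: Psi'_law].
Qed.

End step_law.

Lemma isrepr_exists (R : realType) (P : law R) (j : nat) : exch P ->
  exists Psi : repr R, isrepr P j Psi.
Proof.
move=> hP; elim: j => [|j [Psi hPsi]].
  exists (fun _ _ _ _ => false); split => // [T A q|T M g].
    by rewrite (_ : [set x | _] = set0)//; apply/seteqP; split.
  have [_ P1 _] := hP; transitivity (g finset.set0).
    rewrite -[RHS](EE_cst (mu R {set T})); congr (EE _ _); apply/funext => x.
  rewrite -[LHS]mul1r -(P1 (T + 'I_M)%type) big_distrl; apply: eq_bigr => H _; congr (_ * g _).
  by apply/setP => C; rewrite !inE andbF.
have [sub hsub] := cM_rate hP j.
exists (refine_repr P j Psi sub); apply: isrepr_step => // T A s i Aj; exact: hsub.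
Qed.

(** * Densities under relabelling and disjoint union *)

Section tau_operations.
Context (R : realType) (k : nat) (W : cubeT R (rlt k) -> R).
Hypothesis hW : hyperB W.

Definition uniform (T : finType) (E : {set {set T}}) : Prop := forall A, A \in E -> #|A| = k.

Lemma tau_imset (T T' : finType) (f : T -> T') (E : {set {set T}}) : injective f -> uniform E ->
  tau W ((fun A : {set T} => f @: A) @: E) = tau W E.
Proof.
move=> fI uE; have fI' : injective (fun A : {set T} => f @: A) by exact: imset_inj.
rewrite /tau -(EI_reindex fI'); last by apply: bmf_prod => A _; exact: bmf_wt.
congr (EE _ _); apply/funext => x; rewrite big_imset /=; last by move=> A B _ _; exact: fI'.
by apply: eq_bigr => A AE; rewrite wt_map// uE.
Qed.

Definition inlE (T T' : finType) (E : {set {set T}}) : {set {set (T + T')%type}} :=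
  (fun A : {set T} => inl @: A) @: E.
Definition inrE (T T' : finType) (E : {set {set T'}}) : {set {set (T + T')%type}} :=
  (fun A : {set T'} => inr @: A) @: E.

Hypothesis k0 : (0 < k)%N.

(** Edges on the left read only non-empty subsets of the left part, and edges on the right read none
    of these, so the two products are independent. The one subset common to both parts is the empty
    set, which no edge weight reads. *)
Lemma tau_disjoint (T T' : finType) (E : {set {set T}}) (E' : {set {set T'}}) :
  uniform E -> uniform E' ->
  tau W (inlE T' E :|: inrE T E') = tau W E * tau W E'.
Proof.
move=> uE uE'; pose V := (T + T')%type.
have lI : injective (@inl T T') by move=> ? ? [].
have rI : injective (@inr T T') by move=> ? ? [].
have lk A : A \in inlE T' E -> #|A| = k.
  by case/imsetP => B BE ->; rewrite card_imset// uE.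
have rk A : A \in inrE T E' -> #|A| = k.
  by case/imsetP => B BE ->; rewrite card_imset// uE'.
rewrite -(tau_imset lI uE) -(tau_imset rI uE') -/(inlE T' E) -/(inrE T E').
pose Lf : {set V} := inl @: [set: T]%SET.
pose S : pred {set V} := fun B => (B != finset.set0) && (B \subset Lf).
have sl A : A \in inlE T' E -> A \subset Lf.
  by case/imsetP => B _ ->; apply: imsetS; exact: finset.subsetT.
rewrite /tau -(EI_indep (S := S)).
- have dE : fintype.disjoint (mem (inlE T' E)) (mem (inrE T E')).
    rewrite disjoint_subset; apply/fintype.subsetP => A /[dup] /lk Ak /imsetP[B _ AB].
    rewrite inE; apply/negP => /imsetP[B' _ AB']; have : (0 < #|A|)%N by rewrite Ak.
    case/card_gt0P => v vA; move: (vA); rewrite AB => /imsetP[t _ vt].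
    by move: vA; rewrite AB' vt => /imsetP[].
  by congr (EE _ _); apply/funext => x; rewrite -bigU//=; apply: eq_bigl => A;
    rewrite !inE.
- by apply: bmf_prod => A _; exact: bmf_wt.
- by apply: bmf_prod => A _; exact: bmf_wt.
- move=> x y; apply: eq_bigr => A AE; apply: wt_local => //; first exact: (lk _ AE).
  move=> B B0 BA; rewrite /mix /S B0 (fintype.subset_trans (proper_sub BA))//.
  exact: sl.
- move=> x y; apply: eq_bigr => A AE; apply: wt_local => //; first exact: (rk _ AE).
  move=> B B0 BA; rewrite /mix /S B0 /=; case: ifP => // /fintype.subsetP BL.
  have /set0Pn[v vB] := B0; have /imsetP[t _ vt] := BL _ vB.
  have := fintype.subsetP (proper_sub BA) _ vB; rewrite vt.
  by case/imsetP: AE => B' _ ->; case/imsetP.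
Qed.

End tau_operations.

Definition dens (R : realType) (P : law R) (T : finType) (E : {set {set T}}) : R :=
  wsum (@P T) (fun H => (E \subset H)%:R).

Lemma dens_imset (R : realType) (P : law R) (T T' : finType) (f : T -> T') (E : {set {set T}}) :
  exch P -> injective f -> dens P ((fun A : {set T} => f @: A) @: E) = dens P E.
Proof.
move=> [_ _ PE] fI; rewrite /dens -(PE _ _ _ _ fI); apply: eq_bigr => H _; congr (_ * _%:R).
congr nat_of_bool; apply/fintype.subsetP/fintype.subsetP => EH A.
  by move=> AE; rewrite inE; apply: EH; exact: imset_f.
by case/imsetP => B BE ->; have := EH _ BE; rewrite inE.
Qed.

(** * From a representation to a hypergraphon *)

Section limit.
Context (R : realType) (P : law R) (k : nat).
Arguments P : clear implicits.
Hypothesis hP : exch P.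
Hypothesis k0 : (0 < k)%N.
Hypothesis dissociated : forall (T : finType) (E : {set {set T}}), uniform k E ->
  dens P (inlE T E :|: inrE T E) = dens P E ^+ 2.

Context (Psi : repr R).
Hypothesis hPsi : isrepr P k.+1 Psi.

(** Index of the bit that involves no reference vertex: it tells whether [A] itself belongs to the
    system. *)
Definition q0 : nat := code (finset.set0 : {set 'I_0}).

Definition bA (T : finType) (A : {set T}) (x : cubeT R {set T}) : R := (@Psi T A x q0)%:R.

Lemma bmf_bA (T : finType) (A : {set T}) : bmf (bA A).
Proof. by have [mPsi _ _] := hPsi; exact: bmf_bool. Qed.

Lemma dens_bA (T : finType) (E : {set {set T}}) : uniform k E ->
  dens P E = EE (mu R {set T}) (fun x => \prod_(A in E) bA A x).
Proof.
move=> uE; have [_ _ PE] := hP; have [_ _ law_] := hPsi.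
have lI : injective (@inl T 'I_0) by move=> ? ? [].
rewrite /dens -(PE _ _ _ _ lI).
have -> : wsum (P (T + 'I_0)%type) (fun H => (E \subset pb inl H)%:R) =
    wsum (P (T + 'I_0)%type) (fun H => (E \subset pb inl (cut k.+1 H))%:R).
  apply: eq_bigr => H _; congr (_ * _%:R); congr nat_of_bool.
  apply/fintype.subsetP/fintype.subsetP => EH A AE; have := EH A AE; rewrite !inE; last by case/andP.
  move=> ->; rewrite ltnS -(uE A AE) /=; apply: subset_leq_card; apply/fintype.subsetP => t.
  by rewrite inE => /imsetP[u uA [->]].
rewrite -(law_ T 0%N (fun K => (E \subset pb inl K)%:R)); congr (EE _ _); apply/funext => x.
have linlE (A : {set T}) : linl (inl @: A : {set (T + 'I_0)%type}) = A.
  apply/setP => t; rewrite inE; apply/imsetP/idP => [[u uA [->]]//|tA]; by exists t.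
have linrE (A : {set T}) : linr (inl @: A : {set (T + 'I_0)%type}) = finset.set0.
  by apply/setP => -[].
have [/fintype.subsetP EH|/subsetPn[A AE]] := boolP (E \subset _).
  rewrite big1// => A AE; have := EH A AE; rewrite !inE linlE linrE => /andP[_].
  by rewrite /bA /q0 => ->.
rewrite !inE linlE linrE ltnS (uE A AE) leqnn /= => nA.
by rewrite (bigD1 A)//= /bA /q0 (negbTE nA) mul0r.
Qed.

(** Conditional probability that [A] belongs to the system given the coordinates of its proper
    subsets; the coordinate of [A] is private to [A] and is averaged out. *)
Definition W0 (T : finType) (A : {set T}) (x : cubeT R {set T}) : R :=
  EE (mu R {set T}) (fun y => bA A (mix (pred1 A) y x)).

Lemma bmf_W0 (T : finType) (A : {set T}) : bmf (W0 A).
Proof. exact/bmf_EE_mix/bmf_bA. Qed.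

Lemma W001 (T : finType) (A : {set T}) x : 0 <= W0 A x <= 1.
Proof.
rewrite EE_ge0/= => [|y]; last by rewrite /bA.
rewrite -[leRHS](EE_cst (mu R {set T})); apply: EE_le => [||y].
- exact/bmf_mixl/bmf_bA.
- exact: bmf_cst.
- by rewrite /bA; case: (Psi _ _).
Qed.

Lemma W0_nat (T T' : finType) (f : T -> T') (A : {set T}) (x : cubeT R {set T'}) :
  injective f -> W0 (f @: A) x = W0 A (fun B => x (f @: B)).
Proof.
move=> fI; have fI' : injective (fun A : {set T} => f @: A) by exact: imset_inj.
have [_ nat_ _] := hPsi.
rewrite /W0 -(EI_reindex fI' (bmf_mixl (pred1 A) (fun B => x (f @: B)) (bmf_bA A))).
congr (EE _ _); apply/funext => y; rewrite /bA nat_//; congr ((Psi _ _ _)%:R).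
by apply/funext => B; rewrite /mix /= (inj_eq fI').
Qed.

Lemma W0_local (T : finType) (A : {set T}) (x x' : cubeT R {set T}) :
  (forall B : {set T}, B \proper A -> x B = x' B) -> W0 A x = W0 A x'.
Proof.
move=> xx'; congr (EE _ _); apply/funext => y; rewrite /bA; congr (nat_of_bool _)%:R.
apply: (Psi_local hPsi) => B BA; rewrite /mix /=; case: eqVneq => // nBA.
by apply: xx'; rewrite finset.properEneq nBA.
Qed.

Lemma dens_W0 (T : finType) (E : {set {set T}}) : uniform k E ->
  dens P E = EE (mu R {set T}) (fun x => \prod_(A in E) W0 A x).
Proof.
move=> uE; rewrite dens_bA//.
have bE (u : {set T} -> cubeT R {set T} -> R) :
    (fun x => \prod_(A in E) u A x) = (fun x => 1 * \prod_(A <- enum E) u A x).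
  by apply/funext => x; rewrite mul1r big_enum.
rewrite !bE (@EI_blocks R {set T} _ (enum E) (fun A => pred1 A) (fun=> 1) (fun A => bA A))//.
- exact: enum_uniq.
- exact: bmf_cst.
- by move=> A; exact: bmf_bA.
- move=> A A' x y; rewrite !mem_enum => AE A'E nA; rewrite /bA; congr (nat_of_bool _)%:R.
  apply: (Psi_local hPsi) => B BA; rewrite /mix /=; case: eqVneq => // BA'.
  case/negP: nA; rewrite finset.eqEcard -BA' BA BA' (uE _ AE) (uE _ A'E) leqnn//.
- by move=> A A' B _ _; apply: contraNN => /= /andP[/eqP <- /eqP <-].
Qed.

Definition fillc (c : R) (z : rlt k -> R) : {set 'I_k} -> R :=
  fun B => if B == finset.set0 then c else oapp z 0 (insub B : option (rlt k)).

Definition Wc (c : R) (z : cubeT R (rlt k)) : R := W0 [set: 'I_k]%SET (fillc c z).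

Lemma Wc_hyperB c : hyperB (Wc c).
Proof.
split=> [|z|s z]; last 2 first.
- exact: W001.
- have sT : s @: [set: 'I_k]%SET = [set: 'I_k]%SET.
    apply/eqP; rewrite eqEcard finset.subsetT card_imset ?leqnn//; exact: perm_inj.
  rewrite /Wc -[in RHS]sT W0_nat; last exact: perm_inj.
  congr W0; apply/funext => B; rewrite /fillc imset_eq0; case: eqP => //= /eqP B0.
  case: insubP => [C _ CB|]; last first.
    rewrite B0 /= => /negPn/eqP BT; rewrite insubF// BT sT eqxx andbF//.
  by rewrite /= permptE -CB (_ : s @: val C = val (perm_rlt s C))// valK.
apply: (proj1 (bmf_comp (f := W0 [set: 'I_k]%SET) _ (bmf_W0 _))).
apply: measurable_cubeP => B; rewrite /fillc; case: (B == _); first exact: measurable_cst.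
case: insub => [C|]; [exact: measurable_coord|exact: measurable_cst].
Qed.

Lemma wt_Wc (T : finType) (A : {set T}) c x : #|A| = k ->
  wt (Wc c) A x = W0 A (upd finset.set0 c x).
Proof.
move=> /enum_set_inj[e [eI <-]]; rewrite (wtE (Wc_hyperB c))// W0_nat//.
apply: W0_local => B /[dup] BT; rewrite finset.properT => nBT.
rewrite /fillc /upd imset_eq0; case: eqVneq => // B0.
by rewrite insubT /= ?B0.
Qed.

Lemma bmf_upd_prod (T : finType) (E : {set {set T}}) :
  bmf (fun z : measurableTypeR R * cubeT R {set T} => \prod_(A in E) W0 A (upd finset.set0 z.1 z.2)).
Proof.
apply: bmf_prod => A _; apply: (@bmf_comp _ _ _ _ _ (W0 A)); last exact: bmf_W0.
exact: measurable_upd.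
Qed.

Lemma tau_Wc (T : finType) (E : {set {set T}}) c : uniform k E ->
  tau (Wc c) E = EE (mu R {set T}) (fun y => \prod_(A in E) W0 A (upd finset.set0 c y)).
Proof.
move=> uE; congr (EE _ _); apply/funext => y; apply: eq_bigr => A AE.
by rewrite wt_Wc// uE.
Qed.

Lemma bmf_tau_Wc (T : finType) (E : {set {set T}}) : uniform k E ->
  bmf (fun c : measurableTypeR R => tau (Wc c) E).
Proof.
move=> uE; have := bmf_EE2 (mu R {set T}) (bmf_upd_prod E); congr bmf.
by apply/funext => c; rewrite tau_Wc.
Qed.

Lemma EE_tau_Wc (T : finType) (E : {set {set T}}) : uniform k E ->
  EE (lam R) (fun c => tau (Wc c) E) = dens P E.
Proof.
move=> uE; rewrite dens_W0// (EE_upd finset.set0); last first.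
  by apply: bmf_prod => A _; exact: bmf_W0.
by congr (EE _ _); apply/funext => c; rewrite tau_Wc.
Qed.

(** Over random [c] the density has mean [dens P E]; since densities multiply over disjoint unions,
    dissociation makes its second moment the square of that mean. The variance is 0. *)
Lemma tau_Wc_ae (T : finType) (E : {set {set T}}) : uniform k E ->
  \forall c \ae lam R, tau (Wc c) E = dens P E.
Proof.
move=> uE; have bt := bmf_tau_Wc uE.
have uE2 : uniform k (inlE T E :|: inrE T E).
  by move=> A; rewrite inE => /orP[] /imsetP[B BE ->]; rewrite card_imset ?uE// => ? ? [].
have E2 : EE (lam R) (fun c => tau (Wc c) E ^+ 2) = dens P E ^+ 2.
  rewrite -dissociated// -EE_tau_Wc//; congr (EE _ _); apply/funext => c.
  by rewrite (tau_disjoint (Wc_hyperB c)).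
have b0 := bmfB bt (bmf_cst _ (dens P E)).
have b2 := bmfX 2 b0.
have : EE (lam R) (fun c => (tau (Wc c) E - dens P E) ^+ 2) = 0.
  have -> : (fun c => (tau (Wc c) E - dens P E) ^+ 2) = (fun c => (tau (Wc c) E ^+ 2 +
     (- (2 * dens P E)) * tau (Wc c) E) + dens P E ^+ 2).
    by apply/funext => c; ring.
  have b3 := bmfZ (- (2 * dens P E)) bt; have b4 := bmfX 2 bt.
  rewrite EED; [|exact: bmfD|exact: bmf_cst].
  by rewrite EED// EEZ// E2 EE_tau_Wc// EE_cst; ring.
move=> /(EE_eq0 b2 (fun c => sqr_ge0 _)); apply: filterS => c /eqP.
by rewrite sqrf_eq0 subr_eq0 => /eqP.
Qed.

(** There are only countably many systems on the types ['I_n], so a single [c] off a null set serves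
    them all; any other vertex type is relabelled into one of these. *)
Lemma limit_of_repr : exists W : cubeT R (rlt k) -> R, hyperB W /\
  forall (T : finType) (E : {set {set T}}), uniform k E -> tau W E = dens P E.
Proof.
have h : \forall c \ae lam R, forall n, forall E : {set {set 'I_n}}, uniform k E ->
    tau (Wc c) E = dens P E.
  apply/ae_foralln => n; apply: ae_finite => E.
  have [uE|nE] := pselect (uniform k E); last by apply: aeW.
  have [N [mN N0 hN]] := tau_Wc_ae uE; exists N; split => // c /= nc.
  by apply: hN => /= tc; apply: nc => _; exact: tc.
have [c hc] : exists c, forall n, forall E : {set {set 'I_n}}, uniform k E ->
    tau (Wc c) E = dens P E.
  apply: contrapT => nc; have [N [mN N0 hN]] := h.
  have NT : N = setT.
    by apply/seteqP; split => // c _; apply: hN => /= hc; apply: nc; exists c.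
  by move: N0; rewrite NT probability_setT => -[] /eqP; rewrite oner_eq0.
exists (Wc c); split; first exact: Wc_hyperB.
move=> T E uE.
rewrite -(tau_imset (Wc_hyperB c) (@enum_rank_inj T) uE) -(dens_imset _ hP (@enum_rank_inj T)).
apply: hc => A /imsetP[B BE ->]; rewrite card_imset ?uE//; exact: enum_rank_inj.
Qed.

End limit.

Lemma limit_exists (R : realType) (P : law R) (k : nat) : exch P -> (0 < k)%N ->
  (forall (T : finType) (E : {set {set T}}), uniform k E ->
    dens P (inlE T E :|: inrE T E) = dens P E ^+ 2) ->
  exists W : cubeT R (rlt k) -> R, hyperB W /\
    forall (T : finType) (E : {set {set T}}), uniform k E -> tau W E = dens P E.
Proof.
move=> hP k0 dis; have [Psi hPsi] := isrepr_exists k.+1 hP.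
exact: limit_of_repr hPsi.
Qed.

(** * Limits of graph sequences *)

Section map_statistics.
Context (R : realType) (n : nat) (E : {set {set 'I_n}}).
Implicit Types T : finType.

(** All maps are used, not only injections: the restriction of a uniform map is uniform, and
    restrictions to disjoint parts are independent. The laws of a finite graph are thus exactly
    consistent and dissociated, before any limit. *)
Definition mavg T (g : {set {set T}} -> R) : R :=
  (\sum_(f : {ffun T -> 'I_n}) g (pb f E)) / (n ^ #|T|)%:R.

Definition mlaw T (H : {set {set T}}) : R := mavg (fun H' => (H' == H)%:R).

Lemma wsum_mlaw T g : wsum (@mlaw T) g = mavg g.
Proof.
rewrite /wsum /mlaw /mavg big_distrl /=.
transitivity (\sum_H \sum_(f : {ffun T -> 'I_n}) (pb f E == H)%:R * g H / (n ^ #|T|)%:R).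
  by apply: eq_bigr => H _; rewrite mulrAC big_distrl /= big_distrl.
rewrite exchange_big /=; apply: eq_bigr => f _.
rewrite (bigD1 (pb f E))//= eqxx mul1r big1 ?addr0// => H /negbTE.
by rewrite eq_sym => ->; rewrite !mul0r.
Qed.

Lemma mlaw_ge0 T H : 0 <= @mlaw T H.
Proof. by rewrite divr_ge0// sumr_ge0. Qed.

Hypothesis n0 : (0 < n)%N.

Lemma mavg1 T : mavg (fun _ : {set {set T}} => 1) = 1.
Proof.
rewrite /mavg sumr_const card_ffun card_ord divff// pnatr_eq0 expn_eq0.
by rewrite negb_and -lt0n n0.
Qed.

Lemma card_ext T T' (h : T -> T') (f : {ffun T -> 'I_n}) : injective h ->
  #|[set f' : {ffun T' -> 'I_n} | [ffun x => f' (h x)] == f]%SET| = (n ^ (#|T'| - #|T|))%N.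
Proof.
move=> hI.
pose F (y : T') : pred 'I_n := if [pick x | h x == y] is Some x then pred1 (f x) else predT.
have Fh x : F (h x) = pred1 (f x).
  by rewrite /F; case: pickP => [x' /eqP/hI ->//|/(_ x)]; rewrite eqxx.
have -> : #|[set f' : {ffun T' -> 'I_n} | [ffun x => f' (h x)] == f]%SET| = #|family F|.
  apply: eq_card => f'; rewrite inE; apply/eqP/familyP.
    move=> /ffunP ff' y; rewrite /F; case: pickP => // x /eqP <-.
    by rewrite -topredE /= -ff' ffunE.
  by move=> H; apply/ffunP => x; have := H (h x); rewrite Fh ffunE => /eqP.
rewrite card_family foldrE big_map big_enum /= (bigID (mem (codom h)))/= big1 ?mul1n; last first.
  by move=> y /codomP[x ->]; rewrite Fh card1.
rewrite (eq_bigr (fun=> n)); last first.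
  move=> y yh; rewrite /F; case: pickP => [x /eqP xy|_]; last by rewrite card_ord.
  by case/negP: yh; rewrite -xy codom_f.
rewrite prod_nat_const -(card_codom hI); congr (n ^ _)%N.
rewrite -(cardC (mem (codom h))) addKn; apply: eq_card => y; by rewrite !inE.
Qed.

Lemma mavg_pb T T' (h : T -> T') (g : {set {set T}} -> R) : injective h ->
  mavg (fun H => g (pb h H)) = mavg g.
Proof.
move=> hI; rewrite /mavg.
rewrite (partition_big (fun f' : {ffun T' -> 'I_n} => [ffun x => f' (h x)]) predT)//= !big_distrl /=.
apply: eq_bigr => f _.
rewrite (eq_bigr (fun=> g (pb f E))); last first.
  move=> f' /eqP <-; congr g; rewrite pb_comp; apply/setP => A; rewrite !inE.
  by congr (_ \in E); apply: eq_imset => x; rewrite ffunE.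
rewrite sumr_const -cardsE card_ext//.
have nT (m : nat) : (n ^ m)%:R != 0 :> R by rewrite pnatr_eq0 expn_eq0 negb_and -lt0n n0.
have TT := leq_card _ hI.
rewrite -(subnK TT) expnD natrM addnK -mulr_natr; field.
by rewrite !nT.
Qed.

Lemma mavg_disjoint T (E' : {set {set T}}) :
  mavg (fun H => (inlE T E' :|: inrE T E' \subset H)%:R) = mavg (fun H => (E' \subset H)%:R) ^+ 2.
Proof.
rewrite /mavg expr2 mulrACA big_distrlr /= pair_big /=.
rewrite card_sum expnD natrM invfM; congr (_ * _).
pose j (p : {ffun T -> 'I_n} * {ffun T -> 'I_n}) : {ffun T + T -> 'I_n} :=
  [ffun z => match z with inl x => p.1 x | inr x => p.2 x end].
pose j' (f : {ffun T + T -> 'I_n}) : {ffun T -> 'I_n} * {ffun T -> 'I_n} :=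
  ([ffun x => f (inl x)], [ffun x => f (inr x)]).
rewrite (reindex j)/=; last first.
  exists j' => [[f1 f2] _|f _]; rewrite /j /j' /=.
    by congr (_, _); apply/ffunP => x; rewrite !ffunE.
  by apply/ffunP => -[] x; rewrite !ffunE.
apply: eq_bigr => -[f1 f2] _ /=; rewrite -natrM mulnb finset.subUset; congr (_ && _)%:R.
  have il (A : {set T}) : j (f1, f2) @: (inl @: A) = f1 @: A.
    by rewrite -(imset_comp (j (f1, f2)) inl); apply: eq_imset => x; rewrite /= ffunE.
  apply/fintype.subsetP/fintype.subsetP => EH A AE.
    by have := EH _ (imset_f (fun A : {set T} => inl @: A) AE); rewrite !inE il.
  by case/imsetP: AE => B /EH; rewrite !inE => + ->; rewrite il.
have ir (A : {set T}) : j (f1, f2) @: (inr @: A) = f2 @: A.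
  by rewrite -(imset_comp (j (f1, f2)) inr); apply: eq_imset => x; rewrite /= ffunE.
apply/fintype.subsetP/fintype.subsetP => EH A AE.
  by have := EH _ (imset_f (fun A : {set T} => inr @: A) AE); rewrite !inE ir.
by case/imsetP: AE => B /EH; rewrite !inE => + ->; rewrite ir.
Qed.

End map_statistics.

Lemma tG_mavg (R : realType) k (F G : kgraph k) :
  tG R F G = mavg (kE G) (fun H => (kE F \subset H)%:R).
Proof.
rewrite /tG /mavg card_ord -natr_sum; congr (_%:R / _).
rewrite -sum1_card big_mkcond /=; apply: eq_bigr => f _.
have -> : f \in [set f : {ffun 'I_(kv F) -> 'I_(kv G)} |
    [forall A in kE F, ((fun x => f x) @: A) \in kE G]] =
    [forall A in kE F, ((fun x => f x) @: A) \in kE G].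
  by apply/idP/idP; rewrite inE.
case: ifP => fE; case: fintype.subsetP => // H.
  by case: H => A /(forall_inP fE); rewrite inE.
have /negP[] := negbT fE; apply/forall_inP => A /H; by rewrite inE.
Qed.

Lemma mavg01 (R : realType) n (E : {set {set 'I_n}}) (T : finType) (g : {set {set T}} -> R) :
  (0 < n)%N -> (forall H, 0 <= g H <= 1) -> 0 <= mavg E g <= 1.
Proof.
move=> n0 g01; apply/andP; split.
  by rewrite divr_ge0// sumr_ge0// => f _; case/andP: (g01 (pb f E)).
rewrite -[leRHS](mavg1 R E n0 T) /mavg ler_wpM2r// ler_sum// => f _.
by case/andP: (g01 (pb f E)).
Qed.

Lemma ultra_exists (R : realType) : exists U : set_system nat, [/\ ProperFilter U, \oo `<=` U &
  forall u : nat -> R, (forall n, 0 <= u n <= 1) -> exists a : R, u @ U --> a].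
Proof.
have [U [UU sU]] := @ultraFilterLemma nat \oo _.
exists U; split => // [|u u01]; first exact: ultra_proper.
have UP : ProperFilter U by exact: ultra_proper.
have [|a [_ ca]] := @segment_compact R 0 1 (u @ U) _.
  by apply: (@filterE _ U) => n; rewrite /= in_itv /= u01.
exists a => B Ba; have [//|UB] := in_ultra_setVsetC (u @^-1` B) UU.
by have [x [/= nBx Bx]] := ca (~` B) B UB Ba.
Qed.

Lemma cvg_sumr (R : realType) (I J : Type) (U : set_system J) (r : seq I) (f : I -> J -> R) (a : I -> R) :
  Filter U -> (forall i, f i x @[x --> U] --> a i) ->
  (\sum_(i <- r) f i x) @[x --> U] --> \sum_(i <- r) a i.
Proof.
move=> FU fa; elim: r => [|i r IH].
  by rewrite big_nil; under eq_fun do rewrite big_nil; exact: cvg_cst.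
by rewrite big_cons; under eq_fun do rewrite big_cons; exact: cvgD.
Qed.

Lemma graph_limit (R : realType) k (G : nat -> kgraph k) : (0 < k)%N ->
  (forall n, (0 < kv (G n))%N) ->
  exists U : set_system nat, exists W : cubeT R (rlt k) -> R,
    [/\ ProperFilter U, \oo `<=` U, hyperB W &
    forall F : kgraph k, (fun n => tG R F (G n)) @ U --> tau W (kE F)].
Proof.
move=> k0 G0; have [U [UP sU UC]] := ultra_exists R; exists U.
have cg T (g : {set {set T}} -> R) : (forall H, 0 <= g H <= 1) ->
    exists a : R, (fun n => mavg (kE (G n)) g) @ U --> a.
  by move=> g01; apply: UC => n; exact: mavg01.
pose P : law R := fun T H => lim ((fun n => mlaw R (kE (G n)) H) @ U).
have hP T (H : {set {set T}}) : (fun n => mlaw R (kE (G n)) H) @ U --> P T H.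
  have [|a ua] := cg T (fun H' => (H' == H)%:R); last exact: cvgP ua.
  by move=> H'; case: (_ == _); rewrite ?ler01 ?lexx.
have wP T (g : {set {set T}} -> R) : (fun n => mavg (kE (G n)) g) @ U --> wsum (P T) g.
  rewrite (_ : (fun n => _) = fun n => \sum_H mlaw R (kE (G n)) H * g H); last first.
    by apply/funext => n; rewrite -wsum_mlaw.
  by apply: cvg_sumr => H; apply: cvgMl; exact: hP.
have wPE T (g : {set {set T}} -> R) (a : R) : (fun n => mavg (kE (G n)) g) @ U --> a -> wsum (P T) g = a.
  by move=> ga; exact: (cvg_unique _ (wP T g) ga).
have eP : exch P.
  split => [T H|T|T T' f g fI].
  - by apply: limr_ge; [exact: hP|apply: (@filterE _ U) => n; exact: mlaw_ge0].
  - have <- : wsum (P T) (fun=> 1) = \sum_H P T H by apply: eq_bigr => H _; rewrite mulr1.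
    apply: wPE; rewrite (_ : (fun n => _) = fun=> 1); first exact: cvg_cst.
    by apply/funext => n; rewrite mavg1.
  - apply: wPE; rewrite (_ : (fun n => _) = fun n => mavg (kE (G n)) g); first exact: wP.
    by apply/funext => n; rewrite mavg_pb.
have [|W [hW tW]] := limit_exists eP k0.
  move=> T E uE; rewrite /dens; apply: wPE.
  rewrite (_ : (fun n => _) = fun n => (mavg (kE (G n)) (fun H => (E \subset H)%:R : R)) ^+ 2).
    by rewrite expr2; apply: cvgM; exact: wP.
  by apply/funext => n; rewrite mavg_disjoint.
exists W; split => // F; rewrite (_ : (fun n => _) = fun n => mavg (kE (G n)) (fun H => (kE F \subset H)%:R)).
  by rewrite tW ?/dens; [exact: wP|move=> A AF; apply/eqP; exact: (forall_inP (kunif F))].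
by apply/funext => n; rewrite tG_mavg.
Qed.

(** * Degrees along convergent sequences *)

Section arms.
Context (R : realType) (k l : nat) (B : finType).
Hypothesis lk : (l < k)%N.
Local Notation d := (k - l)%N.
Local Notation T := ('I_l + B * 'I_d)%type.

(* [arm b] is a [k]-set made of the common [l]-set [body] and a private [(k - l)]-set. *)
Definition arm_map (b : B) (i : 'I_k) : T :=
  match fintype.split (cast_ord (esym (subnKC (ltnW lk))) i) with
  | inl a => inl a | inr c => inr (b, c) end.

Lemma arm_map_inj b : injective (arm_map b).
Proof.
move=> i j; rewrite /arm_map.
case: split_ordP => a ia; case: split_ordP => c jc // [ac]; apply: (@cast_ord_inj _ _ (esym (subnKC (ltnW lk))));
  by rewrite ia jc ac.
Qed.

Lemma arm_map_inl b (i : 'I_k) : (i < l)%N = if arm_map b i is inl _ then true else false.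
Proof.
rewrite /arm_map; case: split_ordP => a /(congr1 val) /= ->; first by rewrite ltn_ord.
by rewrite ltnNge leq_addr.
Qed.

Definition arm (b : B) : {set T} := arm_map b @: [set: 'I_k]%SET.

Lemma card_arm b : #|arm b| = k.
Proof. by rewrite card_imset ?cardsT ?card_ord//; exact: arm_map_inj. Qed.

Lemma armP b t : (t \in arm b) = match t with inl _ => true | inr (b', _) => b == b' end.
Proof.
apply/imsetP/idP => [[i _ ->]|].
  by rewrite /arm_map; case: fintype.split => // _; rewrite eqxx.
case: t => [a _|[b' c] /eqP <-].
  exists (cast_ord (subnKC (ltnW lk)) (lshift _ a)) => //.
  by rewrite /arm_map cast_ordK (unsplitK (inl a)).
exists (cast_ord (subnKC (ltnW lk)) (rshift _ c)) => //.
by rewrite /arm_map cast_ordK (unsplitK (inr c)).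
Qed.

Definition body : {set T} := inl @: [set: 'I_l]%SET.

Lemma bodyP t : (t \in body) = if t is inl _ then true else false.
Proof.
by case: t => [a|p]; [rewrite imset_f|apply/imsetP => -[]].
Qed.

Lemma arm_inj : injective arm.
Proof.
move=> b b' bb'; have d0 : (0 < d)%N by rewrite subn_gt0.
have : inr (b, Ordinal d0) \in arm b by rewrite armP.
by rewrite bb' armP => /eqP.
Qed.

Definition arm_block (b : B) : pred {set T} := fun C => (C \subset arm b) && ~~ (C \subset body).

Lemma arm_block_disjoint b c C : b != c -> ~~ (arm_block b C && arm_block c C).
Proof.
move=> bc; apply/negP => /andP[/andP[/fintype.subsetP Cb nC] /andP[/fintype.subsetP Cc _]].
case/subsetPn: nC => t tC; rewrite bodyP.
have := Cb _ tC; have := Cc _ tC; rewrite !armP; case: t tC => // -[b' e] _ /eqP cb' /eqP bb'.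
by rewrite cb' bb' eqxx in bc.
Qed.

Definition body_map (C : rle k l) : {set T} := inl @: [set a : 'I_l | widen_ord (ltnW lk) a \in val C]%SET.

Lemma arm_map_body b (C : rle k l) : arm_map b @: val C = body_map C.
Proof.
have /andP[_ /fintype.subsetP Cl] := valP C.
have wi (i : 'I_k) (a : 'I_l) : arm_map b i = inl a -> i = widen_ord (ltnW lk) a.
  rewrite /arm_map; case: split_ordP => // c ic [ca]; apply: val_inj; rewrite -ca /=.
  by have /(congr1 val) := ic.
apply/setP => t; apply/imsetP/imsetP => [[i iC ->]|[a]].
  have il : (i < l)%N by have := Cl _ iC; rewrite inE.
  move: il; rewrite (arm_map_inl b); case E : arm_map => [a|//] _.
  by exists a => //; rewrite inE -(wi _ _ E).
rewrite inE => aC ->; exists (widen_ord (ltnW lk) a) => //.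
have : (widen_ord (ltnW lk) a < l)%N by exact: (ltn_ord a).
rewrite (arm_map_inl b); case E : arm_map => [a'|//] _; congr inl.
by have /(congr1 val) /= := wi _ _ E => aa'; apply: val_inj.
Qed.

Lemma arm_map_block b (C : rlt k) : arm_block b (arm_map b @: val C) = offl l C.
Proof.
rewrite /arm_block imsetS ?finset.subsetT//= /offl; congr (~~ _).
apply/fintype.subsetP/fintype.subsetP => H i iC.
  have := H _ (imset_f (arm_map b) iC); rewrite bodyP => E.
  by rewrite inE /= (arm_map_inl b).
case/imsetP: iC => j jC ->; have := H _ jC; rewrite inE /= bodyP.
by rewrite (arm_map_inl b).
Qed.

Lemma body_map_inj : injective body_map.
Proof.
have lI : injective (@inl 'I_l (B * 'I_d)) by move=> ? ? [].
move=> C C' /(imset_inj lI) /setP CC'; apply: val_inj; apply/setP => i.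
have mem_lt (D : rle k l) : i \in val D -> (i < l)%N.
  by move=> iD; have /andP[_ /fintype.subsetP/(_ i iD)] := valP D; rewrite inE.
have [il|il] := boolP (i < l)%N; last first.
  by transitivity false; [|apply: esym]; apply: contraNF il => /mem_lt.
have := CC' (Ordinal il); rewrite !inE.
by have -> : widen_ord (ltnW lk) (Ordinal il) = i by exact: val_inj.
Qed.

Context (W : cubeT R (rlt k) -> R).
Hypothesis hW : hyperB W.

Lemma EE_arm b (x : cubeT R {set T}) :
  EE (mu R {set T}) (fun y => wt W (arm b) (mix (arm_block b) y x)) =
  degB W (fun C : rle k l => x (body_map C)).
Proof.
have aI := arm_map_inj (b := b).
have hI : injective (fun C : rlt k => arm_map b @: val C).
  by move=> C C' /(imset_inj aI) /val_inj.
rewrite /degB -(EI_reindex hI); last by apply: bmf_mixl; exact: hyperB_bmf.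
congr (EE _ _); apply/funext => y; rewrite wtE//; congr W; apply/funext => C.
rewrite /mix arm_map_block; case: ifPn => // /negPn Cl; rewrite /ext.
have CP : (val C != finset.set0) && (val C \subset [set i : 'I_k | (i < l)%N]).
  by case/andP: (valP C) => -> _.
case: insubP => [D _ DC|]; last by move=> /negP[]; exact: CP.
by rewrite /= -(arm_map_body b) DC.
Qed.

Lemma wt_arm_local b c (x y : cubeT R {set T}) : b != c ->
  wt W (arm c) (mix (arm_block b) y x) = wt W (arm c) x.
Proof.
move=> bc; apply: wt_local => //; first exact: card_arm.
move=> C C0 Cc; rewrite /mix; case: ifP => // Cb.
case/negP: (arm_block_disjoint C bc); rewrite Cb /arm_block (proper_sub Cc) /=.
by case/andP: Cb.
Qed.

(** Given the coordinates inside the body, the arms use disjoint blocks of coordinates and each is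
    an edge with conditional probability the degree: a moment of the degree is a density. *)
Lemma tau_arms : tau W (arm @: [set: B]%SET) = EE (mu R (rle k l)) (fun x => degB W x ^+ #|B|).
Proof.
have bd : bmf (fun x => degB (l := l) W x ^+ #|B|) by apply: bmfX; apply: bmf_degB; exact: hyperB_bmf.
rewrite /tau.
transitivity (EE (mu R {set T}) (fun x => 1 * \prod_(b <- enum B) wt W (arm b) x)).
  congr (EE _ _); apply/funext => x; rewrite mul1r big_imset/=; last by move=> ? ? _ _; exact: arm_inj.
  by rewrite big_enum /=; apply: eq_bigl => b; rewrite inE.
rewrite (EI_blocks (S := arm_block)) ?enum_uniq//; last 4 first.
- exact: bmf_cst.
- by move=> b; exact: bmf_wt.
- by move=> b c x y _ _; exact: wt_arm_local.
- by move=> b c C _ _; exact: arm_block_disjoint.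
have [B0|[b0 _]] := set_0Vmem [set: B]%SET.
  have B0' : #|B| = 0%N by rewrite -cardsT B0 cards0.
  rewrite B0' (_ : (fun x => _) = fun=> 1); last first.
    by apply/funext => x; rewrite mul1r big_enum big_pred0// => b; have := finset.in_setT b; rewrite B0 inE.
  by rewrite EE_cst; apply: esym; exact: EE_cst.
rewrite -(EI_reindex body_map_inj)//; congr (EE _ _); apply/funext => x.
by rewrite mul1r big_enum /= (eq_bigr _ (fun b _ => EE_arm b x)) prodr_const.
Qed.

End arms.

(** Controls collisions, that is the chance that [t] random vertices coincide with one another or
    hit [l] given ones; it also compares binomial normalizations with powers of [n]. *)
Lemma ffact_ratio (R : realType) (n l t : nat) : (0 < n)%N ->
  (1 : R) - (t * (l + t))%:R / n%:R <= ((n - l) ^_ t)%:R / (n ^ t)%:R <= (1 : R).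
Proof.
move=> n0; have n0' : 0 < n%:R :> R by rewrite ltr0n.
elim: t => [|t /andP[IH1 IH2]]; first by rewrite ffactn0 expn0 divr1 mul0n mul0r subr0 lexx.
have E : ((n - l) ^_ t.+1)%:R / (n ^ t.+1)%:R =
    ((n - l) ^_ t)%:R / (n ^ t)%:R * ((n - l - t)%:R / n%:R) :> R.
  by rewrite ffactnSr expnSr !natrM mulf_div.
rewrite E; set x : R := ((n - l) ^_ t)%:R / (n ^ t)%:R in IH1 IH2 *; have x0 : 0 <= x by rewrite /x divr_ge0.
have y1 : (n - l - t)%:R / n%:R <= 1 :> R.
  by rewrite ler_pdivrMr// mul1r ler_nat -subnDA leq_subr.
have y2 : 1 - (l + t)%:R / n%:R <= (n - l - t)%:R / n%:R :> R.
  rewrite ler_pdivlMr// mulrBl mul1r divfK ?gt_eqF// -subnDA lerBlDr -natrD ler_nat.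
  by lia.
apply/andP; split; last by rewrite -[leRHS]mulr1 ler_pM// divr_ge0.
apply: (@le_trans _ _ (x - (l + t)%:R / n%:R)); last first.
  apply: (@le_trans _ _ (x * (1 - (l + t)%:R / n%:R))); last exact: ler_wpM2l.
  rewrite mulrBr mulr1 lerB// ler_piMl// divr_ge0//.
apply: le_trans (lerB IH1 (lexx _)); rewrite -addrA lerD2l -opprD lerN2 -mulrDl.
rewrite ler_pM2r ?invr_gt0// -natrD ler_nat.
by nia.
Qed.

Lemma kdelta_le k l (G : kgraph k) (L : {set 'I_(kv G)}) : #|L| = l -> kdeg L != 0%N ->
  (kdelta l G <= kdeg L)%N.
Proof.
move=> Ll dL; apply/bigmax_leqP => m /forallP/(_ L).
by rewrite Ll eqxx /= (negbTE dL).
Qed.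

Lemma kdegE k (G : kgraph k) (L : {set 'I_(kv G)}) :
  kdeg L = (\sum_(A in kE G | L \subset A) 1)%N.
Proof.
rewrite /kdeg -sum1_card; apply: eq_bigl => A.
by apply/idP/idP; rewrite inE.
Qed.

(** * Rooted densities in a finite graph *)

Section averages.
Context (R : realType) (n : nat).
Hypothesis n0 : (0 < n)%N.
Local Notation V := 'I_n.

Fixpoint savg (m : nat) (f : seq V -> R) (s : seq V) : R :=
  if m is m'.+1 then (\sum_v savg m' f (v :: s)) / n%:R else f s.

Lemma savg_add m p f s : savg (m + p) f s = savg m (savg p f) s.
Proof.
elim: m s => [//|m IH] s; rewrite addSn /=; congr (_ / _).
by apply: eq_bigr => v _; rewrite IH.
Qed.

Lemma savg_le m f g s t : (forall w, size w = m -> f (w ++ s) <= g (w ++ t)) ->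
  savg m f s <= savg m g t.
Proof.
elim: m s t => [|m IH] s t fg /=; first exact: (fg [::]).
rewrite ler_wpM2r ?invr_ge0// ler_sum// => v _; apply: IH => w wm.
by rewrite -!cat_rcons; apply: fg; rewrite size_rcons wm.
Qed.

Lemma savgZ m c f s : savg m (fun s => c * f s) s = c * savg m f s.
Proof.
elim: m s => [//|m IH] s /=; rewrite mulrA; congr (_ / _).
by rewrite mulr_sumr; apply: eq_bigr => v _; rewrite IH.
Qed.

Lemma savg_ffun m (F : {set V} -> R) s :
  savg m (fun t => F [set x in t]%SET) s =
  (\sum_(w : {ffun 'I_m -> V}) F ((w @: [set: 'I_m]) :|: [set x in s])%SET) / (n ^ m)%:R.
Proof.
elim: m s => [|m IH] s /=.
  rewrite expn0 divr1 (big_pred1 [ffun i : 'I_0 => widen_ord (leq0n n) i]).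
    congr F; apply/setP => x; rewrite !inE; case: imsetP => // -[[]//].
  by move=> w; apply/esym/eqP/ffunP => -[].
rewrite (eq_bigr _ (fun v _ => IH (v :: s))) -mulr_suml -mulrA -invfM -natrM -expnSr.
congr (_ / _); rewrite pair_big /=.
pose j (p : V * {ffun 'I_m -> V}) : {ffun 'I_m.+1 -> V} :=
  [ffun i => if unlift ord0 i is Some i' then p.2 i' else p.1].
rewrite [RHS](reindex j)/=; last first.
  exists (fun w : {ffun 'I_m.+1 -> V} => (w ord0, [ffun i => w (lift ord0 i)])) => [[v w] _|w _].
    rewrite /j /= ffunE unlift_none; congr (_, _); apply/ffunP => i.
    by rewrite !ffunE liftK.
  apply/ffunP => i; rewrite /j ffunE; case: unliftP => [i' ->|->] //=.
  by rewrite ffunE.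
apply: eq_bigr => -[v w] _ /=; congr F; apply/setP => x; rewrite !inE.
have -> : (x \in j (v, w) @: [set: 'I_m.+1]%SET) = (x == v) || (x \in w @: [set: 'I_m]%SET).
  apply/imsetP/orP => [[i _ ->]|[/eqP ->|/imsetP[i _ ->]]].
  - by rewrite /j ffunE; case: unliftP => [i' _|_] /=; [right; rewrite imset_f|left].
  - by exists ord0 => //; rewrite /j ffunE unlift_none.
  - by exists (lift ord0 i) => //; rewrite /j ffunE liftK.
by case: (x == v); rewrite /= ?orbT.
Qed.

End averages.

Section graph_degrees.
Context (R : realType) (k l : nat) (G : kgraph k).
Hypothesis lk : (l < k)%N.
Local Notation n := (kv G).
Local Notation V := 'I_n.
Local Notation d := (k - l)%N.
Hypothesis n0 : (0 < n)%N.

Definition edgeb (s : seq V) : R := ([set x in s]%SET \in kE G)%:R.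

(** Degree normalized by random ordered extensions, repetitions allowed. Its moments are
    homomorphism densities exactly, unlike those of the degree divided by a binomial coefficient. *)
Definition ndeg (s : seq V) : R := savg d edgeb s.

Lemma card_kE A : A \in kE G -> #|A| = k.
Proof. by move=> AE; apply/eqP; exact: (forall_inP (kunif G)). Qed.

Lemma ndegE s : ndeg s =
  (\sum_(w : {ffun 'I_d -> V}) (((w @: [set: 'I_d]) :|: [set x in s])%SET \in kE G)%:R) / (n ^ d)%:R.
Proof. exact: (savg_ffun d (fun A => (A \in kE G)%:R) s). Qed.

(** Every edge through the [l]-set arises from [d]! ordered extensions, the injections into the part
    of the edge outside it, and different edges from different extensions. *)
Lemma ndeg_ge (s : seq V) : #|[set x in s]%SET| = l ->
  (d`! * kdeg [set x in s]%SET)%:R / (n ^ d)%:R <= ndeg s.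
Proof.
move=> sl; rewrite ndegE ler_wpM2r ?invr_ge0//; set L := [set x in s]%SET in sl *.
rewrite kdegE -natr_sum ler_nat big_distrr /=.
have E A : (A \in kE G) && (L \subset A) ->
    d`! = (\sum_(w : {ffun 'I_d -> V}) ((w \in ffun_on (mem (A :\: L)%SET)) && injectiveb w))%N.
  move=> /andP[AE LA]; have := card_inj_ffuns_on 'I_d (mem (A :\: L)%SET).
  have -> : #|mem (A :\: L)%SET| = d by rewrite cardsD (finset.setIidPr LA) sl card_kE.
  rewrite card_ord ffactnn => <-; rewrite -sum1_card big_mkcond /=; apply: eq_bigr => w _.
  by rewrite inE; case: (_ && _).
rewrite (eq_bigr _ (fun A H => congr1 (muln^~ 1%N) (E A H))).
under eq_bigr do rewrite muln1.
rewrite exchange_big /=; apply: leq_sum => w _.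
apply: (@leq_trans (\sum_(A | (A == (w @: [set: 'I_d]) :|: L)%SET) ((A \in kE G) : nat))%N); last first.
  by rewrite big_pred1_eq.
rewrite big_mkcond [leqRHS]big_mkcond /=; apply: leq_sum => A _.
case: ifP => [/andP[AE LA]|_]; last by case: ifP.
have [/andP[/ffun_onP wA /injectiveP wI]|] := boolP (_ && _); last by case: ifP.
rewrite AE ifT//; apply/eqP.
have -> : w @: [set: 'I_d]%SET = (A :\: L)%SET.
  apply/eqP; rewrite eqEcard; apply/andP; split.
    by apply/fintype.subsetP => _ /imsetP[i _ ->]; exact: wA.
  by rewrite card_imset// cardsT card_ord cardsD (finset.setIidPr LA) sl card_kE.
apply/setP => x; rewrite !inE; case: (boolP (x \in s)) => /= [xs|]; last by rewrite orbF.
by rewrite (fintype.subsetP LA)// inE.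
Qed.

(** An edge has [l + d] vertices, so a positive extension density forces the entries of [s] to be
    [l] distinct vertices. *)
Lemma ndeg_gt0 (s : seq V) : (size s <= l)%N -> 0 < ndeg s ->
  #|[set x in s]%SET| = l /\ kdeg [set x in s]%SET != 0%N.
Proof.
move=> sl; rewrite ndegE => H.
have [w wE] : exists w : {ffun 'I_d -> V}, ((w @: [set: 'I_d]) :|: [set x in s])%SET \in kE G.
  apply: contrapT => nw; move: H; rewrite big1 ?mul0r ?ltxx// => w _.
  by have [wE|//] := boolP (_ \in kE G); case: nw; exists w.
split.
  apply/eqP; rewrite eqn_leq; apply/andP; split.
    by apply: leq_trans sl; rewrite cardsE; exact: card_size.
  have := card_kE wE => E; have := leq_card_setU (w @: [set: 'I_d]%SET) [set x in s]%SET.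
  rewrite E => H1.
  have H2 : (#|w @: [set: 'I_d]%SET| <= d)%N by rewrite (leq_trans (leq_imset_card _ _))// cardsT card_ord.
  by rewrite -(leq_add2l d) subnK ?(ltnW lk)//; apply: leq_trans H1 _; rewrite leq_add2r.
rewrite kdegE (bigD1 ((w @: [set: 'I_d]) :|: [set x in s])%SET)//=.
by rewrite wE finset.subsetUr.
Qed.

Definition mindeg : R := (d`! * kdelta l G)%:R / (n ^ d)%:R.

Lemma mindeg_le (s : seq V) : (size s <= l)%N -> 0 < ndeg s -> mindeg <= ndeg s.
Proof.
move=> sl /(ndeg_gt0 sl)[sl' ds]; apply: le_trans (ndeg_ge sl').
by rewrite ler_wpM2r ?invr_ge0// ler_nat leq_mul2l kdelta_le ?orbT.
Qed.

Lemma edgeb01 s : 0 <= edgeb s <= 1.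
Proof. by rewrite /edgeb; case: (_ \in _); rewrite ?lexx ?ler01. Qed.

Lemma savg01 m f s : (forall s, 0 <= f s <= 1) -> 0 <= savg (R := R) (n := n) m f s <= 1.
Proof.
move=> f01; elim: m s => [|m IH] s /=; first exact: f01.
rewrite divr_ge0 ?sumr_ge0//=; last by move=> v _; case/andP: (IH (v :: s)).
rewrite ler_pdivrMr ?ltr0n// mul1r -[leRHS]mulr1n.
apply: (@le_trans _ _ (\sum_(v : V) 1)); last by rewrite sumr_const card_ord mulr1n.
by apply: ler_sum => v _; case/andP: (IH (v :: s)).
Qed.

Lemma ndeg01 s : 0 <= ndeg s <= 1.
Proof. by apply: savg01; exact: edgeb01. Qed.

Lemma ndeg_alt (s : seq V) : (size s <= l)%N -> ndeg s = 0 \/ mindeg <= ndeg s.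
Proof.
move=> sl; have /andP[] := ndeg01 s; rewrite le_eqVlt => /predU1P[<- _|s0 _]; first by left.
by right; exact: mindeg_le.
Qed.

Lemma savg_eqi m s t : s =i t -> savg m edgeb s = savg m edgeb t.
Proof.
move=> st; rewrite !(savg_ffun m (fun A => (A \in kE G)%:R)).
by have -> : [set x in s]%SET = [set x in t]%SET by apply/setP => x; rewrite !inE st.
Qed.

(* A sequence [a :: z] of positive density yields many sequences [w ++ z] with
   [w ++ a :: z] extendable to an edge; such a [w ++ z] has positive, hence large, degree. *)
Lemma savg_drop i a z : (size z + i.+1 = l)%N ->
  mindeg * savg (d + i) edgeb (a :: z) <= savg (d + i.+1) edgeb z.
Proof.
move=> zl; have d0 : (0 < d)%N by rewrite subn_gt0.
rewrite (_ : d + i = i.+1 + d.-1)%N; last by lia.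
rewrite (addnC d i.+1) !savg_add -savgZ; apply: savg_le => w wi.
have M0 : 0 <= mindeg by rewrite /mindeg divr_ge0.
rewrite (savg_eqi _ (t := a :: (w ++ z))); last by move=> x; rewrite !(mem_cat, in_cons) orbCA.
have sz : (size (w ++ z) <= l)%N by rewrite size_cat wi addnC zl.
have /andP[e0 e1] := savg01 d.-1 (a :: w ++ z) edgeb01.
have [|] := ndeg_alt sz; rewrite /ndeg => H; last by apply: le_trans H; rewrite ler_piMr.
suff -> : savg d.-1 edgeb (a :: w ++ z) = 0 by rewrite mulr0 H.
apply/eqP; rewrite eq_le e0 andbT leNgt; apply/negP => ep.
have : 0 < savg d edgeb (w ++ z); last by rewrite H ltxx.
rewrite -(prednK d0) /= divr_gt0 ?ltr0n// (bigD1 a)//= ltr_pwDl//.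
by apply: sumr_ge0 => v _; case/andP: (savg01 d.-1 (v :: w ++ z) edgeb01).
Qed.

(** Start from [l] vertices of some edge, whose extension density is at least [mindeg], and release
    them one by one with [savg_drop], each at the cost of a factor [mindeg]. *)
Lemma mindeg_edge : mindeg ^+ l.+1 <= savg k edgeb [::].
Proof.
have M0 : 0 <= mindeg by rewrite /mindeg divr_ge0.
have [K0|K0] := posnP (kdelta l G).
  by rewrite /mindeg K0 muln0 mul0r exprS mul0r; case/andP: (savg01 k [::] edgeb01).
suff H i : (i <= l)%N -> exists2 s : seq V, (size s + i = l)%N & mindeg ^+ i.+1 <= savg (d + i) edgeb s.
  have [s] := H l (leqnn l); rewrite -[X in _ = X]add0n => /addIn /size0nil ->.
  by rewrite subnK// ltnW.
elim: i => [_|i IH il].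
  have [A AE] : exists A, A \in kE G.
    apply/set0Pn; apply: contraTneq K0; rewrite -leqNgt /kdelta => ->.
    by rewrite cards0; apply/bigmax_leqP => -[m /=]; rewrite ltnS.
  have sA : size (take l (enum A)) = l.
    by rewrite size_takel// -cardE (card_kE AE) ltnW.
  exists (take l (enum A)); first by rewrite addn0.
  rewrite addn0 expr1.
  have LA : [set x in take l (enum A)]%SET \subset A.
    by apply/fintype.subsetP => x; rewrite inE => /mem_take; rewrite mem_enum.
  have cL : #|[set x in take l (enum A)]%SET| = l.
    by rewrite cardsE (card_uniqP _) ?take_uniq ?enum_uniq.
  apply: le_trans (ndeg_ge cL); rewrite ler_wpM2r ?invr_ge0// ler_nat leq_mul2l kdelta_le ?orbT//.
  by rewrite kdegE (bigD1 A)//= AE LA.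
have [|s sl sM] := IH; first exact: ltnW.
case: s sl sM => [|a z] sl sM; first by move: il; rewrite -sl add0n ltnn.
have zl : (size z + i.+1 = l)%N by rewrite addnS -addSn.
exists z => //; apply: le_trans (savg_drop a zl); rewrite exprS ler_wpM2l//.
Qed.

End graph_degrees.

(** A map of the whole configuration is a map of the body together with one independent extension
    per arm. This is the finite counterpart of [tau_arms]. *)
Lemma mavg_arms (R : realType) (k l : nat) (B : finType) (lk : (l < k)%N) (G : kgraph k) :
  (0 < kv G)%N ->
  mavg (kE G) (fun H => (arm (B := B) lk @: [set: B]%SET \subset H)%:R) =
  (\sum_(u : {ffun 'I_l -> 'I_(kv G)}) ndeg R l (codom u) ^+ #|B|) / (kv G ^ l)%:R.
Proof.
move=> n0; set n := kv G; set d := (k - l)%N.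
pose j (p : {ffun 'I_l -> 'I_n} * {ffun B -> {ffun 'I_d -> 'I_n}}) : {ffun 'I_l + B * 'I_d -> 'I_n} :=
  [ffun z => match z with inl a => p.1 a | inr (b, c) => p.2 b c end].
rewrite /mavg (reindex j)/=; last first.
  exists (fun f : {ffun 'I_l + B * 'I_d -> 'I_n} =>
    ([ffun a => f (inl a)], [ffun b => [ffun c => f (inr (b, c))]])).
    move=> [u w] _; rewrite /j /=; congr (_, _); first by apply/ffunP => a; rewrite !ffunE.
    by apply/ffunP => b; apply/ffunP => c; rewrite !ffunE.
  by move=> f _; rewrite /j; apply/ffunP => -[a|[b c]]; rewrite !ffunE.
pose F (u : {ffun 'I_l -> 'I_n}) (w : {ffun 'I_d -> 'I_n}) : R :=
  ((w @: [set: 'I_d] :|: [set x in codom u])%SET \in kE G)%:R.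
have jE u w : (arm (B := B) lk @: [set: B]%SET \subset pb (j (u, w)) (kE G))%:R = \prod_b F u (w b).
  have jb b : j (u, w) @: arm lk b = (w b @: [set: 'I_d] :|: [set x in codom u])%SET.
    apply/setP => x; rewrite !inE; apply/imsetP/orP.
      move=> [[a|[b' c]]]; rewrite armP; first by move=> _ ->; rewrite ffunE; right; exact: codom_f.
      by move=> /eqP <- ->; rewrite ffunE; left; rewrite imset_f.
    case=> [/imsetP[c _ ->]|/codomP[a ->]].
      by exists (inr (b, c)); rewrite ?armP ?ffunE.
    by exists (inl a); rewrite ?armP ?ffunE.
  have -> : (arm (B := B) lk @: [set: B]%SET \subset pb (j (u, w)) (kE G)) =
      [forall b, (w b @: [set: 'I_d] :|: [set x in codom u])%SET \in kE G].
    apply/fintype.subsetP/forallP => [H b|H _ /imsetP[b _ ->]]; last by rewrite inE jb.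
    by have := H _ (imset_f (arm lk) (finset.in_setT b)); rewrite inE jb.
  case: (boolP [forall b, _]) => [/forallP H|/forallPn[b /negbTE Hb]].
    by rewrite big1// => b _; rewrite /F H.
  by rewrite (bigD1 b)//= /F Hb mul0r.
rewrite card_sum card_prod !card_ord -/n expnD mulnC natrM invfM mulrA; congr (_ / _).
rewrite (eq_bigr (fun p : {ffun 'I_l -> 'I_n} * {ffun B -> {ffun 'I_d -> 'I_n}} =>
  \prod_b F p.1 (p.2 b))); last by move=> [u w] _; rewrite jE.
rewrite -(pair_big predT predT (fun u (w : {ffun B -> {ffun 'I_d -> 'I_n}}) => \prod_b F u (w b)))/=.
rewrite mulr_suml; apply: eq_bigr => u _.
rewrite -(bigA_distr_bigA (fun (b : B) w => F u w)) /= prodr_const ndegE// exprMn exprVn -natrX -expnM.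
by rewrite (mulnC d).
Qed.

Lemma mavg_edge (R : realType) (k : nat) (G : kgraph k) : (0 < kv G)%N ->
  mavg (kE G) (fun H => ([set [set: 'I_k]]%SET \subset H)%:R) = savg k (edgeb R (G := G)) [::].
Proof.
move=> n0; rewrite (savg_ffun k (fun A => (A \in kE G)%:R)) /mavg card_ord; congr (_ / _).
apply: eq_bigr => w _; rewrite finset.sub1set inE.
have -> : [set x in [::] : seq 'I_(kv G)]%SET = finset.set0 by apply/setP => x; rewrite !inE.
by rewrite finset.setU0.
Qed.

(** An injective homomorphism would be a copy of [F], so only non-injective maps can count, and
    these are rare in a large graph. *)
Lemma tG_free (R : realType) k (Fam : kgraph k -> Prop) (F G : kgraph k) : (0 < kv G)%N ->
  kfree Fam G -> Fam F -> tG R F G <= (kv F * kv F)%:R / (kv G)%:R.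
Proof.
move=> n0 fG FF; have := ffact_ratio R 0 (kv F) n0; rewrite subn0 add0n => /andP[+ _].
suff : tG R F G + (kv G ^_ kv F)%:R / (kv G ^ kv F)%:R <= 1 by lra.
rewrite /tG -mulrDl ler_pdivrMr ?ltr0n ?expn_gt0 ?n0// mul1r -natrD ler_nat.
rewrite -[X in (X ^_ _)%N]card_ord -[X in (_ ^_ X)%N]card_ord -card_inj_ffuns.
rewrite -[X in (_ <= X ^ _)%N]card_ord -[X in (_ <= _ ^ X)%N]card_ord -card_ffun.
set A := (X in (#|X| + _ <= _)%N); set B := (X in (_ + #|X| <= _)%N).
rewrite -[X in (_ <= X)%N](cardC (mem B)) addnC leq_add2l; apply: subset_leq_card.
apply/fintype.subsetP => f; rewrite inE => fA; rewrite !inE; apply/negP => /injectiveP fI.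
apply: (fG F FF); exists f; split=> // C CF.
by move: fA => /forall_inP/(_ C CF).
Qed.

Lemma tau_edge (R : realType) (k : nat) (W : cubeT R (rlt k) -> R) : hyperB W ->
  tau W [set [set: 'I_k]]%SET = EE (mu R (rlt k)) W.
Proof.
move=> hW.
have vI : injective (fun B : rlt k => val B) by move=> B B' /val_inj.
rewrite /tau -(EI_reindex vI (hyperB_bmf hW)).
congr (EE _ _); apply/funext => x; rewrite big_set1.
have idT : id @: [set: 'I_k]%SET = [set: 'I_k]%SET by exact: imset_id.
rewrite -[in LHS]idT wtE//; congr W; apply/funext => B; by rewrite imset_id.
Qed.

(** * Passing to the limit along a filter *)

Section graph_sequence.
Context (R : realType) (k l : nat) (lk : (l < k)%N) (G : nat -> kgraph k) (FF : set_system nat).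
Context (W : cubeT R (rlt k) -> R).
Hypothesis hW : hyperB W.
Hypothesis G0 : forall n, (0 < kv (G n))%N.
Hypothesis PF : ProperFilter FF.
Hypothesis sF : \oo `<=` FF.
Hypothesis GW : forall F : kgraph k, (fun n => tG R F (G n)) @ FF --> tau W (kE F).

Lemma cvg_mavg (T : finType) (E : {set {set T}}) : uniform k E ->
  (fun n => mavg (kE (G n)) (fun H => (E \subset H)%:R : R)) @ FF --> tau W E.
Proof.
move=> uE; have rI : injective (@enum_rank T) := enum_rank_inj.
pose E' : {set {set 'I_#|T|}} := (fun A : {set T} => enum_rank @: A) @: E.
have uE' : [forall A in E', #|A| == k].
  by apply/forall_inP => _ /imsetP[A AE ->]; rewrite card_imset// uE.
rewrite -(tau_imset hW rI uE); have := @GW (KGraph uE') => /=.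
rewrite (_ : (fun n => _) = (fun n => mavg (kE (G n)) (fun H => (E \subset H)%:R : R)))//.
apply/funext => n; rewrite tG_mavg /=.
rewrite -(mavg_pb (kE (G n)) (G0 n) (fun H => (E \subset H)%:R) rI); congr (mavg _ _).
apply/funext => H; congr (_%:R); congr nat_of_bool.
apply/fintype.subsetP/fintype.subsetP => EH A.
  by move=> AE; rewrite inE; apply: EH; exact: imset_f.
by case/imsetP => B BE ->; have := EH _ BE; rewrite inE.
Qed.

Lemma cvg_ndeg_poly (p : {poly R}) :
  (fun n => (\sum_(u : {ffun 'I_l -> 'I_(kv (G n))}) p.[ndeg R l (codom u)]) / (kv (G n) ^ l)%:R)
    @ FF --> EE (mu R (rle k l)) (fun x => p.[degB W x]).
Proof.
have bd : bmf (degB (l := l) W) by apply: bmf_degB; exact: hyperB_bmf.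
have -> : EE (mu R (rle k l)) (fun x => p.[degB W x]) =
    \sum_(i < size p) p`_i * EE (mu R (rle k l)) (fun x => degB W x ^+ i).
  transitivity (EE (mu R (rle k l)) (fun x => \sum_(i < size p) p`_i * degB W x ^+ i)).
    by congr (EE _ _); apply/funext => x; rewrite horner_coef.
  rewrite EE_sum; last by move=> i _; apply: bmfZ; exact: bmfX.
  by apply: eq_bigr => i _; rewrite EEZ//; exact: bmfX.
rewrite (_ : (fun n => _) = fun n => \sum_(i < size p) p`_i *
    ((\sum_(u : {ffun 'I_l -> 'I_(kv (G n))}) ndeg R l (codom u) ^+ i) / (kv (G n) ^ l)%:R)).
  apply: cvg_sumr => i; apply: cvgMr.
  have uA : uniform k (arm (B := 'I_i) lk @: [set: 'I_i]%SET).
    by move=> _ /imsetP[b _ ->]; exact: card_arm.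
  have := cvg_mavg uA; rewrite tau_arms// card_ord.
  rewrite (_ : (fun n => _) = fun n =>
    (\sum_(u : {ffun 'I_l -> 'I_(kv (G n))}) ndeg R l (codom u) ^+ i) / (kv (G n) ^ l)%:R)//.
  by apply/funext => n; rewrite mavg_arms// card_ord.
apply/funext => n; rewrite mulr_suml
  (eq_bigr (fun u : {ffun 'I_l -> 'I_(kv (G n))} =>
    \sum_(i < size p) p`_i * (ndeg R l (codom u) ^+ i / (kv (G n) ^ l)%:R))).
  by rewrite exchange_big /=; apply: eq_bigr => i _; rewrite mulr_suml mulr_sumr.
by move=> u _; rewrite horner_coef mulr_suml; apply: eq_bigr => i _; rewrite mulrA.
Qed.

Hypothesis Goo : forall M : nat, exists N : nat, forall n, (N <= n)%N -> (M <= kv (G n))%N.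

Lemma cvg_invkv (c : R) : (fun n => c / (kv (G n))%:R) @ FF --> (0 : R).
Proof.
suff H : (fun n => (kv (G n))%:R^-1) @ FF --> (0 : R).
  by rewrite -[0](mulr0 c); exact: cvgMr.
apply/cvgr0Pnorm_le => e e0; apply: sF.
have [m _ /(_ m (leqnn m)) /= me] := near_infty_natSinv_lt (PosNum e0).
have [N HN] := Goo m.+1; exists N => // n /= /HN mn.
rewrite ger0_norm ?invr_ge0//; apply: le_trans (ltW me).
by rewrite lef_pV2 ?posrE ?ltr0n// ler_nat.
Qed.

Lemma limit_free (Fam : kgraph k -> Prop) F : (forall n, kfree Fam (G n)) -> Fam F -> tau W (kE F) = 0.
Proof.
move=> fG FF'; apply/eqP; rewrite eq_le; apply/andP; split.
  apply: (ler_cvg_to (@GW F) (cvg_invkv (kv F * kv F)%:R)).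
  by apply: filterE => n; exact: (tG_free _ _ (fG n)).
by apply: (cvgr_to_ge (@GW F)); apply: filterE => n; rewrite /tG divr_ge0.
Qed.

Variable c : R.
Hypothesis c01 : 0 <= c <= 1.
Hypothesis Gc : (fun n => (kdelta l (G n))%:R / ('C(kv (G n) - l, k - l))%:R) @ FF --> c.

Lemma cvg_mindeg : (fun n => mindeg R l (G n)) @ FF --> c.
Proof.
have E n : mindeg R l (G n) = (kdelta l (G n))%:R / ('C(kv (G n) - l, k - l))%:R *
    (((kv (G n) - l) ^_ (k - l))%:R / (kv (G n) ^ (k - l))%:R) \/ (kv (G n) < k)%N.
  case: (ltnP (kv (G n)) k) => [|kn]; [by right|left].
  rewrite /mindeg -bin_ffact !natrM mulrA; congr (_ / _).
  rewrite mulrA divfK; first exact: mulrC.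
  by rewrite pnatr_eq0 -lt0n bin_gt0 leq_sub2r.
have -> : c = c * 1 by rewrite mulr1.
have H : (fun n => (kdelta l (G n))%:R / ('C(kv (G n) - l, k - l))%:R *
    (((kv (G n) - l) ^_ (k - l))%:R / (kv (G n) ^ (k - l))%:R)) @ FF --> c * 1.
  apply: cvgM => //; set a := ((k - l) * (l + (k - l)))%N.
  have Ha : (fun n => (1 : R) - a%:R / (kv (G n))%:R) @ FF --> (1 : R).
    by rewrite -[X in _ --> X]subr0; apply: cvgB; [exact: cvg_cst|exact: cvg_invkv].
  apply: (squeeze_cvgr _ Ha (cvg_cst _)).
  by apply: filterE => n; exact: ffact_ratio.
apply: cvg_trans H; apply: near_eq_cvg; apply: sF.
have [N HN] := Goo k; exists N => // n /= /HN kn.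
by case: (E n) => [->//|]; rewrite ltnNge kn.
Qed.

(** Rules out the zero limit, whose threshold would be 0 by convention instead of [c]. Eventually
    [mindeg] exceeds c/2, which bounds the edge density from below by [mindeg_edge]. *)
Lemma limit_edge : 0 < c -> EE (mu R (rlt k)) W != 0.
Proof.
move=> c0.
have u1 : uniform k [set [set: 'I_k]]%SET by move=> A /set1P ->; rewrite cardsT card_ord.
rewrite -(tau_edge hW).
rewrite gt_eqF//.
apply: (@lt_le_trans _ _ ((c / 2) ^+ l.+1)); first by rewrite exprn_gt0// divr_gt0.
apply: (cvgr_to_ge (cvg_mavg u1)).
have c2 : c / 2 < c by lra.
have := cvg_mindeg => /cvgr_gt/(_ _ c2); apply: filterS => n cn.
rewrite mavg_edge//; apply: le_trans (mindeg_edge R lk (G0 n)).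
have c20 : 0 <= c / 2 by rewrite divr_ge0// ltW.
by apply: lerXn2r; rewrite ?nnegrE//; [exact: le_trans c20 (ltW cn)|exact: ltW].
Qed.

(* The polynomial 1 + t (c - t) is at most 1 on {0} and on [c, 1], and exceeds 1 on ]0, c[;
   so its large powers rule out any mass of the limiting degree in ]0, c[. *)
Let h : {poly R} := 1 + 'X * (c%:P - 'X).

Let hE t : h.[t] = 1 + t * (c - t).
Proof. by rewrite /h !hornerE. Qed.

Let h_ge0 t : 0 <= t <= 1 -> 0 <= h.[t].
Proof. by rewrite hE => /andP[t0 t1]; move: c01 => /andP[c0 c1]; nra. Qed.

(** In the graphs every normalized degree is 0 or at least [mindeg], where the polynomial is at most
    [1 + |c - mindeg|]. For fixed [N] this bound tends to 1 along the sequence. *)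
Lemma EE_peak N : EE (mu R (rle k l)) (fun x => h.[degB W x] ^+ N) <= 1.
Proof.
have -> : (fun x => h.[degB W x] ^+ N) = fun x : cubeT R (rle k l) => (h ^+ N).[degB W x].
  by apply/funext => x; rewrite horner_exp.
have H1 : (fun n => (1 + `|c - mindeg R l (G n)|) ^+ N) @ FF --> (1 : R).
  have {2}-> : 1 = (1 + `|c - c|) ^+ N :> R by rewrite subrr normr0 addr0 expr1n.
  apply: (@continuous_cvg _ _ _ FF _ (fun n => 1 + `|c - mindeg R l (G n)|) (fun x : R => x ^+ N)).
    exact: exprn_continuous.
  by apply: cvgD; [exact: cvg_cst|apply: cvg_norm; apply: cvgB; [exact: cvg_cst|exact: cvg_mindeg]].
apply: (ler_cvg_to (@cvg_ndeg_poly (h ^+ N)) H1); apply: filterE => n.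
have nl : 0 < (kv (G n) ^ l)%:R :> R by rewrite ltr0n expn_gt0 G0.
rewrite ler_pdivrMr//; apply: (@le_trans _ _ (\sum_(u : {ffun 'I_l -> 'I_(kv (G n))})
  (1 + `|c - mindeg R l (G n)|) ^+ N)).
  apply: ler_sum => u _; rewrite horner_exp.
  have /andP[d0 d1] := ndeg01 R l (G0 n) (codom u).
  rewrite lerXn2r// ?nnegrE ?addr_ge0//; first by apply: h_ge0; rewrite d0.
  rewrite hE lerD2l.
  have [|->|dm] := ndeg_alt R lk (G0 n) (s := codom u); first by rewrite size_codom card_ord.
    by rewrite mul0r.
  apply: (@le_trans _ _ (ndeg R l (codom u) * `|c - mindeg R l (G n)|)).
    by rewrite ler_wpM2l//; apply: le_trans (ler_norm _); rewrite lerD2l lerN2.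
  by rewrite ler_piMl.
by rewrite sumr_const card_ffun !card_ord [leRHS]mulr_natr.
Qed.

(** Where the excess of the polynomial over 1 is at least [a], Bernoulli's inequality makes its
    power at least [1 + a * N]. As [EE_peak] bounds the expectation by 1 for every [N], that event
    is null; the values a = 1/(j+1) exhaust ]0, c[. *)
Lemma limit_degree : mu R (rle k l) [set x | 0 < degB W x < c] = 0%E.
Proof.
have [mD _] : bmf (degB (l := l) W) by apply: bmf_degB; exact: hyperB_bmf.
have bd : bmf (degB (l := l) W) by apply: bmf_degB; exact: hyperB_bmf.
pose g (x : cubeT R (rle k l)) := degB W x * (c - degB W x).
have bg : bmf g by apply: bmfM => //; apply: bmfB => //; exact: bmf_cst.
have [mg _] := bg.
have mA (j : nat) : measurable [set x | j.+1%:R^-1 <= g x].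
  rewrite (_ : [set x | _] = setT `&` g @^-1` `[j.+1%:R^-1, +oo[); first by apply: mg => //; exact: measurable_itv.
  by rewrite setTI; apply/seteqP; split => x /=; rewrite in_itv /= andbT.
have mS : measurable [set x : cubeT R (rle k l) | 0 < degB W x < c].
  rewrite (_ : [set x | _] = setT `&` degB W @^-1` `]0, c[); first by apply: mD => //; exact: measurable_itv.
  by rewrite setTI; apply/seteqP; split => x /=; rewrite in_itv.
apply: (subset_measure0 mS (bigcupT_measurable _ mA)).
  move=> x /= /andP[x0 xc]; have g0 : 0 < g x by rewrite mulr_gt0// subr_gt0.
  have [j _ /(_ j (leqnn j)) /= jg] := near_infty_natSinv_lt (PosNum g0).
  by exists j => //=; exact: ltW.
apply: measure0_bigcup => // j.
have bA := bmf_indic R (mA j).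
set P := mu R (rle k l); set a : R := j.+1%:R^-1.
have a0 : 0 < a by rewrite invr_gt0.
have HN N : EE P (\1_[set x | a <= g x]) * (1 + a * N%:R) <= 1.
  apply: le_trans (EE_peak N); rewrite mulrC -EEZ//; apply: EE_le.
  - exact: bmfZ.
  - rewrite (_ : (fun x => _) = fun x => (1 + g x) ^+ N); last by apply/funext => x; rewrite hE.
    by apply: bmfX; apply: bmfD => //; exact: bmf_cst.
  move=> x; rewrite indicE; have [xA|] := boolP (x \in _); last first.
    by move=> _; rewrite mulr0 exprn_ge0// h_ge0// degB01.
  have ag : a <= g x by move: xA; rewrite inE.
  rewrite mulr1 hE -/(g x); apply: (@le_trans _ _ ((1 + a) ^+ N)).
    elim: (N) => [|m IH]; first by rewrite mulr0 addr0.
    rewrite exprS; apply: le_trans (ler_wpM2l _ IH); last by rewrite addr_ge0// ltW.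
    by rewrite -[in leLHS]natr1; have : 0 <= m%:R :> R by []; nra.
  apply: lerXn2r; rewrite ?nnegrE ?lerD2l// addr_ge0//; first exact: ltW.
  exact: le_trans (ltW a0) ag.
rewrite EE_set; last exact: mA.
move: HN; set e := EE _ _ => HN; congr (_%:E).
have e0 : 0 <= e by apply: EE_ge0 => x; rewrite indicE.
apply/eqP; rewrite eq_le e0 andbT leNgt; apply/negP => ep.
have ea : 0 < e * a by rewrite mulr_gt0.
have [N _ /(_ N (leqnn N)) /= Ne] := near_infty_natSinv_lt (PosNum ea).
have := HN N.+1; rewrite leNgt => /negP; apply.
rewrite mulrDr mulr1 mulrA; move: Ne; rewrite invf_plt ?posrE// => Ne.
have : 1 < e * a * N.+1%:R by rewrite mulrC -ltr_pdivrMr// div1r.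
lra.
Qed.

End graph_sequence.

(** * Sampling from a hypergraphon *)

Section sampling.
Context (R : realType) (k : nat) (W : cubeT R (rlt k) -> R).
Hypothesis hW : hyperB W.

(** The condition is put as membership in the interval [0, w[, whose probability for a uniform
    coordinate is [w] by [EE_itv]. *)
Definition eb (T : finType) (A : {set T}) (x : cubeT R {set T}) : bool := 0 <= x A < wt W A x.

Definition Gs (T : finType) (x : cubeT R {set T}) : {set {set T}} :=
  [set A : {set T} | (#|A| == k) && eb A x]%SET.

Lemma measurable_eb (T : finType) (A : {set T}) : measurable [set x : cubeT R {set T} | eb A x].
Proof.
have mc := @measurable_coord R _ A; have [mw _] := bmf_wt hW A.
have md := measurable_funB mw mc.
rewrite (_ : [set x | _] = (setT `&` (fun x : cubeT R {set T} => x A) @^-1` `[0, +oo[) `&`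
    (setT `&` (fun x => wt W A x - x A) @^-1` `]0, +oo[)).
  by apply: measurableI; [apply: mc|apply: md] => //; exact: measurable_itv.
rewrite !setTI; apply/seteqP; split => x /=; rewrite /eb !in_itv /= !andbT subr_gt0.
  by case/andP.
by case=> -> ->.
Qed.

Lemma bmf_eb (T : finType) (A : {set T}) : bmf (fun x : cubeT R {set T} => (eb A x)%:R : R).
Proof. by apply: bmf_bool; exact: measurable_eb. Qed.

Lemma bmf_Gs (T : finType) (g : {set {set T}} -> R) : bmf (fun x => g (Gs x)).
Proof.
apply: bmf_setval => A; case: (boolP (#|A| == k)) => Ak; last first.
  by rewrite (_ : [set x | _] = set0)//; apply/seteqP; split => x //=; rewrite inE (negbTE Ak).
rewrite (_ : [set x | _] = [set x | eb A x]); first exact: measurable_eb.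
by apply/seteqP; split => x /=; rewrite inE Ak.
Qed.

(** The weight of [A] does not read the coordinate of [A]; integrating this coordinate first turns
    the indicator into the weight. *)
Lemma EE_eb_mix (T : finType) (A : {set T}) (S : pred {set T}) x : S A -> #|A| = k ->
  EE (mu R {set T}) (fun y => (eb A (mix S y x))%:R) = EE (mu R {set T}) (fun y => wt W A (mix S y x)).
Proof.
move=> SA Ak.
rewrite -(EI_mix (pred1 A)); last by apply: (@bmf_mixl _ _ _ (fun x => (eb A x)%:R)); exact: bmf_eb.
congr (EE _ _); apply/funext => y.
have /andP[w0 w1] := wt01 hW A (mix S y x).
rewrite -[RHS]subr0 -(EE_itv A (lexx 0) w0 w1); congr (EE _ _); apply/funext => z.
rewrite /eb; have -> : mix S (mix (pred1 A) z y) x A = z A by rewrite /mix SA /= eqxx.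
congr (_ && (_ < _))%R%:R; apply: wt_local => // B B0 BA; rewrite /mix; case: ifP => // _ /=.
by case: eqP => // BE; move: BA; rewrite BE fintype.properxx.
Qed.

Lemma pb_Gs (T T' : finType) (f : T -> T') (x : cubeT R {set T'}) : injective f ->
  pb f (Gs x) = Gs (fun B : {set T} => x (f @: B)).
Proof.
move=> fI; apply/setP => A; rewrite !inE card_imset//; case: eqP => //= Ak.
by rewrite /eb wt_map.
Qed.

Lemma EE_Gs (T : finType) (E : {set {set T}}) : uniform k E ->
  EE (mu R {set T}) (fun x => (E \subset Gs x)%:R) = tau W E.
Proof.
move=> uE.
transitivity (EE (mu R {set T}) (fun x => 1 * \prod_(A <- enum E) (eb A x)%:R)).
  congr (EE _ _); apply/funext => x; rewrite mul1r big_enum /=.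
  case: (boolP (E \subset Gs x)) => [/fintype.subsetP H|/subsetPn[A AE]].
    by rewrite big1// => A /[dup] AE /H; rewrite inE => /andP[_ ->].
  by rewrite inE uE// eqxx /= => /negbTE nA; rewrite (bigD1 A)//= nA mul0r.
rewrite (EI_blocks (S := @pred1 {set T})) ?enum_uniq//; last 4 first.
- exact: bmf_cst.
- exact: bmf_eb.
- move=> A C x y; rewrite !mem_enum => /uE Ak /uE Ck AC; rewrite /eb.
  have -> : mix (pred1 A) y x C = x C by rewrite /mix /= eq_sym (negbTE AC).
  congr (_ && (_ < _))%R%:R; apply: wt_local => // B B0 BC; rewrite /mix /=.
  by case: eqP => // BE; move: (proper_card BC); rewrite BE Ak Ck ltnn.
- move=> A C B _ _ AC; apply/negP => /andP[/eqP -> /eqP CA]; by rewrite CA eqxx in AC.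
rewrite /tau; congr (EE _ _); apply/funext => x; rewrite mul1r big_enum /=; apply: eq_bigr => A AE.
rewrite EE_eb_mix ?uE//=; transitivity (EE (mu R {set T}) (fun=> wt W A x)); last exact: EE_cst.
congr (EE _ _); apply/funext => y; apply: wt_local => //; first exact: uE.
move=> B B0 BA; rewrite /mix /=; by case: eqP => // BE; move: BA; rewrite BE fintype.properxx.
Qed.

Lemma tau01 (T : finType) (E : {set {set T}}) : 0 <= tau W E <= 1.
Proof.
have bp : bmf (fun x : cubeT R {set T} => \prod_(A in E) wt W A x).
  by apply: bmf_prod => A _; exact: bmf_wt.
have w01 A x := wt01 hW (T := T) A x.
apply/andP; split.
  by apply: EE_ge0 => x; apply: prodr_ge0 => A _; case/andP: (w01 A x).
rewrite -[leRHS](EE_cst (mu R {set T})); apply: EE_le => // [|x]; first exact: bmf_cst.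
by apply: prodr_ile1 => A _; exact: w01.
Qed.

(** For an injective map the expectation is [tau W E] exactly; the remaining maps form a proportion
    of at most t^2/n, each with an error of at most 1. *)
Lemma EE_mavg_Gs n (T : finType) (E : {set {set T}}) : (0 < n)%N -> uniform k E ->
  `|EE (mu R {set 'I_n}) (fun x => mavg (Gs x) (fun H => (E \subset H)%:R)) - tau W E| <=
  (#|T| * #|T|)%:R / n%:R.
Proof.
move=> n0 uE; set t := #|T|.
have N0 : (n ^ t)%:R != 0 :> R by rewrite pnatr_eq0 expn_eq0 negb_and -lt0n n0.
have bE (f : {ffun T -> 'I_n}) : bmf (fun x : cubeT R {set 'I_n} => (E \subset pb f (Gs x))%:R : R).
  exact: (bmf_Gs (fun H => (E \subset pb f H)%:R)).
have -> : EE (mu R {set 'I_n}) (fun x => mavg (Gs x) (fun H => (E \subset H)%:R)) =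
    (\sum_(f : {ffun T -> 'I_n}) EE (mu R {set 'I_n}) (fun x => (E \subset pb f (Gs x))%:R)) / (n ^ t)%:R.
  rewrite -EE_sum// mulrC -EEZ; last exact: bmf_sum.
  by congr (EE _ _); apply/funext => x; rewrite mulrC.
have Ef (f : {ffun T -> 'I_n}) : injectiveb f ->
    EE (mu R {set 'I_n}) (fun x => (E \subset pb f (Gs x))%:R) = tau W E.
  move=> /injectiveP fI; rewrite -(tau_imset hW fI uE) -EE_Gs.
    congr (EE _ _); apply/funext => x; congr (_%:R); congr nat_of_bool.
    apply/fintype.subsetP/fintype.subsetP => EH A.
      by case/imsetP => B BE ->; have := EH _ BE; rewrite inE.
    by move=> AE; rewrite inE; apply: EH; exact: imset_f.
  by move=> _ /imsetP[A AE ->]; rewrite card_imset// uE.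
have tauE : tau W E = (\sum_(f : {ffun T -> 'I_n}) tau W E) / (n ^ t)%:R.
  by rewrite sumr_const card_ffun card_ord -[_ *+ _]mulr_natr mulfK.
rewrite {1}tauE -mulrBl -sumrB normrM (ger0_norm (x := (n ^ t)%:R^-1)) ?invr_ge0//.
have := ffact_ratio R 0 t n0; rewrite subn0 add0n => /andP[+ _].
rewrite -/t; set B := _ / n%:R => HB.
suff : `|\sum_(f : {ffun T -> 'I_n}) (EE (mu R {set 'I_n}) (fun x => (E \subset pb f (Gs x))%:R) - tau W E)| <=
    (n ^ t)%:R - (n ^_ t)%:R.
  move=> H; apply: (@le_trans _ _ (((n ^ t)%:R - (n ^_ t)%:R) / (n ^ t)%:R)).
    by rewrite ler_wpM2r ?invr_ge0.
  by rewrite mulrBl divff//; lra.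
apply: le_trans (ler_norm_sum _ _ _) _.
apply: (@le_trans _ _ (\sum_(f : {ffun T -> 'I_n}) (1 - (injectiveb f)%:R))).
  apply: ler_sum => f _; case: (boolP (injectiveb f)) => [/Ef ->|_]; first by rewrite !subrr normr0.
  rewrite subr0 ler_norml.
  have := tau01 E; have := EE_ge0 (mu R {set 'I_n}) (f := fun x => (E \subset pb f (Gs x))%:R) (fun=> ler0n _ _).
  have : EE (mu R {set 'I_n}) (fun x => (E \subset pb f (Gs x))%:R) <= 1.
    rewrite -[leRHS](EE_cst (mu R {set 'I_n})); apply: EE_le => // [|x]; first exact: bmf_cst.
    by rewrite lern1; case: (_ \subset _).
  by lra.
rewrite sumrB sumr_const card_ffun card_ord lerD2l lerN2 -natr_sum ler_nat.
by rewrite -[X in (X ^_ _)%N]card_ord -card_inj_ffuns -sum1dep_card big_mkcond /=; apply: leq_sum => f _; case: injectiveb.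
Qed.

(** The square of the density is the density of two disjoint copies, on [2t] vertices, whose
    expectation is within (2t)^2/n of the squared limit. The cross term adds 2t^2/n, whence the
    6. *)
Lemma EE_mavg_variance n (T : finType) (E : {set {set T}}) : (0 < n)%N -> (0 < k)%N -> uniform k E ->
  EE (mu R {set 'I_n}) (fun x => (mavg (Gs x) (fun H => (E \subset H)%:R) - tau W E) ^+ 2) <=
  6 * (#|T| * #|T|)%:R / n%:R.
Proof.
move=> n0 k0 uE; set t := #|T|; pose X (x : cubeT R {set 'I_n}) : R := mavg (Gs x) (fun H => (E \subset H)%:R).
have bX : bmf X by exact: (bmf_Gs (fun H => mavg H (fun H' => (E \subset H')%:R))).
set p := tau W E.
have uE2 : uniform k (inlE T E :|: inrE T E).
  by move=> A; rewrite inE => /orP[] /imsetP[B BE ->]; rewrite card_imset ?uE// => ? ? [].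
have H1 := EE_mavg_Gs n0 uE; have H2 := EE_mavg_Gs n0 uE2.
rewrite tau_disjoint// in H2; rewrite -/p -/t -/X in H1; move: H2.
rewrite (_ : (fun x => mavg _ _) = fun x => X x ^+ 2); last first.
  by apply/funext => x; rewrite mavg_disjoint.
rewrite -/p card_sum -/t => H2.
have b2 := bmfX 2 bX.
have -> : EE (mu R {set 'I_n}) (fun x => (X x - p) ^+ 2) =
    EE (mu R {set 'I_n}) (fun x => X x ^+ 2) - 2 * p * EE (mu R {set 'I_n}) X + p ^+ 2.
  transitivity (EE (mu R {set 'I_n}) (fun x => (X x ^+ 2 + (- (2 * p)) * X x) + p ^+ 2)).
    by congr (EE _ _); apply/funext => x; ring.
  have bZ := bmfZ (- (2 * p)) bX.
  rewrite EED; [|exact: bmfD|exact: bmf_cst]; rewrite EED// EEZ// EE_cst; ring.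
have -> : 6 * (t * t)%:R / n%:R = ((t + t) * (t + t))%:R / n%:R + 2 * ((t * t)%:R / n%:R) :> R.
  by rewrite !natrM !natrD; field; rewrite pnatr_eq0 -lt0n.
move: H1 H2; rewrite !ler_norml => /andP[H1 H1'] /andP[H2 H2'].
have /andP[p0 p1] := tau01 E; rewrite -/p in p0 p1.
set e := EE _ X in H1 H1' *; set e2 := EE _ _ in H2 H2' *; set D := (t * t)%:R / n%:R in H1 H1' *.
set D2 := _ / _ in H2 H2' *.
have D0 : 0 <= D by rewrite divr_ge0.
have : p * (p - e) <= D.
  by apply: le_trans (ler_wpM2l p0 (_ : _ <= D)) _; [lra|rewrite ler_piMl].
nra.
Qed.

End sampling.

(** The left side is the mean of exp(la(a - X)) for an indicator X of probability [theta]. It is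
    bounded through exp(-la) <= 1/(1 + la) and 1 - x <= exp(-x); [la] is small enough that theta/(1
    + la) still exceeds [a], which makes [c] positive. *)
Lemma chernoff_rate (R : realType) (a theta : R) : 0 < a < theta -> theta <= 1 ->
  exists la c : R, [/\ 0 < la, 0 < c &
    expR (la * a) + (expR (la * (a - 1)) - expR (la * a)) * theta <= expR (- c)].
Proof.
move=> /andP[a0 at_] t1; pose la := (theta - a) / 2.
have la0 : 0 < la by rewrite divr_gt0// subr_gt0.
have la1 : 0 < 1 + la by rewrite addr_gt0.
have key : a < theta / (1 + la) by rewrite ltr_pdivlMr// /la; nra.
exists la, (la * (theta / (1 + la) - a)); split => //; first by rewrite mulr_gt0// subr_gt0.
have e1 : expR (- la) <= (1 + la)^-1.
  by rewrite expRN lef_pV2 ?posrE ?expR_gt0//; exact: expR_ge1Dx.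
have -> : expR (la * (a - 1)) = expR (la * a) * expR (- la).
  by rewrite -expRD; congr expR; ring.
apply: (@le_trans _ _ (expR (la * a) * (1 - theta * (1 - (1 + la)^-1)))).
  have -> : expR (la * a) + (expR (la * a) * expR (- la) - expR (la * a)) * theta =
    expR (la * a) * (1 - theta * (1 - expR (- la))) by ring.
  rewrite ler_pM2l ?expR_gt0//; nra.
apply: (@le_trans _ _ (expR (la * a) * expR (- (theta * (1 - (1 + la)^-1))))).
  by rewrite ler_pM2l ?expR_gt0// expR_ge1Dx.
rewrite -expRD le_eqVlt; apply/orP; left; apply/eqP; congr expR; field.
by rewrite gt_eqF.
Qed.

(** * Lower tails of the sampled degree *)

Section tails.
Context (R : realType) (k l : nat) (lk : (l < k)%N) (B : finType) (W : cubeT R (rlt k) -> R).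
Hypothesis hW : hyperB W.
Local Notation T := ('I_l + B * 'I_(k - l))%type.

Definition bdeg (x : cubeT R {set T}) : R := degB W (fun C : rle k l => x (body_map B lk C)).

Lemma bmf_bdeg : bmf bdeg.
Proof.
apply: (@bmf_comp _ _ _ _ _ (degB (l := l) W)); first exact: measurable_reindex.
by apply: bmf_degB; exact: hyperB_bmf.
Qed.

Lemma bdeg01 x : 0 <= bdeg x <= 1. Proof. exact: degB01. Qed.

Lemma bdeg_mix b (x y : cubeT R {set T}) : bdeg (mix (arm_block lk b) y x) = bdeg x.
Proof.
congr (degB W _); apply/funext => C; rewrite /mix ifF//; apply/negbTE/negP => /andP[_ /negP]; apply.
by apply: imsetS; exact: finset.subsetT.
Qed.

Lemma arm_block_arm b : arm_block lk b (arm lk b : {set T}).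
Proof.
rewrite /arm_block fintype.subxx /=; apply/subsetPn.
have d0 : (0 < k - l)%N by rewrite subn_gt0.
by exists (inr (b, Ordinal d0)); rewrite ?armP ?bodyP.
Qed.

Lemma arm_blockNarm b b' : b != b' -> arm_block lk b (arm lk b' : {set T}) = false.
Proof.
move=> bb'; have := arm_block_disjoint lk (arm lk b') bb'.
by rewrite arm_block_arm andbT => /negbTE.
Qed.

Lemma EE_eb_arm b (x : cubeT R {set T}) :
  EE (mu R {set T}) (fun y => (eb W (arm lk b) (mix (arm_block lk b) y x))%:R) = bdeg x.
Proof.
by rewrite EE_eb_mix//; [exact: EE_arm|exact: arm_block_arm|exact: card_arm].
Qed.

Lemma bmf_bdeg_eq0 : bmf (fun x => (bdeg x == 0)%:R : R).
Proof.
have [mD _] := bmf_bdeg; apply: bmf_bool.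
rewrite (_ : [set x | _] = setT `&` bdeg @^-1` [set 0]); first by apply: mD => //; exact: measurable_set1.
by rewrite setTI; apply/seteqP; split => x /= /eqP.
Qed.

(** Given the body, an arm is an edge with probability [bdeg]. Where this vanishes, the sampled set
    almost surely has degree 0 rather than a small positive degree. *)
Lemma EE_bdeg_eq0 b : EE (mu R {set T}) (fun x => (bdeg x == 0)%:R * (eb W (arm lk b) x)%:R) = 0.
Proof.
have b0 := bmf_bdeg_eq0; have be := bmf_eb hW (arm lk b).
rewrite -(EI_mix (arm_block lk b)); last exact: bmfM.
transitivity (EE (mu R {set T}) (fun=> 0)); last exact: EE_cst.
congr (EE _ _); apply/funext => x.
transitivity (EE (mu R {set T}) (fun y => (bdeg x == 0)%:R * (eb W (arm lk b) (mix (arm_block lk b) y x))%:R)).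
  by congr (EE _ _); apply/funext => y; rewrite bdeg_mix.
rewrite EEZ; last by apply: (@bmf_mixl _ _ _ (fun x => (eb W (arm lk b) x)%:R)).
by rewrite EE_eb_arm; case: eqP => [->|_]; rewrite ?mulr0 ?mul0r.
Qed.

Lemma EE_bdeg_small (theta : R) : mu R (rle k l) [set x | 0 < degB W x < theta] = 0%E ->
  bmf (fun x => (0 < bdeg x < theta)%R%:R : R) /\
  EE (mu R {set T}) (fun x => (0 < bdeg x < theta)%R%:R) = 0.
Proof.
move=> H; have bd : bmf (degB (l := l) W) by apply: bmf_degB; exact: hyperB_bmf.
have [mD _] := bd.
have mS : measurable [set x : cubeT R (rle k l) | 0 < degB W x < theta].
  rewrite (_ : [set x | _] = setT `&` degB W @^-1` `]0, theta[); first by apply: mD => //; exact: measurable_itv.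
  by rewrite setTI; apply/seteqP; split => x /=; rewrite in_itv.
have bS : bmf (fun x : cubeT R (rle k l) => (0 < degB W x < theta)%R%:R : R) by exact: bmf_bool.
split.
  apply: (@bmf_comp _ _ _ _ _ (fun x : cubeT R (rle k l) => (0 < degB W x < theta)%R%:R)) bS.
  exact: measurable_reindex.
have E0 := EI_reindex (@body_map_inj k l B lk) bS.
by apply: etrans E0 _; have := EE_bool (mu R (rle k l)) mS; rewrite H => -[].
Qed.

(** Exponential Markov inequality. Given the body the arms are independent, so the expectation of
    the product is a power of the one-arm factor, which is at most exp(-c) as soon as [bdeg] reaches
    [theta]. *)
Lemma EE_chernoff (theta a la c : R) :
  mu R (rle k l) [set x | 0 < degB W x < theta] = 0%E ->
  0 < la -> expR (la * a) + (expR (la * (a - 1)) - expR (la * a)) * theta <= expR (- c) ->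
  EE (mu R {set T}) (fun x => (bdeg x != 0)%:R *
    (\sum_b (eb W (arm lk b) x)%:R < a * #|B|%:R)%R%:R) <= expR (- c) ^+ #|B|.
Proof.
move=> /EE_bdeg_small[bS S0] la0 rate.
set c0 := expR (la * a) in rate *; set c1 := expR (la * (a - 1)) in rate *.
have c10 : c1 <= c0 by rewrite ler_expR ler_pM2l//; lra.
have c1p : 0 < c1 := expR_gt0 _.
pose u b (x : cubeT R {set T}) : R := c0 + (c1 - c0) * (eb W (arm lk b) x)%:R.
pose h (x : cubeT R {set T}) : R := (bdeg x != 0)%:R.
have be b := bmf_eb hW (arm lk b : {set T}).
have bh : bmf h.
  apply: (@eq_bmf _ _ _ (fun x => 1 - (bdeg x == 0)%:R)).
    by move=> x; rewrite /h; case: eqP; rewrite ?subrr ?subr0.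
  by apply: bmfB; [exact: bmf_cst|exact: bmf_bdeg_eq0].
have bu b : bmf (u b) by apply: bmfD; [exact: bmf_cst|exact: bmfZ].
have uE b x : u b x = expR (la * (a - (eb W (arm lk b) x)%:R)).
  rewrite /u; case: eb; last by rewrite mulr0 addr0 subr0.
  by rewrite mulr1 addrC subrK.
have bP : bmf (fun x => \prod_(b <- enum B) u b x) by apply: bmf_prod => b _; exact: bu.
have bI : bmf (fun x : cubeT R {set T} => (\sum_b (eb W (arm lk b) x)%:R < a * #|B|%:R)%R%:R : R).
  have [mS _] : bmf (fun x : cubeT R {set T} => \sum_b (eb W (arm lk b) x)%:R : R) by apply: bmf_sum.
  apply: bmf_bool; rewrite (_ : [set x | _] = setT `&`
    (fun x : cubeT R {set T} => \sum_b (eb W (arm lk b) x)%:R) @^-1` `]-oo, (a * #|B|%:R)[).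
    by apply: mS => //; exact: measurable_itv.
  by rewrite setTI; apply/seteqP; split => x /=; rewrite in_itv.
apply: (@le_trans _ _ (EE (mu R {set T}) (fun x => h x * \prod_(b <- enum B) u b x))).
  apply: EE_le => [||x]; [exact: bmfM|exact: bmfM|rewrite ler_wpM2l//].
  rewrite big_enum /= (eq_bigr _ (fun b _ => uE b x)) -expR_sum -mulr_sumr sumrB sumr_const.
  rewrite mulr_natr; case: ltP => H /=; last exact: expR_ge0.
  by rewrite -[leLHS]expR0 ler_expR mulr_ge0 ?subr_ge0//; exact: ltW.
rewrite (EI_blocks (S := arm_block lk)) ?enum_uniq//; last 3 first.
- by move=> b x y _; rewrite /h bdeg_mix.
- move=> b b' x y _ _ bb'; rewrite /u /eb wt_arm_local//.
  by have -> : mix (arm_block lk b) y x (arm lk b') = x (arm lk b') by rewrite /mix arm_blockNarm.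
- by move=> b b' C _ _; exact: arm_block_disjoint.
have Eu b x : EE (mu R {set T}) (fun y => u b (mix (arm_block lk b) y x)) = c0 + (c1 - c0) * bdeg x.
  have bm : bmf (fun y : cubeT R {set T} => (eb W (arm lk b) (mix (arm_block lk b) y x))%:R : R).
    by apply: (@bmf_mixl _ _ _ (fun x => (eb W (arm lk b) x)%:R)).
  by rewrite /u EED; [rewrite EE_cst EEZ// EE_eb_arm|exact: bmf_cst|exact: bmfZ].
have bF : bmf (fun x => (c0 + (c1 - c0) * bdeg x) ^+ #|B|).
  by apply: bmfX; apply: bmfD; [exact: bmf_cst|apply: bmfZ; exact: bmf_bdeg].
rewrite (_ : (fun x => _) = fun x => h x * (c0 + (c1 - c0) * bdeg x) ^+ #|B|); last first.
  by apply/funext => x; rewrite big_enum /= (eq_bigr _ (fun b _ => Eu b x)) prodr_const.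
(* The added term has expectation 0 and covers the degrees in ]0, theta[, which makes the comparison
   valid at every point. *)
have -> : expR (- c) ^+ #|B| =
    EE (mu R {set T}) (fun x => expR (- c) ^+ #|B| + c0 ^+ #|B| * (0 < bdeg x < theta)%R%:R).
  rewrite EED; [|exact: bmf_cst|exact: bmfZ].
  by rewrite EEZ// S0 mulr0 addr0 EE_cst.
apply: EE_le => [||x]; [exact: bmfM|by apply: bmfD; [exact: bmf_cst|exact: bmfZ]|].
have /andP[d0 d1] := bdeg01 x.
have f1 : c1 <= c0 + (c1 - c0) * bdeg x by nra.
have f0 : c0 + (c1 - c0) * bdeg x <= c0 by nra.
have c0p : 0 < c0 := expR_gt0 _.
rewrite /h; case: eqP => [_|/eqP D0] /=; first by rewrite mul0r addr_ge0// ?mulr_ge0// ?exprn_ge0// ltW// expR_gt0.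
have Dp : 0 < bdeg x by rewrite lt_neqAle eq_sym D0.
rewrite mul1r Dp /=; case: ltP => Dt /=.
  rewrite mulr1; apply: (@le_trans _ _ (c0 ^+ #|B|)); last by rewrite lerDr exprn_ge0// expR_ge0.
  by apply: lerXn2r => //; rewrite nnegrE; [exact: le_trans (ltW c1p) f1|exact: ltW].
rewrite mulr0 addr0; apply: lerXn2r; rewrite ?nnegrE ?expR_ge0//; first exact: le_trans (ltW c1p) f1.
by apply: le_trans rate; rewrite lerD2l ler_wnM2l// subr_le0.
Qed.

End tails.

Lemma perm_map (V : finType) (s s' : seq V) : uniq s -> uniq s' -> size s = size s' ->
  exists p : {perm V}, map p s = s'.
Proof.
elim/last_ind: s s' => [|s x IH] s'; first by case: s' => // _ _ _; exists 1%g.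
case/lastP: s' => [|s' y]; first by rewrite size_rcons.
rewrite !rcons_uniq !size_rcons => /andP[xs us] /andP[ys us'] [ss].
have [p ps] := IH _ us us' ss.
exists (p * tperm (p x) y)%g; rewrite map_rcons permM tpermL; congr rcons.
rewrite -ps; apply/eq_in_map => z zs; rewrite permM tpermD//.
  by rewrite (inj_eq perm_inj); apply: contraNneq xs => ->.
by apply: contraNneq ys => ->; rewrite -ps map_f.
Qed.

(** * Placements of the arms around a fixed set *)

Section arm_placements.
Context (k l : nat) (lk : (l < k)%N) (B V : finType) (iota : 'I_l -> V).
Local Notation T := ('I_l + B * 'I_(k - l))%type.
Hypothesis cV : #|V| = #|{: T}|.
Hypothesis iotaI : injective iota.
Local Notation L := (iota @: [set: 'I_l]%SET).

(** Since [V] has exactly as many elements as the configuration, these are the bijections that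
    extend [iota]. *)
Definition placements : {set {ffun T -> V}} :=
  [set s : {ffun T -> V} | injectiveb s && [forall a, s (inl a) == iota a]]%SET.

Lemma placementP (s : {ffun T -> V}) : reflect (injective s /\ forall a, s (inl a) = iota a) (s \in placements).
Proof.
rewrite inE; apply: (iffP andP) => [[/injectiveP sI /forallP H]|[sI H]].
  by split => // a; exact/eqP.
by split; [exact/injectiveP|apply/forallP => a; apply/eqP].
Qed.

Lemma placements_gt0 : (0 < #|placements|)%N.
Proof.
pose f0 (t : T) : V := enum_val (cast_ord (esym cV) (enum_rank t)).
have f0I : injective f0 by move=> t t' /enum_val_inj /cast_ord_inj /enum_rank_inj.
have lI : injective (@inl 'I_l (B * 'I_(k - l))) by move=> ? ? [].
have [|||p pE] := @perm_map V (map (f0 \o inl) (enum 'I_l)) (map iota (enum 'I_l)).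
- by rewrite map_inj_uniq ?enum_uniq//; exact: inj_comp.
- by rewrite map_inj_uniq ?enum_uniq.
- by rewrite !size_map.
apply/card_gt0P; exists [ffun t => p (f0 t)]; apply/placementP; split.
  by move=> t t'; rewrite !ffunE => /perm_inj /f0I.
move=> a; rewrite ffunE; move: pE; rewrite -map_comp => /eq_in_map/(_ a) pE.
by apply: pE; rewrite mem_enum.
Qed.

Definition nplace b (A : {set V}) : nat := #|[set s in placements | s @: arm lk b == A]%SET|.

Lemma card_body_image : #|L| = l.
Proof. by rewrite card_imset// cardsT card_ord. Qed.

(** A permutation of [V] that fixes [L] pointwise and maps [A] onto [A'] carries placements to
    placements. *)
Lemma nplace_le b (A A' : {set V}) : #|A| = k -> #|A'| = k -> L \subset A -> L \subset A' ->
  (nplace b A <= nplace b A')%N.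
Proof.
move=> Ak A'k LA LA'.
have uD (C : {set V}) : uniq (enum L ++ enum (C :\: L)%SET).
  rewrite cat_uniq !enum_uniq /= andbT -all_predC; apply/allP => x.
  by rewrite mem_enum inE /= mem_enum => /andP[].
have sD (C : {set V}) : L \subset C -> size (enum L ++ enum (C :\: L)%SET) = #|C|.
  by move=> LC; rewrite size_cat -!cardE cardsD (finset.setIidPr LC) subnKC// subset_leq_card.
have [|p] := perm_map (uD A) (uD A') _; first by rewrite !sD// Ak A'k.
rewrite map_cat => /eqP; rewrite eqseq_cat ?size_map// => /andP[/eqP pL /eqP pD].
have fixL x : x \in L -> p x = x.
  move=> xL; have : map p (enum L) = map id (enum L) by rewrite pL map_id.
  by move/eq_in_map => ->//; rewrite mem_enum.
have pA : p @: A = A'.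
  apply/eqP; rewrite eqEcard card_imset ?Ak ?A'k ?leqnn ?andbT; last exact: perm_inj.
  apply/fintype.subsetP => _ /imsetP[x xA ->].
  have [xL|xL] := boolP (x \in L); first by rewrite fixL// (fintype.subsetP LA').
  have : p x \in map p (enum (A :\: L)%SET) by rewrite map_f// mem_enum inE xL.
  by rewrite pD mem_enum inE => /andP[].
pose c (s : {ffun T -> V}) : {ffun T -> V} := [ffun t => p (s t)].
have cI : injective c by move=> s s' /ffunP H; apply/ffunP => t; have := H t; rewrite !ffunE => /perm_inj.
rewrite /nplace -(card_imset _ cI); apply: subset_leq_card.
apply/fintype.subsetP => _ /imsetP[s + ->]; rewrite inE => /andP[/placementP[sI sL] /eqP sA].
rewrite inE; apply/andP; split.
  apply/placementP; split; first by move=> t t'; rewrite !ffunE => /perm_inj /sI.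
  by move=> a; rewrite ffunE sL fixL// imset_f.
by apply/eqP; rewrite -pA -sA -(imset_comp p s); apply: eq_imset => t; rewrite /= ffunE.
Qed.

Lemma nplace_eq b (A A' : {set V}) : #|A| = k -> #|A'| = k -> L \subset A -> L \subset A' ->
  nplace b A = nplace b A'.
Proof. by move=> *; apply/eqP; rewrite eqn_leq !nplace_le. Qed.

Lemma body_image_sub b (s : {ffun T -> V}) : s \in placements -> L \subset s @: arm lk b.
Proof.
move=> /placementP[_ sL]; apply/fintype.subsetP => _ /imsetP[a _ ->].
by rewrite -sL imset_f// armP.
Qed.

Lemma sum_placements b (A0 : {set V}) (H : {set {set V}}) : uniform k H -> #|A0| = k -> L \subset A0 ->
  (\sum_(s in placements) (s @: arm lk b \in H) = nplace b A0 * \sum_(A in H | L \subset A) 1)%N.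
Proof.
move=> uH A0k LA0; rewrite big_distrr /=.
transitivity (\sum_(s in placements) \sum_(A in H | L \subset A) (s @: arm lk b == A))%N.
  apply: eq_bigr => s sP; have [sH|sH] := boolP (_ \in H).
    rewrite (bigD1 (s @: arm lk b)) /= ?sH ?body_image_sub// eqxx big1 ?addn0// => A /andP[_ /negbTE].
    by rewrite eq_sym => ->.
  by rewrite big1// => A /andP[AH _]; apply/eqP; rewrite eqb0; apply: contraNneq sH => ->.
rewrite exchange_big /=; apply: eq_bigr => A /andP[AH LA]; rewrite muln1.
rewrite (nplace_eq b A0k (uH _ AH) LA0 LA) /nplace -sum1dep_card [RHS]big_mkcond [LHS]big_mkcond /=.
by apply: eq_bigr => s _; case: (_ \in placements) => //=; case: eqP.
Qed.

Definition oversets : nat := (\sum_(A : {set V} | (#|A| == k) && (L \subset A)) 1)%N.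

(** An arm of a random placement is uniform among the [k]-sets over [L]. The common number of
    placements per [k]-set is eliminated by applying the same count to the system of all
    [k]-sets. *)
Lemma sum_placements_oversets b (H : {set {set V}}) : uniform k H ->
  ((\sum_(s in placements) (s @: arm lk b \in H)) * oversets =
   #|placements| * \sum_(A in H | L \subset A) 1)%N.
Proof.
move=> uH; have /card_gt0P[s0 s0P] := placements_gt0; pose A0 := s0 @: arm lk b.
have [sI0 _] := placementP _ s0P.
have A0k : #|A0| = k by rewrite card_imset// card_arm.
have LA0 : L \subset A0 by exact: body_image_sub.
rewrite (sum_placements b uH A0k LA0).
pose Hk : {set {set V}} := [set A : {set V} | #|A| == k]%SET.
have uHk : uniform k Hk by move=> A; rewrite inE => /eqP.
have := sum_placements b uHk A0k LA0.
rewrite (eq_bigr (fun=> 1%N)); last first.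
  by move=> s /placementP[sI _]; rewrite inE card_imset// card_arm eqxx.
rewrite sum1_card => ->.
have -> : (\sum_(A in Hk | L \subset A) 1)%N = oversets by apply: eq_bigl => A; rewrite inE.
by rewrite mulnAC.
Qed.

Lemma bin_oversets : ('C(#|V| - l, k - l) <= oversets)%N.
Proof.
rewrite /oversets sum1dep_card.
have <- : #|(~: L)%SET| = (#|V| - l)%N by rewrite -(cardsC L) card_body_image addKn.
rewrite -cards_draws.
have UI : {in [set M : {set V} | (M \subset ~: L) && (#|M| == (k - l)%N)]%SET &,
    injective (fun M : {set V} => (L :|: M)%SET)}.
  have E (M : {set V}) : (M \subset ~: L)%SET -> ((L :|: M) :\: L = M)%SET.
    move=> /fintype.subsetP ML; apply/setP => x; rewrite !inE.
    by case: (boolP (x \in M)) => [/ML|]; rewrite ?inE ?orbT ?orbF; [move=> ->|case: (x \in L)].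
  move=> M M'; rewrite !inE => /andP[ML _] /andP[ML' _] EM.
  by rewrite -(E M ML) EM E.
rewrite -(card_in_imset UI); apply: subset_leq_card; apply/fintype.subsetP => _ /imsetP[M + ->].
rewrite !inE => /andP[ML /eqP Mk]; rewrite finset.subsetUl andbT cardsU card_body_image Mk.
have -> : (L :&: M)%SET = finset.set0.
  apply/setP => x; rewrite !inE; apply/negbTE/negP => /andP[xL /(fintype.subsetP ML)].
  by rewrite inE xL.
by rewrite cards0 subn0 subnKC// ltnW.
Qed.

Lemma placement_exists b (A : {set V}) : #|A| = k -> L \subset A ->
  exists2 s : {ffun T -> V}, s \in placements & s @: arm lk b = A.
Proof.
move=> Ak LA; have /card_gt0P[s0 s0P] := placements_gt0; have [sI0 _] := placementP _ s0P.
have : (0 < nplace b A)%N.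
  have A0k : #|s0 @: arm lk b| = k by rewrite card_imset// card_arm.
  rewrite (nplace_eq b Ak A0k LA (body_image_sub b s0P)).
  by apply/card_gt0P; exists s0; rewrite inE s0P eqxx.
by case/card_gt0P => s; rewrite inE => /andP[sP /eqP <-]; exists s.
Qed.

(* Over the placements of the arms around [L], the proportion of arms landing in [H] has
   the relative degree of [L] as its mean, so by Markov's inequality a low degree of [L]
   makes many placements have few arms in [H]. *)
Lemma low_degree_placements (R : realType) (a u : R) (H : {set {set V}}) :
  uniform k H -> (0 < #|B|)%N -> 0 < a <= 1 -> (k <= #|V|)%N ->
  (\sum_(A in H | L \subset A) 1)%:R < u * ('C(#|V| - l, k - l))%:R ->
  (a - u) * #|placements|%:R <=
  \sum_(s in placements) ((\sum_b (s @: arm lk b \in H)%:R < a * #|B|%:R :> R)%R : bool)%:R.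
Proof.
move=> uH B0 /andP[a0 a1] kV; set K := (\sum_(A in H | _) 1)%N => Ku.
set P := #|placements|%:R : R; set Bad := \sum_(s in placements) _.
have C0 : 0 < ('C(#|V| - l, k - l))%:R :> R by rewrite ltr0n bin_gt0 leq_sub2r.
have MC : ('C(#|V| - l, k - l))%:R <= oversets%:R :> R by rewrite ler_nat bin_oversets.
have u0 : 0 < u by rewrite -(pmulr_lgt0 _ C0); apply: le_lt_trans Ku.
have KM : K%:R <= u * oversets%:R by apply: ltW; apply: (lt_le_trans Ku); rewrite ler_pM2l.
have M0 : 0 < oversets%:R :> R by exact: lt_le_trans MC.
pose q : R := #|B|%:R; have q0 : 0 < q by rewrite ltr0n.
have S1 : \sum_(s in placements) \sum_b (s @: arm lk b \in H)%:R <= u * P * q.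
  rewrite exchange_big /= -(ler_pM2r M0) mulr_suml.
  apply: (@le_trans _ _ (\sum_(b : B) P * K%:R)).
    apply: ler_sum => b _; rewrite -natr_sum -natrM sum_placements_oversets// natrM//.
  rewrite sumr_const -[_ *+ _]mulr_natr -/q (_ : u * P * q * _ = P * (u * oversets%:R) * q); last by ring.
  by rewrite ler_pM2r// ler_wpM2l.
have S2 : (P - Bad) * (a * q) <= \sum_(s in placements) \sum_b (s @: arm lk b \in H)%:R.
  rewrite /P -sum1_card natr_sum /Bad -sumrB mulr_suml; apply: ler_sum => s _.
  case: ltP => H1 /=; first by rewrite subrr mul0r sumr_ge0.
  by rewrite subr0 mul1r.
have Bad0 : 0 <= Bad by apply: sumr_ge0.
have : (P - Bad) * a <= u * P by rewrite -(ler_pM2r q0) -mulrA; exact: le_trans S1.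
nra.
Qed.

End arm_placements.

Lemma kdelta_ge (R : realType) k l (G : kgraph k) (r : R) : (l <= k)%N -> kE G != finset.set0 ->
  (forall L : {set 'I_(kv G)}, #|L| = l -> kdeg L != 0%N -> r <= (kdeg L)%:R) ->
  r <= (kdelta l G)%:R.
Proof.
move=> lk /set0Pn[A AE] H.
have sA : size (take l (enum A)) = l by rewrite size_takel// -cardE (card_kE AE).
pose L0 : {set 'I_(kv G)} := [set x in take l (enum A)]%SET.
have P0 : (#|L0| == l) && (kdeg L0 != 0%N).
  rewrite cardsE (card_uniqP _) ?take_uniq ?enum_uniq// sA eqxx /= kdegE (bigD1 A)//= AE /=.
  by apply/fintype.subsetP => x; rewrite inE => /mem_take; rewrite mem_enum.
case: (@arg_minnP _ L0 (fun L => (#|L| == l) && (kdeg L != 0%N)) (@kdeg k G) P0) => L /andP[/eqP Ll dL] Lmin.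
apply: le_trans (H L Ll dL) _; rewrite ler_nat.
have LE : (kdeg L < #|kE G|.+1)%N.
  rewrite ltnS kdegE -sum1_card [leqRHS](bigID (fun A : {set 'I_(kv G)} => L \subset A))/=.
  exact: leq_addr.
apply: (@leq_bigmax_cond _ _ (fun m : 'I_#|kE G|.+1 => m : nat) (Ordinal LE)).
apply/forallP => L'; apply/implyP => /eqP L'l; case: eqP => //= /eqP d'.
by apply: Lmin; rewrite L'l eqxx.
Qed.

Lemma exists_lt_EE (R : realType) d (X : measurableType d) (P : probability X R) (f : X -> R) c :
  bmf f -> EE P f < c -> exists x, f x < c.
Proof.
move=> bf fc; apply: contrapT => /forallNP nx.
have : c <= EE P f; last by rewrite leNgt fc.
rewrite -[leLHS](EE_cst P); apply: EE_le => // [|x]; first exact: bmf_cst.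
by rewrite leNgt; exact/negP.
Qed.

Lemma half_below (R : realType) (theta e : R) : 0 < e -> e < theta -> theta <= 1 ->
  0 < theta - e / 2 <= 1.
Proof. by move=> *; apply/andP; split; lra. Qed.

(** * Failure probability for one set *)

Section degree_sampling.
Context (R : realType) (k l : nat) (lk : (l < k)%N) (W : cubeT R (rlt k) -> R).
Hypothesis hW : hyperB W.
Local Notation d := (k - l)%N.
Variables (theta e : R).
Hypothesis e0 : 0 < e.
Hypothesis theta1 : theta <= 1.
Hypothesis Wdeg : mu R (rle k l) [set x | 0 < degB W x < theta] = 0%E.

Definition degH n (H : {set {set 'I_n}}) (L : {set 'I_n}) : nat := (\sum_(A in H | L \subset A) 1)%N.

(** If the conditional degree is non-zero, a low degree forces a proportion of at least e/2 of the
    placements to have few arms in the sample; Markov's inequality gives the factor 2/e and the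
    Chernoff bound controls each placement. If it is zero, a positive degree has probability 0. *)
Lemma EE_low_degree (la c : R) q (iota : 'I_l -> 'I_(l + q * d)) : (0 < q)%N -> injective iota ->
  e < theta -> 0 < la ->
  expR (la * (theta - e / 2)) + (expR (la * ((theta - e / 2) - 1)) - expR (la * (theta - e / 2))) * theta
    <= expR (- c) ->
  EE (mu R {set 'I_(l + q * d)}) (fun x =>
    ((degH (Gs W x) (iota @: [set: 'I_l]%SET) != 0%N) &&
     ((degH (Gs W x) (iota @: [set: 'I_l]%SET))%:R < (theta - e) * ('C(l + q * d - l, d))%:R))%:R)
  <= 2 / e * expR (- c) ^+ q.
Proof.
set n := (l + q * d)%N => q0 iI et la0 rate; set L := iota @: _.
pose B := 'I_q; pose T := ('I_l + B * 'I_d)%type.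
have cV : #|'I_n| = #|{: T}| by rewrite card_sum card_prod !card_ord.
pose pl := placements k B iota.
have a0 := half_below e0 et theta1.
pose re (s : {ffun T -> 'I_n}) (x : cubeT R {set 'I_n}) : cubeT R {set T} := fun C => x (s @: C).
pose D (x : cubeT R {set 'I_n}) : R := degB W (fun C : rle k l =>
  x (iota @: [set a : 'I_l | widen_ord (ltnW lk) a \in val C]%SET)).
have DE s x : s \in pl -> bdeg lk W (re s x) = D x.
  move=> /placementP[_ sL]; congr (degB W _); apply/funext => C; rewrite /re; congr x.
  by rewrite /body_map -(imset_comp s inl); apply: eq_imset => a; rewrite /= sL.
have ebE s b x : s \in pl -> (s @: arm lk b \in Gs W x) = eb W (arm lk b) (re s x).
  move=> /placementP[sI _]; have := pb_Gs hW x sI => /setP/(_ (arm lk b)).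
  by rewrite !inE card_arm eqxx.
(* The two failures are [f0], an edge in spite of conditional degree 0, and [f1], few edges in spite
   of a non-zero one. One fixed arm is enough for [f0], because some placement sends it onto any
   given edge over [L]. *)
pose f0 (y : cubeT R {set T}) : R := (bdeg lk W y == 0)%:R * (eb W (arm lk (Ordinal q0 : B)) y)%:R.
pose f1 (y : cubeT R {set T}) : R := (bdeg lk W y != 0)%:R *
  ((\sum_(b : B) (eb W (arm lk b) y)%:R < (theta - e / 2) * #|B|%:R)%R : bool)%:R.
have bf0 : bmf f0 by apply: bmfM; [exact: bmf_bdeg_eq0|exact: bmf_eb].
have bf1 : bmf f1.
  apply: bmfM.
    apply: (@eq_bmf _ _ _ (fun x => 1 - (bdeg lk W x == 0)%:R)).
      by move=> x; case: eqP; rewrite ?subrr ?subr0.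
    by apply: bmfB; [exact: bmf_cst|exact: bmf_bdeg_eq0].
  have [mS _] : bmf (fun x : cubeT R {set T} => \sum_(b : B) (eb W (arm lk b) x)%:R : R).
    by apply: bmf_sum => b _; exact: bmf_eb.
  apply: bmf_bool; rewrite (_ : [set x | _] = setT `&`
    (fun x : cubeT R {set T} => \sum_(b : B) (eb W (arm lk b) x)%:R) @^-1`
      `]-oo, ((theta - e / 2) * #|B|%:R)[).
    by apply: mS => //; exact: measurable_itv.
  by rewrite setTI; apply/seteqP; split => x /=; rewrite in_itv.
have bre (f : cubeT R {set T} -> R) s : bmf f -> bmf (fun x => f (re s x)).
  by move=> bf; apply: (@bmf_comp _ _ _ _ _ f) bf; exact: measurable_reindex.
have Ere (f : cubeT R {set T} -> R) s : s \in pl -> bmf f ->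
    EE (mu R {set 'I_n}) (fun x => f (re s x)) = EE (mu R {set T}) f.
  by move=> /placementP[sI _] bf; rewrite -(EI_reindex (imset_inj sI) bf).
have pl0 : 0 < #|pl|%:R :> R by rewrite ltr0n placements_gt0.
have e2 : 0 < e / 2 by rewrite divr_gt0.
apply: (@le_trans _ _ (EE (mu R {set 'I_n}) (fun x =>
  \sum_(s in pl) f0 (re s x) + (2 / e / #|pl|%:R) * \sum_(s in pl) f1 (re s x)))).
  apply: EE_le.
  - exact: (bmf_Gs hW (fun H => ((degH H L != 0%N) && ((degH H L)%:R < (theta - e) * ('C(n - l, d))%:R))%:R)).
  - apply: bmfD; first by apply: bmf_sum => s _; exact: bre.
    by apply: bmfZ; apply: bmf_sum => s _; exact: bre.
  move=> x; have uG : uniform k (Gs W x) by move=> A; rewrite inE => /andP[/eqP].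
  have g0 : 0 <= \sum_(s in pl) f0 (re s x) by apply: sumr_ge0 => s _; rewrite mulr_ge0.
  have g1 : 0 <= 2 / e / #|pl|%:R * \sum_(s in pl) f1 (re s x).
    apply: mulr_ge0; first by rewrite !divr_ge0// ltW.
    by apply: sumr_ge0 => s _; rewrite mulr_ge0.
  case: (boolP (degH _ _ != 0%N)) => dH /=; last by rewrite addr_ge0.
  case: ltP => low /=; last by rewrite addr_ge0.
  have [D0|D0] := eqVneq (D x) 0.
    have [A /andP[AG LA]] : exists A, (A \in Gs W x) && (L \subset A).
      apply: contrapT => nA; case/negP: dH; rewrite /degH big1// => A HA.
      by case: nA; exists A.
    have [s sP sA] := placement_exists lk cV iI (Ordinal q0 : B) (uG _ AG) LA.
    rewrite -[leLHS]addr0 lerD// (bigD1 s)//= -[leLHS]addr0 lerD//; last first.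
      by apply: sumr_ge0 => s' _; rewrite mulr_ge0.
    by rewrite /f0 DE// D0 eqxx -ebE// sA AG mulr1.
  have := low_degree_placements (B := B) lk cV iI (a := theta - e / 2) (u := theta - e) uG.
  rewrite !card_ord => /(_ q0 a0); rewrite -/n -/pl => H.
  have kn : (k <= n)%N by rewrite /n -[X in (X <= _)%N](subnKC (ltnW lk)) leq_add2l leq_pmull.
  have := H kn low; rewrite (_ : theta - e / 2 - (theta - e) = e / 2); last by field.
  move=> H1; apply: (@le_trans _ _ (2 / e / #|pl|%:R * \sum_(s in pl) f1 (re s x))); last by rewrite lerDr.
  rewrite (_ : 2 / e / #|pl|%:R = (e / 2 * #|pl|%:R)^-1); last by rewrite !invfM invrK; ring.
  rewrite mulrC ler_pdivlMr ?mulr_gt0// mul1r; apply: le_trans H1 _; rewrite le_eqVlt; apply/orP; left; apply/eqP.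
  apply: eq_bigr => s sP; rewrite /f1 DE// D0 mul1r card_ord; congr (nat_of_bool (_ < _))%:R.
  by apply: eq_bigr => b _; rewrite ebE.
rewrite EED; last 2 first.
- by apply: bmf_sum => s _; exact: bre.
- by apply: bmfZ; apply: bmf_sum => s _; exact: bre.
rewrite EEZ; last by apply: bmf_sum => s _; exact: bre.
rewrite !EE_sum; try by move=> s _; exact: bre.
rewrite big1 ?add0r; last by move=> s sP; rewrite Ere// EE_bdeg_eq0.
rewrite -(mulrA (2 / e)) ler_pM2l ?divr_gt0// mulrC ler_pdivrMr//.
apply: (@le_trans _ _ (\sum_(s in pl) expR (- c) ^+ q)); last by rewrite sumr_const [leRHS]mulr_natr.
apply: ler_sum => s sP; rewrite Ere// -[X in _ ^+ X]card_ord.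
exact: EE_chernoff Wdeg la0 rate.
Qed.

End degree_sampling.

(** From exp(y) >= y with y = cq/(l+1), raised to the power [l + 1]. The exponent exceeds [l] by one
    so that a union bound over about q^l sets still decays like 1/q. *)
Lemma poly_exp_bound (R : realType) (c : R) (l q : nat) : 0 < c -> (0 < q)%N ->
  q%:R ^+ l * expR (- c) ^+ q <= (l.+1%:R / c) ^+ l.+1 / q%:R.
Proof.
move=> c0 q0; have q0' : 0 < q%:R :> R by rewrite ltr0n.
pose y := c * q%:R / l.+1%:R.
have y0 : 0 < y by rewrite divr_gt0// mulr_gt0.
have E : expR (- c) ^+ q = (expR y ^+ l.+1)^-1.
  rewrite -!expRM_natl -expRN; congr expR; rewrite /y; field.
  by rewrite nat1r pnatr_eq0.
have H : expR (- c) ^+ q <= (y ^+ l.+1)^-1.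
  rewrite E lef_pV2 ?posrE ?exprn_gt0 ?expR_gt0//.
  apply: lerXn2r; rewrite ?nnegrE ?expR_ge0 ?ltW//.
  by apply: lt_le_trans (expR_ge1Dx y); rewrite ltrDr.
apply: (le_trans (ler_wpM2l _ H)); first by rewrite exprn_ge0.
have -> : y = (l.+1%:R / c)^-1 * q%:R by rewrite /y invf_div mulrAC.
rewrite exprMn invfM exprVn invrK (exprSr q%:R) invfM mulrCA mulVKf// expf_neq0//.
by rewrite gt_eqF.
Qed.

Lemma markov_sqr (R : realType) (x y eps : R) : 0 < eps ->
  (eps <= `|x - y|)%R%:R <= (x - y) ^+ 2 / eps ^+ 2.
Proof.
move=> e0; case: (lerP eps _) => H; last by rewrite mulr_ge0 ?sqr_ge0// invr_ge0 sqr_ge0.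
rewrite ler_pdivlMr ?exprn_gt0// mul1r -(real_normK (num_real (x - y))).
by apply: lerXn2r; rewrite ?nnegrE// ltW.
Qed.

Lemma EE_deviation (R : realType) (k n : nat) (W : cubeT R (rlt k) -> R) (T : finType) (E : {set {set T}})
    (eps : R) : hyperB W -> (0 < n)%N -> (0 < k)%N -> uniform k E -> 0 < eps ->
  EE (mu R {set 'I_n}) (fun x => (eps <= `|mavg (Gs W x) (fun H => (E \subset H)%:R) - tau W E|)%R%:R)
  <= 6 * (#|T| * #|T|)%:R / eps ^+ 2 / n%:R.
Proof.
move=> hW n0 k0 uE e0; rewrite (mulrAC _ (eps ^+ 2)^-1).
have bm : bmf (fun x : cubeT R {set 'I_n} => mavg (Gs W x) (fun H => (E \subset H)%:R) : R).
  exact: (bmf_Gs hW (fun H => mavg H (fun H' => (E \subset H')%:R))).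
have b2 : bmf (fun x : cubeT R {set 'I_n} => (mavg (Gs W x) (fun H => (E \subset H)%:R) - tau W E) ^+ 2).
  by apply: bmfX; apply: bmfB => //; exact: bmf_cst.
apply: (@le_trans _ _ (EE (mu R {set 'I_n}) (fun x =>
  (eps ^+ 2)^-1 * (mavg (Gs W x) (fun H => (E \subset H)%:R) - tau W E) ^+ 2))).
  apply: EE_le => [||x].
  - exact: (bmf_Gs hW (fun H => (eps <= `|mavg H (fun H' => (E \subset H')%:R) - tau W E|)%R%:R)).
  - exact: bmfZ.
  - by rewrite [leRHS]mulrC; exact: markov_sqr.
rewrite EEZ// mulrC ler_pM2r ?invr_gt0 ?exprn_gt0//.
exact: EE_mavg_variance.
Qed.

Lemma sum_ge_in (R : realType) (I : Type) (s : seq I) (f : I -> R) i : (forall i, 0 <= f i) ->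
  List.In i s -> f i <= \sum_(j <- s) f j.
Proof.
move=> f0; elim: s => [//|j s IH] /= [->|/IH H]; rewrite big_cons; first by rewrite lerDl sumr_ge0.
by apply: le_trans H _; rewrite lerDr.
Qed.

(** * Existence of good samples *)

Section sampling_theorem.
Context (R : realType) (k l : nat) (lk : (l < k)%N) (W : cubeT R (rlt k) -> R).
Hypothesis hW : hyperB W.
Local Notation d := (k - l)%N.
Variables (theta e : R).
Hypothesis e0 : 0 < e.
Hypothesis theta1 : theta <= 1.
Hypothesis Wdeg : mu R (rle k l) [set x | 0 < degB W x < theta] = 0%E.
Hypothesis Wnz : 0 < theta -> EE (mu R (rlt k)) W != 0.

(** [g] counts defects: emptiness of the sample, on which [kdelta] would be 0, and each [l]-tuple of
    positive but low degree. A value below 1 means that there is no defect. *)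
Lemma degree_sampling : exists2 K : R, 0 <= K & forall q : nat, (0 < q)%N ->
  exists g : {set {set 'I_(l + q * d)}} -> R,
    [/\ (forall H, 0 <= g H),
        EE (mu R {set 'I_(l + q * d)}) (fun x => g (Gs W x)) <= K / q%:R &
        forall (H : {set {set 'I_(l + q * d)}}) (uH : [forall A in H, #|A| == k]), g H < 1 ->
          (theta - e) * ('C(l + q * d - l, d))%:R <= (kdelta l (KGraph uH))%:R].
Proof.
have [te|et] := leP theta e.
  exists 0 => // q q0; exists (fun=> 0); split => //.
    by rewrite mul0r (EE_cst (mu R {set 'I_(l + q * d)})).
  move=> H uH _; apply: (@le_trans _ _ 0); last exact: ler0n.
  by rewrite mulr_le0_ge0// subr_le0.
have th0 : 0 < theta := lt_trans e0 et.
have /andP[a0 a1] := half_below e0 et theta1.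
have at_ : 0 < theta - e / 2 < theta by rewrite a0 gtrBl divr_gt0.
have [la [c [la0 c0 rate]]] := chernoff_rate at_ theta1.
pose p := EE (mu R (rlt k)) W.
have k0 : (0 < k)%N := leq_ltn_trans (leq0n l) lk.
have uE1 : uniform k [set [set: 'I_k]]%SET by move=> A /set1P ->; rewrite cardsT card_ord.
have p0 : 0 < p.
  rewrite lt_neqAle eq_sym Wnz// andTb /p -(tau_edge hW).
  by case/andP: (tau01 hW [set [set: 'I_k]]%SET).
(* An empty sample deviates from the edge density [p] by [p], so the second moment bound is used at
   distance [p]. *)
pose K1 : R := 6 * (k * k)%:R / p ^+ 2.
(* Union bound over at most ((l+d)q)^l tuples, each failing with probability at most (2/e) exp(-cq),
   evaluated by [poly_exp_bound]. *)
pose K2 : R := 2 / e * (l + d)%:R ^+ l * (l.+1%:R / c) ^+ l.+1.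
have K10 : 0 <= K1 by rewrite !mulr_ge0// invr_ge0 sqr_ge0.
have K20 : 0 <= K2.
  by rewrite /K2 !mulr_ge0 ?exprn_ge0// ?divr_ge0// ?invr_ge0 ltW.
exists (K1 + K2) => [|q q0]; first exact: addr_ge0.
set n := (l + q * d)%N.
pose C : R := ('C(n - l, d))%:R.
pose bad (H : {set {set 'I_n}}) (i : {ffun 'I_l -> 'I_n}) : R :=
  ((degH H (i @: [set: 'I_l]%SET) != 0%N) && ((degH H (i @: [set: 'I_l]%SET))%:R < (theta - e) * C))%:R.
pose g (H : {set {set 'I_n}}) : R := (H == finset.set0)%:R +
  \sum_(i : {ffun 'I_l -> 'I_n} | injectiveb i) bad H i.
have bad0 H i : 0 <= bad H i by rewrite /bad.
have n0 : (0 < n)%N.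
  by rewrite /n; case: (l) lk => [|l'] lk' //; rewrite add0n muln_gt0 q0 subn_gt0.
have qn : q%:R <= n%:R :> R.
  rewrite ler_nat /n; apply: leq_trans (leq_addl _ _); by rewrite leq_pmulr// subn_gt0.
exists g; split=> [H||H uH].
- by rewrite addr_ge0// sumr_ge0.
- rewrite /g EED; last 2 first.
  + exact: (bmf_Gs hW (fun H => (H == finset.set0)%:R)).
  + exact: (bmf_Gs hW (fun H => \sum_(i : {ffun 'I_l -> 'I_n} | injectiveb i) bad H i)).
  rewrite mulrDl; apply: lerD.
    apply: (@le_trans _ _ (K1 / n%:R)); last by rewrite ler_wpM2l// lef_pV2 ?posrE ?ltr0n.
    have := EE_deviation hW n0 k0 uE1 p0; rewrite tau_edge// -/p card_ord; apply: le_trans.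
    apply: EE_le => [||x].
    + exact: (bmf_Gs hW (fun H => (H == finset.set0)%:R)).
    + exact: (bmf_Gs hW (fun H => (p <= `|mavg H (fun H' => ([set [set: 'I_k]]%SET \subset H')%:R) - p|)%R%:R)).
    case: eqP => [->|_] //=.
    have -> : mavg (finset.set0 : {set {set 'I_n}}) (fun H => ([set [set: 'I_k]]%SET \subset H)%:R) = 0 :> R.
      by rewrite /mavg big1 ?mul0r// => f _; rewrite finset.sub1set !inE.
    by rewrite sub0r normrN gtr0_norm// lexx.
  rewrite EE_sum; last by move=> i _; exact: (bmf_Gs hW (fun H => bad H i)).
  apply: (@le_trans _ _ (\sum_(i : {ffun 'I_l -> 'I_n}) (2 / e * expR (- c) ^+ q))).
    rewrite [leRHS](bigID (fun i : {ffun 'I_l -> 'I_n} => injectiveb i))/= -[leLHS]addr0; apply: lerD.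
      apply: ler_sum => i /injectiveP iI.
      exact: (EE_low_degree lk hW e0 theta1 Wdeg q0 iI et la0 rate).
    by apply: sumr_ge0 => i _; rewrite mulr_ge0 ?exprn_ge0 ?expR_ge0// ltW// divr_gt0.
  rewrite sumr_const card_ffun !card_ord -[_ *+ _]mulr_natr natrX.
  have nq : n%:R <= (l + d)%:R * q%:R :> R.
    by rewrite -natrM ler_nat /n mulnDl (mulnC q) leq_add2r leq_pmulr.
  apply: (@le_trans _ _ (2 / e * expR (- c) ^+ q * ((l + d)%:R * q%:R) ^+ l)).
    apply: ler_wpM2l; first by rewrite mulr_ge0 ?exprn_ge0 ?expR_ge0// ltW// divr_gt0.
    by apply: lerXn2r; rewrite ?nnegrE// mulr_ge0.
  rewrite exprMn (_ : _ * _ = 2 / e * (l + d)%:R ^+ l * (q%:R ^+ l * expR (- c) ^+ q)); last by ring.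
  rewrite /K2 -(mulrA (2 / e * _)); apply: ler_wpM2l; last exact: poly_exp_bound.
  by rewrite mulr_ge0 ?exprn_ge0// ltW// divr_gt0.
rewrite /g => gE; apply: (kdelta_ge (ltnW lk)) => /=.
  by apply/negP => /eqP E0; move: gE; rewrite E0 eqxx /= -[ltRHS]addr0 ltrD2l ltNge sumr_ge0.
move=> L Ll; rewrite kdegE => dL; rewrite leNgt; apply/negP => low.
have [i iI iL] : exists2 i : {ffun 'I_l -> 'I_n}, injective i & i @: [set: 'I_l]%SET = L.
  have [i [iI iL]] := enum_set_inj Ll; exists (finfun i).
    by move=> a b; rewrite !ffunE => /iI.
  by rewrite -iL; apply: eq_imset => a; rewrite ffunE.
move: gE; rewrite (bigD1 i)/=; last exact/injectiveP.
rewrite ltNge => /negP; apply; rewrite /bad iL /degH dL low /= addrCA lerDl addr_ge0//.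
exact: sumr_ge0.
Qed.

(** All requirements are summed into one count of defects whose expectation is below 1; some point
    has value below 1 and hence no defect at all. *)
Lemma sampling_exists (Fam : kgraph k -> Prop) (Fs : seq (kgraph k)) (M : nat) :
  (forall F, Fam F -> tau W (kE F) = 0) ->
  exists G : kgraph k, [/\ (M <= kv G)%N, kfree Fam G,
    (forall F, List.In F Fs -> `|tG R F G - tau W (kE F)| < e) &
    (theta - e) * ('C(kv G - l, d))%:R <= (kdelta l G)%:R].
Proof.
move=> WF; have [K K0 HK] := degree_sampling.
have k0 : (0 < k)%N := leq_ltn_trans (leq0n l) lk.
pose K1 (F : kgraph k) : R := 6 * (kv F * kv F)%:R / e ^+ 2.
have K10 F : 0 <= K1 F by rewrite !mulr_ge0// invr_ge0 sqr_ge0.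
pose K2 := K + \sum_(F <- Fs) K1 F.
have K20 : 0 <= K2 by rewrite addr_ge0// sumr_ge0.
(* The expected number of defects is at most K2/q, so any [q] beyond [K2] will do; [M] ensures the
   size. *)
pose q := maxn M (Num.truncn K2).+1.
have q0 : (0 < q)%N by rewrite leq_max orbT.
have Kq : K2 < q%:R.
  by apply: lt_le_trans (truncnS_gt _) _; rewrite ler_nat leq_maxr.
have [g [g0 gE gK]] := HK q q0; set n := (l + q * d)%N in g g0 gE gK.
have qn : (q <= n)%N by rewrite /n; apply: leq_trans (leq_addl _ _); rewrite leq_pmulr// subn_gt0.
have n0 : (0 < n)%N := leq_trans q0 qn.
have uk (F : kgraph k) : uniform k (kE F) by move=> A /card_kE.
pose dev (F : kgraph k) (H : {set {set 'I_n}}) : R :=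
  (e <= `|mavg H (fun H' => (kE F \subset H')%:R) - tau W (kE F)|)%R%:R.
pose nofree (H : {set {set 'I_n}}) : Prop :=
  exists F, Fam F /\ exists f : 'I_(kv F) -> 'I_n, injective f /\ forall A, A \in kE F -> f @: A \in H.
pose bad (H : {set {set 'I_n}}) : R := g H + \sum_(F <- Fs) dev F H + (`[< nofree H >])%:R.
have Ebad : EE (mu R {set 'I_n}) (fun x => bad (Gs W x)) < 1.
  rewrite /bad EED; last 2 first.
  - exact: (bmf_Gs hW (fun H => g H + \sum_(F <- Fs) dev F H)).
  - exact: (bmf_Gs hW (fun H => (`[< nofree H >])%:R)).
  rewrite EED; last 2 first.
  - exact: (bmf_Gs hW g).
  - exact: (bmf_Gs hW (fun H => \sum_(F <- Fs) dev F H)).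
  have -> : EE (mu R {set 'I_n}) (fun x => (`[< nofree (Gs W x) >])%:R) = 0.
    (* [Fam] may be infinite, but on [n] vertices there are finitely many systems [H]. Each one
       containing a copy of a member of [Fam] has probability at most the density of that member,
       which is 0. *)
    transitivity (EE (mu R {set 'I_n}) (fun x => \sum_H (`[< nofree H >])%:R * (Gs W x == H)%:R)).
      congr (EE _ _); apply/funext => x; rewrite (bigD1 (Gs W x))//= eqxx mulr1 big1 ?addr0// => H.
      by rewrite eq_sym => /negbTE ->; rewrite mulr0.
    have bH H : bmf (fun x : cubeT R {set 'I_n} => (Gs W x == H)%:R : R).
      exact: (bmf_Gs hW (fun H' => (H' == H)%:R)).
    rewrite EE_sum; last by move=> H _; exact: bmfZ.
    rewrite big1// => H _; rewrite EEZ//.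
    case: asboolP => [[F [FF [f [fI fH]]]]|_]; last by rewrite mul0r.
    rewrite mul1r; apply/eqP; rewrite eq_le EE_ge0 ?andbT//.
    rewrite -(WF F FF) -(tau_imset hW fI (uk F)) -EE_Gs//; last first.
      by move=> _ /imsetP[A AF ->]; rewrite card_imset// uk.
    apply: EE_le => // [|x]; first exact: (bmf_Gs hW (fun H => (_ \subset H)%:R)).
    case: eqP => [->|_] //=.
    rewrite (_ : _ \subset H)//; apply/fintype.subsetP => _ /imsetP[A AF ->]; exact: fH.
  rewrite addr0 EE_sum; last by move=> F _; exact: (bmf_Gs hW (dev F)).
  apply: (@le_lt_trans _ _ (K / q%:R + \sum_(F <- Fs) K1 F / q%:R)).
    apply: lerD => //; apply: ler_sum => F _.
    apply: (@le_trans _ _ (K1 F / n%:R)).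
      by have := EE_deviation hW n0 k0 (uk F) e0; rewrite card_ord.
    by rewrite ler_wpM2l// lef_pV2 ?posrE ?ltr0n// ler_nat.
  by rewrite -mulr_suml -mulrDl ltr_pdivrMr ?ltr0n// mul1r.
have [x xb] := exists_lt_EE (bmf_Gs hW bad) Ebad.
have uG : [forall A in Gs W x, #|A| == k] by apply/forall_inP => A; rewrite inE => /andP[].
have dev0 F : 0 <= dev F (Gs W x) by rewrite /dev.
have sdev0 : 0 <= \sum_(F <- Fs) dev F (Gs W x) by exact: sumr_ge0.
have asb0 : 0 <= (`[< nofree (Gs W x) >])%:R :> R by [].
exists (KGraph uG); split => /=.
- by apply: leq_trans qn; exact: leq_maxl.
- move=> F FF [f [fI fG]]; move: xb; rewrite /bad ltNge => /negP; apply.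
  have -> : `[< nofree (Gs W x) >] = true by apply/asboolP; exists F; split => //; exists f.
  by rewrite lerDr addr_ge0.
- move=> F FFs; rewrite ltNge; apply/negP => eF; move: xb; rewrite /bad ltNge => /negP; apply.
  have d1 : dev F (Gs W x) = 1 by rewrite /dev -(tG_mavg R F (KGraph uG)) eF.
  have := sum_ge_in (f := fun F => dev F (Gs W x)) dev0 FFs; rewrite d1 => s1.
  by rewrite -[leLHS]addr0 lerD// -[leLHS]add0r lerD.
- by apply: gK; apply: le_lt_trans xb; rewrite /bad -addrA lerDl addr_ge0.
Qed.

End sampling_theorem.

(** * The extremal problem *)

Lemma limn_esup01 (R : realType) (u : nat -> R) : (forall n, 0 <= u n <= 1) ->
  exists c : R, [/\ limn_esup (fun n => (u n)%:E) = c%:E, 0 <= c <= 1,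
    (forall e, 0 < e -> exists N, forall n, (N <= n)%N -> u n <= c + e) &
    (forall e N, 0 < e -> exists2 n, (N <= n)%N & c - e <= u n)].
Proof.
move=> u01; pose v n := (u n)%:E; set L := limn_esup v.
have LE : L = ereal_inf (range (esups v)).
  by rewrite /L limn_esup_lim; apply: cvg_lim => //; exact: cvg_esups_inf.
have v_le n m : (n <= m)%N -> (v m <= esups v n)%E.
  by move=> nm; apply: ereal_sup_ubound; exists m.
have L0 : (0 <= L)%E.
  rewrite LE; apply: le_ereal_inf_tmp => _ [n _ <-].
  by apply: le_trans (v_le n n (leqnn n)); rewrite lee_fin; case/andP: (u01 n).
have L1 : (L <= 1)%E.
  rewrite LE; apply: (@le_trans _ _ (esups v 0%N)); first by apply: ereal_inf_lbound; exists 0%N.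
  by apply: ge_ereal_sup => _ [n _ <-]; rewrite lee_fin; case/andP: (u01 n).
have Lfin : L \is a fin_num by rewrite fin_numE; apply/andP; split; apply: contraTneq isT => E;
  [move: L0|move: L1]; rewrite E.
exists (fine L); rewrite fineK//; split => //.
- by rewrite -!lee_fin fineK// L0 L1.
- move=> e e0; have /(lb_ereal_inf_adherent e0)[_ [N _ <-] HN] : ereal_inf (range (esups v)) \is a fin_num by rewrite -LE.
  exists N => n Nn; rewrite -lee_fin EFinD fineK//; apply: le_trans (v_le N n Nn) _.
  by rewrite LE ltW.
- move=> e N e0; apply: contrapT => nex.
  have : (L <= (fine L - e)%:E)%E.
    rewrite [leLHS]LE; apply: (@le_trans _ _ (esups v N)); first by apply: ereal_inf_lbound; exists N.
    apply: ge_ereal_sup => _ [n /= Nn <-]; rewrite lee_fin leNgt; apply/negP => H.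
    by case: nex; exists n => //; exact: ltW.
  by rewrite -[X in (X <= _)%E]fineK// lee_fin lerBrDr gerDl leNgt e0.
Qed.

(** An edge through a fixed [l]-set is determined by its part outside this set. *)
Lemma kdelta_le_bin k l (G : kgraph k) : (l <= k)%N -> (kdelta l G <= 'C(kv G - l, k - l))%N.
Proof.
move=> lk; have [E0|/set0Pn[A AE]] := eqVneq (kE G) finset.set0.
  apply: (@leq_trans 0%N) => //; rewrite /kdelta E0.
  by rewrite cards0; apply/bigmax_leqP => -[m /=]; rewrite ltnS.
have sA : size (take l (enum A)) = l by rewrite size_takel// -cardE (card_kE AE).
pose L : {set 'I_(kv G)} := [set x in take l (enum A)]%SET.
have Ll : #|L| = l by rewrite cardsE (card_uniqP _) ?take_uniq ?enum_uniq.
have LA : L \subset A by apply/fintype.subsetP => x; rewrite inE => /mem_take; rewrite mem_enum.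
have dL : kdeg L != 0%N by rewrite kdegE (bigD1 A)//= AE.
apply: leq_trans (kdelta_le Ll dL) _; rewrite kdegE sum1dep_card.
have <- : #|(~: L)%SET| = (kv G - l)%N by rewrite -[in RHS](card_ord (kv G)) -(cardsC L) Ll addKn.
rewrite -cards_draws.
have DI : {in [set A in kE G | L \subset A]%SET &, injective (fun A : {set 'I_(kv G)} => (A :\: L)%SET)}.
  have E (C : {set 'I_(kv G)}) : L \subset C -> (L :|: (C :\: L))%SET = C.
    by move=> LC; rewrite -{1}(finset.setIidPr LC) finset.setID.
  by move=> C C'; rewrite !inE => /andP[_ LC] /andP[_ LC'] CC'; rewrite -(E C LC) CC' E.
rewrite -(card_in_imset DI); apply: subset_leq_card; apply/fintype.subsetP => _ /imsetP[C + ->].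
rewrite !inE => /andP[CE LC]; rewrite cardsD (finset.setIidPr LC) (card_kE CE) Ll eqxx andbT.
by apply/fintype.subsetP => x; rewrite !inE => /andP[].
Qed.

(** Allows one sample to approximate all the densities of graphs with at most [n] vertices at
    once. *)
Lemma kgraph_list k (n : nat) : exists Fs : seq (kgraph k), forall F, (kv F <= n)%N -> List.In F Fs.
Proof.
have H m : exists Fs : seq (kgraph k), forall F, kv F = m -> List.In F Fs.
  pose mk (E : {set {set 'I_m}}) : option (kgraph k) :=
    if pselect [forall A in E, #|A| == k] is left uE then Some (KGraph uE) else None.
  exists (pmap mk (enum {: {set {set 'I_m}}})) => -[n' E uE] /= E'; subst n'.
  have : E \in enum {: {set {set 'I_m}}} by rewrite mem_enum.
  have mkE : mk E = Some (KGraph uE).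
    by rewrite /mk; case: pselect => [uE'|//]; rewrite (bool_irrelevance uE uE').
  elim: (enum _) => [//|E' s IH]; rewrite in_cons => /predU1P[<-|/IH sF] /=.
    by rewrite mkE /=; left.
  by case: (mk E') => [F|] //=; right.
elim: n => [|n [Fs IH]].
  by have [Fs HF] := H 0%N; exists Fs => F; rewrite leqn0 => /eqP; exact: HF.
have [Fs' HF] := H n.+1; exists (Fs ++ Fs') => F.
rewrite leq_eqVlt ltnS => /predU1P[/HF|/IH] FF; apply: List.in_or_app; by [right|left].
Qed.

Definition borel_version (R : realType) k (W : (rlt k -> R) -> R) (W' : cubeT R (rlt k) -> R) : Prop :=
  [/\ hyperB W', forall F : kgraph k, tW F W = tau W' (kE F),
    Wzero W <-> EE (mu R (rlt k)) W' = 0 &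
    forall l, (l < k)%N -> ((0 <= deltaW l W <= 1)%E /\ forall d : R, ~ Wzero W ->
      ((d%:E <= deltaW l W)%E <-> mu R (rle k l) [set x | 0 < degB W' x < d] = 0%E))].

Lemma hyperB_borel_version (R : realType) k (W : cubeT R (rlt k) -> R) : hyperB W -> borel_version W W.
Proof.
move=> hW; have [_ W01 _] := hW; have W01' x (_ : incube x) := W01 x.
have N0 : mu R (rlt k) set0 = 0%E by exact: measure0.
have WW x (_ : incube x) (_ : ~ set0 x) : W x = W x by [].
split => //; first exact: tW_tau W01' hW measurable0 N0 WW.
  exact: Wzero_EE hW measurable0 N0 WW.
move=> l lk; split; first exact: deltaW_range lk W01' hW measurable0 N0 WW.
exact: deltaW_ge lk W01' hW measurable0 N0 WW.
Qed.

Section main.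
Context (R : realType) (k l : nat) (Fam : kgraph k -> Prop).
Hypothesis lk : (l < k)%N.
Hypothesis Fam0 : forall F, Fam F -> kE F != finset.set0.

Definition ratio (G : kgraph k) : R := (kdelta l G)%:R / ('C(kv G - l, k - l))%:R.

Lemma ratio_le_coex G : kfree Fam G -> (kdelta l G)%:R <= coex R l Fam (kv G).
Proof.
move=> fG; apply: ub_le_sup; last by exists G.
exists ('C(kv G - l, k - l))%:R => _ [G' [GG' _] <-]; rewrite -GG' ler_nat.
exact/kdelta_le_bin/ltnW.
Qed.

(** Members of [Fam] have an edge, so the edgeless graph on [n] vertices is free and the supremum
    runs over a non-empty set. *)
Lemma has_sup_coex n :
  has_sup [set ((kdelta l G)%:R : R) | G in [set G : kgraph k | kv G = n /\ kfree Fam G]].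
Proof.
split; last first.
  exists ('C(n - l, k - l))%:R => _ [G' [<- _] <-]; rewrite ler_nat.
  exact/kdelta_le_bin/ltnW.
have u0 : [forall A in (finset.set0 : {set {set 'I_n}}), #|A| == k].
  by apply/forall_inP => A; rewrite inE.
exists (kdelta l (KGraph u0))%:R; exists (KGraph u0) => //; split => // F FF [f [fI fG]].
by have /set0Pn[A /fG] := Fam0 FF; rewrite /= inE.
Qed.

Lemma coex_ratio01 n : 0 <= coex R l Fam n / ('C(n - l, k - l))%:R <= 1.
Proof.
have [ne ub] := has_sup_coex n; have [_ [G [Gn fG] _]] := ne.
have c0 : 0 <= coex R l Fam n.
  by rewrite -Gn; apply: le_trans (ratio_le_coex fG); exact: ler0n.
rewrite divr_ge0//=; have [C0|C0] := posnP 'C(n - l, k - l).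
  by rewrite C0 invr0 mulr0 ler01.
rewrite ler_pdivrMr ?ltr0n// mul1r; apply: ge_sup => // _ [G' [<- _] <-].
by rewrite ler_nat; exact/kdelta_le_bin/ltnW.
Qed.

Lemma gamma_real : exists c : R, [/\ gammaP R l Fam = c%:E, 0 <= c <= 1,
  (forall e, 0 < e -> exists N, forall G, kfree Fam G -> (N <= kv G)%N -> ratio G <= c + e) &
  (forall e N, 0 < e -> exists G, [/\ kfree Fam G, (N <= kv G)%N & c - e <= ratio G])].
Proof.
have [c [cE c01 up low]] := limn_esup01 coex_ratio01; exists c; split => //.
  move=> e /up[N HN]; exists N => G fG /HN; apply: le_trans.
  by rewrite ler_wpM2r ?invr_ge0//; exact: ratio_le_coex.
move=> e N e0; have e2 : 0 < e / 2 by rewrite divr_gt0.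
(* Taking [n] at least [k] makes the binomial coefficient at least 1, so the error e/2 made in
   approaching [coex] costs at most e/2 after division. *)
have [n Nn cn] := low (e / 2) (maxn N k) e2.
have [_ [G [Gn fG] <-] HG] := sup_adherent e2 (has_sup_coex n).
have kn : (k <= n)%N := leq_trans (leq_maxr _ _) Nn.
exists G; split => //; first by rewrite Gn (leq_trans (leq_maxl _ _) Nn).
have C1 : 1 <= ('C(n - l, k - l))%:R :> R by rewrite ler1n bin_gt0 leq_sub2r.
have C0 : 0 < ('C(n - l, k - l))%:R :> R := lt_le_trans ltr01 C1.
rewrite /ratio Gn ler_pdivlMr//; move: cn; rewrite ler_pdivlMr// -/(coex R l Fam n) => cn.
have HG' : coex R l Fam n - e / 2 < (kdelta l G)%:R := HG.
apply: le_trans (ltW HG'); nra.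
Qed.

Variable c : R.
Hypothesis cE : gammaP R l Fam = c%:E.
Hypothesis c01 : 0 <= c <= 1.
Hypothesis upper : forall e, 0 < e -> exists N, forall G, kfree Fam G -> (N <= kv G)%N -> ratio G <= c + e.

(** Samples are arbitrarily large free graphs of ratio at least d - e/2, whereas all large free
    graphs have ratio at most c + e/2. *)
Lemma deltaW_le_gamma (W : (rlt k -> R) -> R) : hypergraphon W -> Wfree Fam W -> (deltaW l W <= c%:E)%E.
Proof.
move=> hyW WF; have [W' [hW' tE Wz Hd]] := hypergraphon_normal hyW.
have [Wze|nWz] := pselect (Wzero W).
  by rewrite /deltaW asboolT// lee_fin; case/andP: c01.
have [/andP[d0 d1] dE] := Hd l lk.
have dfin : deltaW l W \is a fin_num by rewrite fin_numE; apply/andP; split; apply: contraTneq isT => E;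
  [move: d0|move: d1]; rewrite E.
set d := fine (deltaW l W); have dd : deltaW l W = d%:E by rewrite fineK.
have Wdeg : mu R (rle k l) [set x | 0 < degB W' x < d] = 0%E by apply/dE => //; rewrite dd.
have d1' : d <= 1 by rewrite -lee_fin -dd.
have nz : 0 < d -> EE (mu R (rlt k)) W' != 0 by move=> _; apply/eqP => /Wz.
rewrite dd lee_fin; apply/ler_addgt0Pr => e e0; have e2 : 0 < e / 2 by rewrite divr_gt0.
have [N HN] := upper e2.
have [|G [NG fG _ dG]] := sampling_exists lk hW' e2 d1' Wdeg nz [::] (maxn N k) (Fam := Fam).
  by move=> F FF; rewrite -tE WF.
have := HN G fG (leq_trans (leq_maxl _ _) NG).
rewrite /ratio ler_pdivrMr; last first.
  by rewrite ltr0n bin_gt0 leq_sub2r// (leq_trans (leq_maxr _ _) NG).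
move=> /(le_trans dG); rewrite ler_pM2r; last first.
  by rewrite ltr0n bin_gt0 leq_sub2r// (leq_trans (leq_maxr _ _) NG).
rewrite lerBlDr -addrA -mulr2n -[_ *+ 2]mulr_natr divfK//.
Qed.

(** Stated for any proper filter finer than [\oo]: the ultrafilter serves for attaining the maximum,
    [\oo] itself for given convergent sequences. *)
Lemma deltaW_ge_gamma (W : (rlt k -> R) -> R) (W' : cubeT R (rlt k) -> R) (G : nat -> kgraph k)
    (FF : set_system nat) : borel_version W W' -> ProperFilter FF -> \oo `<=` FF ->
  (forall n, (0 < kv (G n))%N) ->
  (forall M : nat, exists N : nat, forall n, (N <= n)%N -> (M <= kv (G n))%N) ->
  (forall n, kfree Fam (G n)) ->
  (fun n => ratio (G n)) @ FF --> c ->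
  (forall F : kgraph k, (fun n => tG R F (G n)) @ FF --> tau W' (kE F)) ->
  Wfree Fam W /\ (c%:E <= deltaW l W)%E.
Proof.
move=> [hW' tE Wz Hd] PF sF G0 Goo fG Gc GW; split.
  by move=> F HF; rewrite tE (limit_free G0 PF sF GW Goo fG HF).
have [/andP[d0 _] dE] := Hd l lk.
have [c0|c0] := leP c 0; first by apply: le_trans d0; rewrite lee_fin.
apply/dE; last exact: (limit_degree lk hW' G0 PF sF GW Goo c01 Gc).
by move=> /Wz/eqP; apply/negP; exact: (limit_edge lk hW' G0 PF sF GW Goo Gc c0).
Qed.

End main.

Lemma ratio_cvg (R : realType) (k l : nat) (Fam : kgraph k -> Prop) (c : R) (G : nat -> kgraph k) :
  (forall e, 0 < e -> exists N, forall G, kfree Fam G -> (N <= kv G)%N -> ratio R l G <= c + e) ->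
  (forall n, [/\ kfree Fam (G n), (n < kv (G n))%N & c - n.+1%:R^-1 <= ratio R l (G n)]) ->
  (fun n => ratio R l (G n)) @ \oo --> c.
Proof.
move=> upper HG; apply/cvgrPdist_le => e e0.
have [N HN] := upper e e0; have [m _ Hm] := near_infty_natSinv_lt (PosNum e0).
exists (maxn N m) => // n /=; rewrite geq_max => /andP[Nn mn].
have [fG nG low] := HG n; have up := HN _ fG (leq_trans Nn (ltnW nG)).
have /= ne := Hm n mn.
by rewrite ler_distlC; apply/andP; split; [apply: le_trans low; rewrite lerD2l lerN2 ltW|].
Qed.

Theorem theorem3p1 (R : realType) (k l : nat) (Fam : kgraph k -> Prop) :
  (l < k)%N ->
  (forall F, Fam F -> kE F != finset.set0) ->
  (gammaP R l Fam =
     ereal_sup [set deltaW l W | W in [set W | hypergraphon W /\ Wfree Fam W]]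
   /\ exists W, [/\ hypergraphon W, Wfree Fam W & deltaW l W = gammaP R l Fam])
  /\ (forall W : (rlt k -> R) -> R, hypergraphon W ->
        (WplusP l Fam W <-> (Wfree Fam W /\ deltaW l W = gammaP R l Fam))).
Proof.
move=> lk Fam0; have k0 : (0 < k)%N := leq_ltn_trans (leq0n l) lk.
have [c [cE c01 upper lower]] := gamma_real R lk Fam0.
have le_c W := @deltaW_le_gamma R k l Fam lk c c01 upper W.
have attained : exists W, [/\ hypergraphon W, Wfree Fam W & deltaW l W = gammaP R l Fam].
  (* The maximum is attained at a limit, along an ultrafilter, of graphs within 1/(n+1) of the
     extremal value. *)
  have /boolp.choice[G HG] : forall n, exists G : kgraph k,
      [/\ kfree Fam G, (n < kv G)%N & c - n.+1%:R^-1 <= ratio R l G].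
    by move=> n; apply: lower; rewrite invr_gt0.
  have Gc := ratio_cvg upper HG.
  have G0 n : (0 < kv (G n))%N by have [_ nG _] := HG n; exact: leq_ltn_trans nG.
  have Goo M : exists N, forall n, (N <= n)%N -> (M <= kv (G n))%N.
    by exists M => n Mn; have [_ nG _] := HG n; exact: leq_trans Mn (ltnW nG).
  have fG n : kfree Fam (G n) by have [] := HG n.
  have [U [W [UP sU hW GW]]] := graph_limit R k0 G0.
  have [WF Wc] := deltaW_ge_gamma lk c01 (hyperB_borel_version hW) UP sU G0 Goo fG
    (fun A cA => sU _ (Gc A cA)) GW.
  exists W; split => //; first exact: hyperB_hypergraphon.
  rewrite cE; apply/eqP; rewrite eq_le Wc le_c//; exact: hyperB_hypergraphon.
split.
  split => //; apply/eqP; rewrite eq_le; apply/andP; split.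
    have [W [hyW WF WE]] := attained; rewrite -WE; apply: ereal_sup_ubound.
    by exists W.
  by apply: ge_ereal_sup => _ [W [hyW WF] <-]; rewrite cE; exact: le_c.
move=> W hyW; have [W' bv] := hypergraphon_normal hyW.
have [hW' tE Wz Hd] := bv; split.
  move=> [G [fG Goo Gc GW]]; have [N1 HN1] := Goo 1%N.
  (* The sequence is shifted by [N1] so that no graph has an empty vertex set. *)
  have [||||||WF Wc] := @deltaW_ge_gamma R k l Fam lk c c01 W W' (fun n => G (n + N1)%N) \oo bv _ _.
  - by [].
  - by move=> n; apply: HN1; exact: leq_addl.
  - move=> M; have [N HN] := Goo M; exists N => n Nn; apply: HN.
    exact: leq_trans Nn (leq_addr _ _).
  - by move=> n; exact: fG.
  - move: Gc; rewrite cE => /fine_cvgP[_ Gc].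
    by have := cvg_shiftn N1 (fun n => ratio R l (G n)) (nbhs c) => ->.
  - move=> F; have := GW F; rewrite tE => GF.
    by have := cvg_shiftn N1 (fun n => tG R F (G n)) (nbhs (tau W' (kE F))) => ->.
  by split => //; rewrite cE; apply/eqP; rewrite eq_le Wc le_c.
move=> [WF]; rewrite cE => dc.
have [_ dE] := Hd l lk.
have Wdeg : mu R (rle k l) [set x | 0 < degB W' x < c] = 0%E.
  (* For a zero [W] the convention for the threshold gives c = 0, and the interval ]0, 0[ is
     empty. *)
  have [Wze|nWz] := pselect (Wzero W); last by apply/dE => //; rewrite dc.
  have c0 : c = 0 by move: dc; rewrite /deltaW asboolT// => -[].
  have -> : [set x : cubeT R (rle k l) | 0 < degB W' x < c] = set0; last exact: measure0.
  by apply/seteqP; split => x //=; rewrite c0 => /andP[x0 /(lt_trans x0)]; rewrite ltxx.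
have nz : 0 < c -> EE (mu R (rlt k)) W' != 0.
  move=> c0; apply/eqP => /Wz Wze; move: dc c0; rewrite /deltaW asboolT// => -[<-].
  by rewrite ltxx.
have c1 : c <= 1 by case/andP: c01.
have Wtau F : Fam F -> tau W' (kE F) = 0 by move=> FF; rewrite -tE WF.
(* Diagonal choice: the n-th graph approximates all densities of graphs on at most [n] vertices
   within 1/(n+1), so each fixed density is controlled eventually. More than [n + k] vertices make
   the sizes diverge and the binomial coefficient positive. *)
have /boolp.choice[G HG] : forall n : nat, exists G : kgraph k, [/\ (n + k < kv G)%N, kfree Fam G,
    (forall F : kgraph k, (kv F <= n)%N -> `|tG R F G - tau W' (kE F)| < n.+1%:R^-1) &
    c - n.+1%:R^-1 <= ratio R l G].
  move=> n; have [Fs HFs] := kgraph_list k n.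
  have e0 : 0 < n.+1%:R^-1 :> R by rewrite invr_gt0.
  have [G [NG fG dev dG]] := sampling_exists lk hW' e0 c1 Wdeg nz Fs (n + k).+1 Wtau.
  exists G; split => // [F /HFs|]; first exact: dev.
  rewrite /ratio ler_pdivlMr// ltr0n bin_gt0 leq_sub2r//.
  by apply: leq_trans (ltnW NG); exact: leq_addl.
exists G; split.
- by move=> n; have [] := HG n.
- move=> M; exists M => n Mn; have [nG _ _ _] := HG n.
  by apply: leq_trans Mn (leq_trans (leq_addr _ _) (ltnW nG)).
- rewrite cE; apply: cvg_EFin; first exact: nearW.
  apply: (ratio_cvg upper) => n; have [nG fG _ rG] := HG n; split => //.
  by apply: leq_ltn_trans nG; exact: leq_addr.
- move=> F; rewrite tE; apply/cvgrPdist_lt => e e0.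
  have [m _ Hm] := near_infty_natSinv_lt (PosNum e0).
  exists (maxn (kv F) m) => // n /=; rewrite geq_max => /andP[Fn mn].
  have [_ _ dev _] := HG n; rewrite distrC; apply: lt_trans (dev F Fn) _.
  exact: Hm.
Qed.
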